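(* (Binary search tree.) Let $f$ be a real-valued functional of binary trees such that $f(T)=O(|T|^\alpha)$ for some $\alpha<1/2$, and let $F(T):=\sum_{v\in T}f(T(v))$. Then, as $n\to\infty$, $$\frac{\mathbb{E}(F(\mathcal{T}_n))}{n}\to\mu_F:=\sum_{k=1}^\infty\frac{2}{(k+1)(k+2)}\mathbb{E} f(\mathcal{T}_k),\qquad \frac{\mathrm{Var}(F(\mathcal{T}_n))}{n}\to\sigma_F^2:=\lim_{N\to\infty}\sum_{|T|,|T'|\le N}f(T)f(T')\sigma_{T,T'}<\infty,$$ $$\frac{F(\mathcal{T}_n)-\mathbb{E} F(\mathcal{T}_n)}{\sqrt n}\xrightarrow{d}\mathcal{N}(0,\sigma_F^2),\qquad\text{and}\qquad \frac{F(\mathcal{T}_n)-n\mu_F}{\sqrt n}\xrightarrow{d}\mathcal{N}(0,\sigma_F^2).$$ (Random recursive tree.) Let $f$ be a real-valued functional of ordered (or unordered) rooted trees such that $f(\Lambda)=O(|\Lambda|^\alpha)$ for some $\alpha<1/2$, and let $F(\Lambda):=\sum_{v\in\Lambda}f(\Lambda(v))$. Then, as $n\to\infty$, $$\frac{\mathbb{E}(F(\Lambda_n))}{n}\to\hat\mu_F:=\sum_{k=1}^\infty\frac{1}{k(k+1)}\mathbb{E} f(\Lambda_k),\qquad \frac{\mathrm{Var}(F(\Lambda_n))}{n}\to\hat\sigma_F^2:=\lim_{N\to\infty}\sum_{|\Lambda|,|\Lambda'|\le N}f(\Lambda)f(\Lambda')\hat\sigma_{\Lambda,\Lambda'}<\infty,$$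 $$\frac{F(\Lambda_n)-\mathbb{E} F(\Lambda_n)}{\sqrt n}\xrightarrow{d}\mathcal{N}(0,\hat\sigma_F^2),\qquad\text{and}\qquad \frac{F(\Lambda_n)-n\hat\mu_F}{\sqrt n}\xrightarrow{d}\mathcal{N}(0,\hat\sigma_F^2).$$ (In particular the limits defining $\sigma_F^2$ and $\hat\sigma_F^2$ exist.)
   Context: Random binary search tree $\mathcal{T}_n$: insert the keys of a uniformly random permutation of $\{1,\dots,n\}$ one by one; the first key is placed at the root, and each later key starts at the root and at each occupied node proceeds to the left child position if it is smaller than the key there and to the right child position if it is larger, until it reaches an empty position, where it is placed. It is regarded as an unlabelled binary tree (left and right children distinguished). Random recursive tree $\Lambda_n$: start with a root labelled $1$; for $i=2,\dots,n$, node $i$ is attached as a child of a uniformly random node among $1,\dots,i-1$ (independently of earlier choices). It is regarded as an ordered rooted tree by ordering the children of each node by increasing labels from left to right and then ignoring the labels, or as an unordered rooted tree by ignoring also the ordering. All trees are nonempty; $|T|$ is the number of nodes. $T(v)$ is the fringe subtree of $T$ rooted at $v$ ($v$ together with all its descendants). ''Subtree'' means fringe subtree and ''copy'' means isomorphic (as a binary, ordered or unordered tree, respectively). $\mathcal{N}(0,0)$ is the point mass at $0$. Covariance constants. For binary trees $T,T'$ of sizes $k\ge m$, let $p_{k,T}:=\mathbb{P}(\mathcal{T}_k=T)$, $p_{m,T'}:=\mathbb{P}(\mathcal{T}_m=T')$, let $q^T_{T'}$ be the number of subtrees of $T$ that are copies of $T'$, and $$\sigma_{T,T'}=\sigma_{T',T}:=\tfrac{2}{(k+1)(k+2)}q^T_{T'}p_{k,T}-\beta(k,m)p_{k,T}p_{m,T'},$$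 $$\beta(k,m):=\tfrac{4(k+m+3)}{(k+1)(k+2)(m+1)(m+2)}-\tfrac{4(k^2+3km+m^2+4k+4m+3)}{(k+1)(m+1)(k+m+1)(k+m+2)(k+m+3)}.$$ For ordered (or unordered) rooted trees $\Lambda,\Lambda'$ of sizes $k\ge m$, let $\hat p_{k,\Lambda}:=\mathbb{P}(\Lambda_k=\Lambda)$, $\hat p_{m,\Lambda'}:=\mathbb{P}(\Lambda_m=\Lambda')$, let $\hat q^\Lambda_{\Lambda'}$ be the number of subtrees of $\Lambda$ that are copies of $\Lambda'$, and $$\hat\sigma_{\Lambda,\Lambda'}=\hat\sigma_{\Lambda',\Lambda}:=\tfrac{1}{k(k+1)}\hat q^\Lambda_{\Lambda'}\hat p_{k,\Lambda}-\hat\beta(k,m)\hat p_{k,\Lambda}\hat p_{m,\Lambda'},\qquad \hat\beta(k,m):=\tfrac{k^2+km+m^2+k+m}{k(k+1)m(m+1)(k+m+1)}.$$ *)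

(* Defs.v *)
From HB Require Import structures.
From mathcomp Require Import all_boot all_order all_algebra all_fingroup.
From mathcomp Require Import generic_quotient.
From mathcomp Require Import all_classical all_reals all_analysis.

Set Implicit Arguments.
Unset Strict Implicit.
Unset Printing Implicit Defensive.

Import Order.TTheory GRing.Theory Num.Theory.
Import numFieldNormedType.Exports.

Local Open Scope ring_scope.
Local Open Scope classical_set_scope.

(** * Binary trees *)

(* [BEmpty] is an empty position (so that left and right children are
   distinguished); it is not a tree: the trees proper are the [BNode _ _], i.e.,
   those with [0 < bsize t]. *)
Inductive bintree := BEmpty | BNode of bintree & bintree.

Fixpoint bintree_enc (t : bintree) : GenTree.tree unit :=
  match t with
  | BEmpty => GenTree.Leaf tt
  | BNode l r => GenTree.Node 0 [:: bintree_enc l; bintree_enc r]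
  end.

Fixpoint bintree_dec (g : GenTree.tree unit) : bintree :=
  match g with
  | GenTree.Node _ [:: l; r] => BNode (bintree_dec l) (bintree_dec r)
  | _ => BEmpty
  end.

Lemma bintree_encK : cancel bintree_enc bintree_dec.
Proof. by elim=> //= l -> r ->. Qed.

HB.instance Definition _ := Countable.copy bintree (can_type bintree_encK).

Fixpoint bsize (t : bintree) : nat :=
  if t is BNode l r then (bsize l + bsize r).+1 else 0%N.

Fixpoint bfringe (t : bintree) : seq bintree :=
  if t is BNode l r then t :: bfringe l ++ bfringe r else [::].

(* Binary trees with a key at each node. *)
Inductive keytree := KEmpty | KNode of keytree & nat & keytree.

Fixpoint key_insert (x : nat) (t : keytree) : keytree :=
  match t with
  | KEmpty => KNode KEmpty x KEmpty
  | KNode l y r => if (x < y)%N then KNode (key_insert x l) y r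
                   else KNode l y (key_insert x r)
  end.

Fixpoint shape (t : keytree) : bintree :=
  if t is KNode l _ r then BNode (shape l) (shape r) else BEmpty.

Definition bst_of_keys (s : seq nat) : bintree :=
  shape (foldl (fun t x => key_insert x t) KEmpty s).

Definition bst n (s : 'S_n) : bintree := bst_of_keys [seq (s i).+1 | i : 'I_n].

(** * Ordered rooted trees *)

Inductive otree := ONode of seq otree.

Definition ochildren (t : otree) : seq otree := let: ONode ts := t in ts.

Fixpoint otree_enc (t : otree) : GenTree.tree unit :=
  let: ONode ts := t in GenTree.Node 0 (map otree_enc ts).

Fixpoint otree_dec (g : GenTree.tree unit) : otree :=
  if g is GenTree.Node _ gs then ONode (map otree_dec gs) else ONode [::].

Lemma otree_encK : cancel otree_enc otree_dec.
Proof.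
rewrite /cancel; fix IH 1; case=> ts /=; congr ONode.
by elim: ts => //= t ts ->; rewrite IH.
Qed.

HB.instance Definition _ := Countable.copy otree (can_type otree_encK).

Fixpoint osize (t : otree) : nat :=
  let: ONode ts := t in (sumn (map osize ts)).+1.

Fixpoint ofringe (t : otree) : seq otree :=
  let: ONode ts := t in t :: flatten (map ofringe ts).

(** * Unordered rooted trees: ordered trees up to isomorphism *)

Inductive oiso : otree -> otree -> Prop :=
  OIso (ts us vs : seq otree) of perm_eq vs us & size ts = size vs &
    (forall i, (i < size ts)%N -> oiso (nth (ONode [::]) ts i) (nth (ONode [::]) vs i)) :
    oiso (ONode ts) (ONode us).

Lemma oiso_refl t : oiso t t.
Proof.
move: t; fix IH 1; case=> ts; apply: (OIso (perm_refl ts) erefl).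
elim: ts => [|t ts IHts] [|i] lti; try discriminate lti.
  exact: (IH t).
exact: (IHts i lti).
Qed.

Lemma oiso_sym t u : oiso t u -> oiso u t.
Proof.
elim=> {t u} ts us vs; rewrite perm_sym => + eqs _ IH.
move=> /(perm_iotaP (ONode [::])) [Is pIs ->].
apply: (@OIso _ ts [seq nth (ONode [::]) ts i | i <- Is]).
- by apply/(perm_iotaP (ONode [::])); exists Is; rewrite ?eqs.
- by rewrite !size_map.
move=> i; rewrite size_map => ltiI; rewrite !(nth_map 0%N)//; apply: IH.
have : nth 0%N Is i \in iota 0 (size vs) by rewrite -(perm_mem pIs) mem_nth.
by rewrite mem_iota eqs.
Qed.

Lemma oiso_trans u t w : oiso t u -> oiso u w -> oiso t w.
Proof.
move=> tu; elim: tu w => {t u} ts us vs + eqs _ IH w uw.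
move=> /(perm_iotaP (ONode [::])) [Is pIs vsE].
inversion uw as [us' xs ws pwx eqw isow Eus Ew]; subst us' w.
apply: (@OIso _ xs [seq nth (ONode [::]) ws i | i <- Is]).
- apply: perm_trans pwx; apply/(perm_iotaP (ONode [::])).
  by exists Is; rewrite // -eqw.
- by rewrite eqs vsE !size_map.
move=> i ltit; apply: (IH i ltit).
have ltiI : (i < size Is)%N by rewrite eqs vsE size_map in ltit.
rewrite vsE !(nth_map 0%N)//; apply: isow.
have : nth 0%N Is i \in iota 0 (size us) by rewrite -(perm_mem pIs) mem_nth.
by rewrite mem_iota.
Qed.

Definition oisob : rel otree := fun t u => `[< oiso t u >].

Lemma oisob_equiv : equiv_class_of oisob.
Proof.
apply: EquivClass => [t|t u|u t w]; first exact/asboolP/oiso_refl.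
  by apply/asboolP/asboolP; exact: oiso_sym.
by move=> /asboolP tu /asboolP uw; apply/asboolP; exact: oiso_trans uw.
Qed.

Canonical oisob_equiv_rel := EquivRelPack oisob_equiv.

Definition utree := {eq_quot oisob}%qT.

HB.instance Definition _ := Choice.on utree.
HB.instance Definition _ := EqQuotient.on utree.

(* The size and the multiset of fringe subtrees do not depend on the ordered
   representative that is chosen. *)
Definition usize (t : utree) : nat := osize (repr t).

Definition ufringe (t : utree) : seq utree :=
  [seq \pi_utree%qT s | s <- ofringe (repr t)].

(** * Random recursive trees *)

(* [w i] encodes that the node with label [i + 2] is attached to the node with
   label [w i + 1], for [0 <= i < n - 1]; the uniform distribution on
   [rrt_space n] makes these choices uniform and independent. *)
Definition rrt_space (n : nat) : finType := {dffun forall i : 'I_n.-1, 'I_i.+1}.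

(* The fringe subtree at the node labelled [v]; the children are listed by
   increasing labels.  [h] bounds the number of levels, so [h = n] is enough. *)
Fixpoint rrt_from n (h : nat) (w : rrt_space n) (v : nat) : otree :=
  if h is h'.+1 then
    ONode [seq rrt_from h' w (val i).+2 | i <- enum 'I_n.-1 & (w i).+1 == v]
  else ONode [::].

Definition rrt n (w : rrt_space n) : otree := rrt_from n w 1.

(** * Random trees *)

(* A class of trees together with, for each [n], a random tree [rtree n w], where
   [w] is uniformly distributed on the finite set [rspace n]. *)
Record random_trees := RandomTrees {
  tree :> choiceType;
  tsize : tree -> nat;
  fringe : tree -> seq tree;
  rspace : nat -> finType;
  rtree : forall n, rspace n -> tree }.

Definition binary_search_trees : random_trees :=
  @RandomTrees bintree bsize bfringe (fun n => 'S_n) bst.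

Definition ordered_recursive_trees : random_trees :=
  @RandomTrees otree osize ofringe rrt_space rrt.

Definition unordered_recursive_trees : random_trees :=
  @RandomTrees utree usize ufringe rrt_space (fun n w => \pi_utree%qT (rrt w)).

(** * Uniform probability on a finite set *)

Section uniform.
Context {R : realType} {Omega : finType}.

Definition uprob (A : pred Omega) : R := #|A|%:R / #|Omega|%:R.

Definition uexp (X : Omega -> R) : R := (\sum_w X w) / #|Omega|%:R.

Definition uvar (X : Omega -> R) : R := uexp (fun w => (X w - uexp X) ^+ 2).

End uniform.

Definition cvg_in_distribution {R : realType} (Omega : nat -> finType)
    (X : forall n, Omega n -> R) (mu : probability (measurableTypeR R) R) : Prop :=
  forall x : R, {for x, continuous (fun y : R => fine (mu `]-oo, y]))} ->
    (fun n => uprob (fun w => X n w <= x) : R) @ \oo --> fine (mu `]-oo, x]).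

(* [normal_prob] takes the standard deviation, and is the uniform distribution on
   [0, 1] when it is 0, whence the case distinction. *)
Definition centered_normal {R : realType} (v : R) : probability (measurableTypeR R) R :=
  if v == 0 then (\d_(0 : measurableTypeR R) : probability (measurableTypeR R) R)
  else normal_prob 0 (Num.sqrt v).

(** * Additive functionals *)

Section additive_functionals.
Context {R : realType} {M : random_trees}.
Implicit Types (f : M -> R) (T : M).

Definition size_bigO f (alpha : R) : Prop :=
  exists C : R, forall T, (0 < tsize T)%N -> `|f T| <= C * (tsize T)%:R `^ alpha.

Definition additive_functional f T : R := \sum_(S <- fringe T) f S.

(* The random variable f(T_n). *)
Definition at_random f n (w : rspace M n) : R := f (rtree w).

Definition tprob T : R := uprob (fun w : rspace M (tsize T) => rtree w == T).

(* [c k] is the coefficient of q p_k, and [b] is the function beta. *)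
Definition tcov_of (c : nat -> R) (b : nat -> nat -> R) T T' : R :=
  let cov A B := c (tsize A) * (count_mem B (fringe A))%:R * tprob A
                 - b (tsize A) (tsize B) * tprob A * tprob B in
  if (tsize T' <= tsize T)%N then cov T T' else cov T' T.

Definition quadratic_sum (s : M -> M -> R) f (N : nat) : R :=
  let A := [set T : M | (0 < tsize T <= N)%N] in
  \sum_(T \in A) \sum_(T' \in A) f T * f T' * s T T'.

End additive_functionals.

Arguments at_random {R M} f n w.

(** * Covariance constants *)

Section constants.
Context {R : realType}.
Implicit Types k m : nat.

Definition bst_coef k : R := 2 / ((k + 1) * (k + 2))%:R.

Definition bst_beta k m : R :=
  (4 * (k + m + 3))%:R / ((k + 1) * (k + 2) * (m + 1) * (m + 2))%:R
  - (4 * (k ^ 2 + 3 * k * m + m ^ 2 + 4 * k + 4 * m + 3))%:R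
    / ((k + 1) * (m + 1) * (k + m + 1) * (k + m + 2) * (k + m + 3))%:R.

Definition rrt_coef k : R := 1 / (k * (k + 1))%:R.

Definition rrt_beta k m : R :=
  (k ^ 2 + k * m + m ^ 2 + k + m)%:R
  / (k * (k + 1) * m * (m + 1) * (k + m + 1))%:R.

End constants.

Definition bst_cov {R : realType} : binary_search_trees -> binary_search_trees -> R :=
  tcov_of bst_coef bst_beta.

Definition ordered_rrt_cov {R : realType} :
    ordered_recursive_trees -> ordered_recursive_trees -> R :=
  tcov_of rrt_coef rrt_beta.

Definition unordered_rrt_cov {R : realType} :
    unordered_recursive_trees -> unordered_recursive_trees -> R :=
  tcov_of rrt_coef rrt_beta.

(* Main.v *)
(* The random binary search tree grows by replacing a uniform external node, hence its two root
   subtrees are independent random search trees given their sizes, and the left size is uniform.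
   The rotation correspondence carries this growth to that of the random recursive tree, whose
   additive functionals thus become additive functionals of the search tree as well.

   For a toll f, mean and second moment of the centred functional Y satisfy
   x_n = b_n + (2/n) sum_(j < n) x_j, whose solution is b_n +
     (n + 1) sum_(j < n) 2 b_j/((j+1)(j+2)).
   This yields mu and sigma^2, and by a bootstrap the bound E Y^2 = O(c^2 n), uniform over the
   tolls with |f(T)| <= c (|T| + 1)^alpha; everything is therefore continuous in the toll and f may
   be truncated.

   For a toll of bounded support, E Y = 0 and E Y^2 = sigma^2 (n + 1) exactly for large n. Let
   u(t, x) = P(N(0, t) <= x). As u solves the heat equation, replacing the Y of one root subtree by
   a Gaussian of the same variance shifts t, so that the errors of the two subtrees simply add:
   by induction |E u(t, x - Y) - u(t + sigma^2 (n + 1), x)| = O(n t^(-3/2)) for t >= 1. Taking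
   t = tau n gives the convergence of smoothed distribution functions, and tau -> 0 the limit law.

   The covariance constants come out by substituting the explicit means in the formula for sigma^2
   and telescoping the resulting rational sums. *)

Require Import Defs.
From HB Require Import structures.
From mathcomp Require Import all_boot all_order all_algebra all_fingroup.
From mathcomp Require Import generic_quotient ring lra zify.
From mathcomp Require Import all_classical all_reals all_analysis.

Set Implicit Arguments.
Unset Strict Implicit.
Unset Printing Implicit Defensive.

Import Order.TTheory GRing.Theory Num.Theory.
Import numFieldNormedType.Exports.

Local Open Scope ring_scope.
Local Open Scope classical_set_scope.

(** * Growth and splitting of random binary search trees *)

(** The threshold 1/2 enters through products: a toll of order n^al meets a fluctuation of order
    n^(1/2), and their product must be O(n^(1 - th)) with th > 0 to be summable against weights of
    order n^(-2). Only first and second moments are bounded uniformly in the size. The Gaussian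
    comparison also needs third moments; these are used only for tolls of bounded support and for
    finitely many sizes, larger sizes being reached through the split at the root. There the
    exactness of mean 0 and variance sigma^2 (n + 1) is essential: approximate values would leave a
    correction at each level of the induction. Cutting off a toll does not make the remainder small
    relative to the exponent al itself. It does so for any larger exponent, so perturbations are
    measured with an exponent strictly between al and 1/2. For recursive trees the toll seen by the
    search tree reads only the left subtree, so even after truncation it has unbounded support; the
    means of its centred functional nevertheless vanish from some size on. *)

Fixpoint bgrow (t : bintree) : seq bintree :=
  if t is BNode l r then
    [seq BNode l' r | l' <- bgrow l] ++ [seq BNode l r' | r' <- bgrow r]
  else [:: BNode BEmpty BEmpty].

Lemma size_bgrow t : size (bgrow t) = (bsize t).+1.
Proof. by elim: t => //= l IHl r IHr; rewrite size_cat !size_map IHl IHr addSn addnS. Qed.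

Fixpoint keys (t : keytree) : seq nat :=
  if t is KNode l x r then keys l ++ x :: keys r else [::].

Fixpoint search_tree (t : keytree) : bool :=
  if t is KNode l x r then
    [&& search_tree l, search_tree r, all (ltn^~ x) (keys l) & all (leq x) (keys r)]
  else true.

Lemma size_keys t : size (keys t) = bsize (Defs.shape t).
Proof. by elim: t => //= l IHl x r IHr; rewrite size_cat /= IHl IHr addnS. Qed.

Lemma keys_insert x t : perm_eq (keys (key_insert x t)) (x :: keys t).
Proof.
apply/seq.permP => a; elim: t => //= l IHl y r IHr.
by case: ifP => _ /=; rewrite !count_cat /= ?IHl ?IHr /=; lia.
Qed.

Lemma search_tree_insert x t : search_tree t -> search_tree (key_insert x t).
Proof.
elim: t => //= l IHl y r IHr /and4P[sl sr ly yr]; case: ifP => xy /=.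
  by rewrite IHl// sr yr (perm_all _ (keys_insert _ _))/= ly xy.
by rewrite IHr// sl ly (perm_all _ (keys_insert _ _))/= yr leqNgt xy.
Qed.

(** [bgrow] lists the external nodes from left to right, so the one reached by [x] is indexed by the
    number of keys that precede it; equal keys send [x] to the right, hence [leq]. *)
Lemma shape_insert x t : search_tree t ->
  Defs.shape (key_insert x t) = nth BEmpty (bgrow (Defs.shape t)) (count (leq^~ x) (keys t)).
Proof.
elim: t => //= l IHl y r IHr /and4P[sl sr ly yr].
have cl : (count (leq^~ x) (keys l) <= bsize (Defs.shape l))%N by rewrite -size_keys count_size.
have cr : (count (leq^~ x) (keys r) <= bsize (Defs.shape r))%N by rewrite -size_keys count_size.
rewrite count_cat nth_cat size_map size_bgrow/=; case: ltnP => xy /=.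
  have -> : count (leq^~ x) (keys r) = 0%N.
    apply/eqP; rewrite -leqn0 leqNgt -has_count -all_predC.
    by apply: sub_all yr => z /=; rewrite -ltnNge; exact: leq_trans.
  by rewrite !addn0 ltnS cl (nth_map BEmpty) ?size_bgrow// IHl.
have -> : count (leq^~ x) (keys l) = bsize (Defs.shape l).
  rewrite -size_keys; apply/eqP; rewrite -all_count.
  by apply: sub_all ly => z /= zy; apply: leq_trans xy; exact: ltnW.
rewrite add1n addnS ltnNge ltnS leq_addr/= subSS addKn.
by rewrite (nth_map BEmpty) ?size_bgrow// IHr.
Qed.

Lemma bst_of_keys_rcons s x :
  bst_of_keys (rcons s x) = nth BEmpty (bgrow (bst_of_keys s)) (count (leq^~ x) s).
Proof.
rewrite /bst_of_keys -cats1 foldl_cat/=.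
set t := foldl _ _ s.
have [st ks] : search_tree t /\ perm_eq (keys t) s.
  rewrite {}/t; elim/last_ind: s => [//|s y [st ks]].
  rewrite -cats1 foldl_cat/=; split; first exact: search_tree_insert.
  by rewrite (permPl (keys_insert _ _)) cats1 perm_sym perm_rcons perm_cons perm_sym.
by rewrite shape_insert// (seq.permP ks).
Qed.

Lemma bst_of_keys_map (h : nat -> nat) s :
  {mono h : x y / (x <= y)%N} -> bst_of_keys (map h s) = bst_of_keys s.
Proof.
move=> hm; elim/last_ind: s => // s x IH.
rewrite map_rcons !bst_of_keys_rcons IH count_map; congr nth.
by apply: eq_count => y /=; rewrite hm.
Qed.

(** In [lift_perm ord_max j s] the last key has rank [j], and the earlier ones are those of [s]
    moved by an increasing map. They build the same tree as [s], and the last key falls into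
    external node [j]. *)
Lemma bst_lift_perm n (j : 'I_n.+1) (s : 'S_n) :
  bst (lift_perm ord_max j s) = nth BEmpty (bgrow (bst s)) j.
Proof.
rewrite /bst /image_mem enum_ordSr map_rcons lift_perm_id -map_comp bst_of_keys_rcons.
set u := [seq _ | i <- _].
have -> : u = map (bump j.+1) [seq (s i).+1 | i <- enum 'I_n].
  rewrite /u -map_comp; apply: eq_map => i /=.
  have -> : widen_ord (leqnSn n) i = lift ord_max i.
    by apply/val_inj; rewrite /= /bump leqNgt ltn_ord.
  by rewrite lift_perm_lift /= bumpS.
rewrite bst_of_keys_map; last first.
  by move=> x y; rewrite /= leq_bump2.
congr nth; rewrite !count_map.
rewrite (eq_count (a2 := (fun i => (s i < j)%N))); last first.
  by move=> i /=; rewrite bumpS ltnS /bump; case: leqP => //=; lia.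
rewrite -sum1_count big_mkcond/= (reindex_inj (@perm_inj _ (s^-1)%g))/=.
under eq_bigr do rewrite permKV.
rewrite -big_mkcond/= -(@big_ord_widen _ _ _ j n (fun=> 1%N)); last by rewrite -ltnS.
by rewrite sum_nat_const card_ord muln1.
Qed.

(** Locked, so that conversion does not unfold it into a sum over permutations. *)
HB.lock Definition bexp (R : realType) n (g : bintree -> R) : R :=
  uexp (fun s : 'S_n => g (bst s)).

Section law.
Context {R : realType}.

Lemma sum_lift_perm n (G : 'S_n.+1 -> R) :
  \sum_s G s = \sum_(s : 'S_n) \sum_(j < n.+1) G (lift_perm ord_max j s).
Proof.
pose F (p : 'S_n * 'I_n.+1) := lift_perm ord_max p.2 p.1.
have F_inj : injective F.
  move=> [s j] [s' j'] /permP sE; have := sE ord_max.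
  rewrite !lift_perm_id /= => jE; move: sE; rewrite /F /= jE => sE; congr pair.
  apply/permP => i; have := sE (lift ord_max i).
  by rewrite !lift_perm_lift; exact: lift_inj.
rewrite (reindex F); last first.
  by apply/onW_bij/inj_card_bij => //; rewrite card_prod !card_Sn card_ord factS mulnC.
by rewrite [RHS]pair_bigA.
Qed.

Lemma bsize_bst n (s : 'S_n) : bsize (bst s) = n.
Proof.
rewrite /bst /bst_of_keys -size_keys.
set u := image_mem _ _.
have -> : n = size u by rewrite size_map size_enum_ord.
elim/last_ind: u => // u x IH; rewrite -cats1 foldl_cat/=.
by rewrite (perm_size (keys_insert _ _))/= IH size_cat addn1.
Qed.

Lemma bexp_growth n (g : bintree -> R) :
  bexp n.+1 g = bexp n (fun t => \sum_(t' <- bgrow t) g t') / n.+1%:R.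
Proof.
rewrite !bexp.unlock /uexp sum_lift_perm !card_Sn factS natrM invfM mulrA mulrAC.
congr (_ / _ / _); apply: eq_bigr => s _.
rewrite (big_nth BEmpty) size_bgrow bsize_bst big_mkord.
by apply: eq_bigr => j _; rewrite bst_lift_perm.
Qed.

Lemma bexp0 (g : bintree -> R) : bexp 0 g = g BEmpty.
Proof.
rewrite !bexp.unlock /uexp card_Sn divr1 (big_pred1 1%g)//=; last first.
  by move=> s; apply/esym/eqP/permP => -[].
by rewrite /bst /image_mem enum_ord0.
Qed.

Lemma eq_bexp n (g h : bintree -> R) : (forall t, bsize t = n -> g t = h t) ->
  bexp n g = bexp n h.
Proof.
by move=> gh; rewrite !bexp.unlock /uexp; congr (_ / _); apply: eq_bigr => s _;
  rewrite gh// bsize_bst.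
Qed.

Lemma bexp_cst n (a : R) : bexp n (fun=> a) = a.
Proof.
rewrite !bexp.unlock /uexp sumr_const -[_ *+ _]mulr_natr; apply: mulfK.
by rewrite card_Sn pnatr_eq0 -lt0n fact_gt0.
Qed.

Lemma bexpD n (g h : bintree -> R) :
  bexp n (fun t => g t + h t) = bexp n g + bexp n h.
Proof. by rewrite !bexp.unlock /uexp big_split/= mulrDl. Qed.

Lemma bexpZ n (a : R) (g : bintree -> R) : bexp n (fun t => a * g t) = a * bexp n g.
Proof. by rewrite !bexp.unlock /uexp -mulr_sumr mulrA. Qed.

Lemma bexpZr n (a : R) (g : bintree -> R) : bexp n (fun t => g t * a) = bexp n g * a.
Proof. by rewrite mulrC -bexpZ; apply: eq_bexp => t _; rewrite mulrC. Qed.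

Lemma bexpN n (g : bintree -> R) : bexp n (fun t => - g t) = - bexp n g.
Proof. by rewrite -mulN1r -bexpZ; apply: eq_bexp => t _; rewrite mulN1r. Qed.

Lemma bexpB n (g h : bintree -> R) :
  bexp n (fun t => g t - h t) = bexp n g - bexp n h.
Proof. by rewrite bexpD bexpN. Qed.

Lemma bexp_sum (I : Type) (r : seq I) (P : pred I) n (g : I -> bintree -> R) :
  bexp n (fun t => \sum_(i <- r | P i) g i t) = \sum_(i <- r | P i) bexp n (g i).
Proof.
by rewrite !bexp.unlock /uexp exchange_big/= mulr_suml.
Qed.

Lemma ler_bexp n (g h : bintree -> R) : (forall t, bsize t = n -> g t <= h t) ->
  bexp n g <= bexp n h.
Proof.
move=> gh; rewrite !bexp.unlock /uexp ler_wpM2r ?invr_ge0//.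
by apply: ler_sum => s _; rewrite gh// bsize_bst.
Qed.

Lemma bexp_ge0 n (g : bintree -> R) : (forall t, bsize t = n -> 0 <= g t) -> 0 <= bexp n g.
Proof. by move=> g0; rewrite -(bexp_cst n 0); exact: ler_bexp. Qed.

Lemma ler_norm_bexp n (g : bintree -> R) : `|bexp n g| <= bexp n (fun t => `|g t|).
Proof.
by rewrite ler_norml -bexpN; apply/andP; split; apply: ler_bexp => t _;
  rewrite ?ler_norm// lerNl -normrN ler_norm.
Qed.

(* A uniformly random external node of [BNode l r] is in [l] with probability proportional to
   [bsize l + 1], so the split recursion follows from the growth rule by induction. *)
Lemma bexp_split n (g : bintree -> R) :
  bexp n.+1 g =
  (\sum_(i < n.+1) bexp i (fun l => bexp (n - i) (fun r => g (BNode l r)))) / n.+1%:R.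
Proof.
elim: n g => [|n IH] g.
  by rewrite bexp_growth big_ord1/= subnn !bexp0/= big_seq1.
have grow k (h : bintree -> R) :
    bexp k (fun t => \sum_(t' <- bgrow t) h t') = k.+1%:R * bexp k.+1 h.
  by rewrite bexp_growth mulrC divfK ?pnatr_eq0.
have growl i : bexp i (fun l => bexp (n - i) (fun r => \sum_(l' <- bgrow l) g (BNode l' r))) =
    i.+1%:R * bexp i.+1 (fun l => bexp (n - i) (fun r => g (BNode l r))).
  by rewrite -(grow i); apply: eq_bexp => l _; rewrite bexp_sum.
have growr i : bexp i (fun l => bexp (n - i) (fun r => \sum_(r' <- bgrow r) g (BNode l r'))) =
    (n - i).+1%:R * bexp i (fun l => bexp (n - i).+1 (fun r => g (BNode l r))).
  by rewrite -bexpZ; apply: eq_bexp => l _; exact: (grow _ (fun r => g (BNode l r))).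
rewrite bexp_growth IH; congr (_ / _).
rewrite (eq_bigr (fun i : 'I_n.+1 =>
    i.+1%:R * bexp i.+1 (fun l => bexp (n - i) (fun r => g (BNode l r))) +
    (n - i).+1%:R * bexp i (fun l => bexp (n - i).+1 (fun r => g (BNode l r))))); last first.
  move=> i _; rewrite -growl -growr -bexpD; apply: eq_bexp => l _.
  by rewrite -bexpD; apply: eq_bexp => r _; rewrite big_cat !big_map.
rewrite big_split/=.
(* A split with left size [i] arises by growth on the left with weight [i] and on the right with
   weight [n.+1 - i]. The total [n.+1] does not depend on [i], which is the uniformity of the left
   size. *)
pose a i := bexp i (fun l => bexp (n.+1 - i) (fun r => g (BNode l r))).
rewrite [X in X + _](_ : _ = \sum_(i < n.+2) i%:R * a i); last first.
  by rewrite [RHS]big_ord_recl mul0r add0r; apply: eq_bigr => i _.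
rewrite [X in _ + X](_ : _ = \sum_(i < n.+2) (n.+1 - i)%:R * a i); last first.
  by rewrite [RHS]big_ord_recr/= subnn mul0r addr0; apply: eq_bigr => i _; rewrite /a subSn// -ltnS.
rewrite -big_split/= (eq_bigr (fun i : 'I_n.+2 => n.+1%:R * a i)); last first.
  by move=> i _; rewrite -mulrDl -natrD subnKC// -ltnS.
by rewrite -mulr_sumr mulrC mulKf// pnatr_eq0.
Qed.

End law.

(** * Random recursive trees by rotation *)

(** A node of [t] becomes a child: its left subtree encodes its descendants and its right subtree
    the siblings after it. The additional root carries the whole forest, so [n] nodes become
    [n.+1]. *)
Fixpoint rotation (t : bintree) : otree :=
  if t is BNode l r then ONode (rotation l :: ochildren (rotation r)) else ONode [::].

(** The recursive call is a parameter, so that [ogrow] passes the guard condition. A grown tree is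
    represented by the list of its children; the new node comes last among them because its label is
    the largest. *)
Definition forest_grow (grow : otree -> seq (seq otree)) :=
  fix fg (ts : seq otree) : seq (seq otree) :=
    if ts is t :: ts' then
      [seq ONode us :: ts' | us <- grow t] ++ [seq t :: us | us <- fg ts']
    else [::].

Fixpoint ogrow (t : otree) : seq (seq otree) :=
  let: ONode ts := t in rcons ts (ONode [::]) :: forest_grow ogrow ts.

(** [rrt] forgets the labels, but attaching a node has to name its parent; the growth rule is
    therefore proved on labelled trees and then erased. *)
Inductive ltree := LNode of nat & seq ltree.

Fixpoint erase (t : ltree) : otree := let: LNode _ ts := t in ONode (map erase ts).

Fixpoint labels (t : ltree) : seq nat := let: LNode v ts := t in v :: flatten (map labels ts).

Fixpoint attach (p c : nat) (t : ltree) : ltree :=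
  let: LNode v ts := t in
  LNode v (map (attach p c) ts ++ if v == p then [:: LNode c [::]] else [::]).

Lemma ltree_seq_ind (P : ltree -> Prop) :
  (forall v ts, foldr (fun t Q => P t /\ Q) True ts -> P (LNode v ts)) -> forall t, P t.
Proof.
move=> H; fix IH 1; case=> v ts; apply: H.
elim: ts => [|t ts IHts]; [exact: I|split; [exact: IH|exact: IHts]].
Qed.

Lemma attach_notin p c t : p \notin labels t -> attach p c t = t.
Proof.
elim/ltree_seq_ind: t => v ts IH /=; rewrite inE negb_or => /andP[pv].
rewrite eq_sym (negbTE pv) cats0 => pts; congr LNode.
elim: ts IH pts => //= t ts IHts [IHt IH]; rewrite mem_cat negb_or => /andP[pt pts].
by rewrite IHt// IHts.
Qed.

Lemma map_attach_notin p c ts : p \notin flatten (map labels ts) -> map (attach p c) ts = ts.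
Proof.
elim: ts => //= t ts IH; rewrite mem_cat negb_or => /andP[pt pts].
by rewrite attach_notin// IH.
Qed.

Lemma count_labels_attach a p c t :
  count a (labels (attach p c t)) = (count_mem p (labels t) * a c + count a (labels t))%N.
Proof.
elim/ltree_seq_ind: t => v ts IH /=; rewrite map_cat flatten_cat count_cat.
have -> : count a (flatten (map labels (map (attach p c) ts))) =
    (count_mem p (flatten (map labels ts)) * a c + count a (flatten (map labels ts)))%N.
  elim: ts IH => //= t ts IHts [IHt IH].
  by rewrite !count_cat IHt IHts// mulnDl; lia.
by case: ifP => vp /=; rewrite mulnDl /=; lia.
Qed.

Section grow.
Context {V : nmodType}.

(** Each external node that ends a right spine corresponds to one node of [rotation t], whose
    children the spine lists; filling it appends a last child to that node. *)
Lemma sum_bgrow_rotation (g : otree -> V) t :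
  \sum_(t' <- bgrow t) g (rotation t') = \sum_(us <- ogrow (rotation t)) g (ONode us).
Proof.
elim: t g => [|l IHl r IHr] g /=; first by rewrite !big_seq1.
rewrite big_cat !big_map/= (IHl (fun u => g (ONode (u :: ochildren (rotation r))))).
rewrite (IHr (fun u => g (ONode (rotation l :: ochildren u)))).
rewrite big_cons big_cat !big_map/=.
by case: (rotation r) => ts /=; rewrite big_cons addrCA.
Qed.

(** With distinct labels [attach p c] changes a single node, so summing over labels is summing over
    nodes, in the preorder that [ogrow] follows. *)
Lemma sum_attach (g : otree -> V) c t : uniq (labels t) ->
  \sum_(p <- labels t) g (erase (attach p c t)) = \sum_(us <- ogrow (erase t)) g (ONode us).
Proof.
elim/ltree_seq_ind: t g => v ts IH g /= /andP[vts uts].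
rewrite big_cons eqxx map_attach_notin// map_cat cats1 big_cons; congr (_ + _).
transitivity (\sum_(p <- flatten (map labels ts)) g (ONode (map erase (map (attach p c) ts)))).
  apply: eq_big_seq => p pts; rewrite ifF ?cats0//.
  by apply/negbTE; apply: contra vts => /eqP->.
pose h us := g (ONode us).
rewrite -/(h _) (eq_bigr (fun p => h (map erase (map (attach p c) ts))))//.
rewrite [RHS](eq_bigr h)//; move: h => h.
elim: ts IH uts h {g vts} => [|t ts IHts].
  by move=> _ _ h; rewrite !big_nil.
move=> /= [IHt IH]; rewrite cat_uniq => /and3P[ut tts uts] h; rewrite !big_cat/=; congr (_ + _).
  rewrite big_map -(IHt (fun u => h (u :: map erase ts)))//.
  apply: eq_big_seq => p pt; rewrite map_attach_notin//.
  by apply: contra tts => pts; apply/hasP; exists p.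
rewrite big_map -(IHts IH uts (fun us => h (erase t :: us))).
apply: eq_big_seq => p pts; rewrite attach_notin//.
by apply: contra tts => pt; apply/hasP; exists p.
Qed.

End grow.

Fixpoint lrrt_from n (h : nat) (w : rrt_space n) (v : nat) : ltree :=
  LNode v (if h is h'.+1 then
    [seq lrrt_from h' w (val i).+2 | i <- enum 'I_n.-1 & (w i).+1 == v] else [::]).

Lemma erase_lrrt_from n h (w : rrt_space n) v : erase (lrrt_from h w v) = rrt_from h w v.
Proof.
elim: h v => //= h IH v; congr ONode; rewrite -map_comp.
by apply: eq_map => i /=.
Qed.

(** The choice [j] of the newest node is appended to [w]; [inord] only casts into the dependent
    type, the value being in range already. *)
Definition rext n (w : rrt_space n.+1) (j : 'I_n.+1) : rrt_space n.+2 :=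
  finfun (fun i : 'I_n.+1 =>
    inord (if insub (val i) is Some k then nat_of_ord (w k) else j) : 'I_i.+1).

Lemma rext_widen n (w : rrt_space n.+1) j (k : 'I_n) :
  rext w j (widen_ord (leqnSn n) k) = w k :> nat.
Proof.
rewrite /rext ffunE /= (_ : insub _ = Some k); last first.
  by rewrite insubT ?ltn_ord// => kn; congr Some; exact/val_inj.
by rewrite inordK.
Qed.

Lemma rext_max n (w : rrt_space n.+1) j : rext w j (ord_max : 'I_n.+1) = j :> nat.
Proof. by rewrite /rext ffunE /= insubF ?ltnn// inordK. Qed.

Lemma attachE p c v ts : attach p c (LNode v ts) =
  LNode v (map (attach p c) ts ++ if v == p then [:: LNode c [::]] else [::]).
Proof. by []. Qed.

Lemma lrrt_fromS n h (w : rrt_space n) v : lrrt_from h.+1 w v =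
  LNode v [seq lrrt_from h w (val i).+2 | i <- enum 'I_n.-1 & (w i).+1 == v].
Proof. by []. Qed.

Lemma lrrt_from_leaf n (w : rrt_space n) h v : (n < v.+1)%N -> lrrt_from h w v = LNode v [::].
Proof.
case: h => //= h nv; congr LNode.
rewrite (_ : [seq i <- _ | _] = [::])//; apply/eqP.
rewrite -size_eq0 size_filter -leqn0 leqNgt -has_count.
apply/hasPn => i _ /=; rewrite ltn_eqF//; apply: leq_ltn_trans (ltn_ord (w i)) _.
by have := ltn_ord i; lia.
Qed.

(** Labels increase downwards, so few levels remain below a large label. Measuring the fuel by
    [h + v] lets the condition pass to the children, which lose one unit of [h] and gain at least
    one of [v]. *)
Lemma lrrt_from_rext n (w : rrt_space n.+1) (j : 'I_n.+1) h v :
  (0 < v <= n.+1)%N -> (n.+1 <= h + v)%N ->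
  lrrt_from h.+1 (rext w j) v = attach j.+1 n.+2 (lrrt_from h w v).
Proof.
have childE h' v' :  lrrt_from h'.+1 (rext w j) v' =
    LNode v' ([seq lrrt_from h' (rext w j) (val k).+2 | k <- enum 'I_n & (w k).+1 == v'] ++
             if v' == j.+1 then [:: LNode n.+2 [::]] else [::]).
  rewrite lrrt_fromS [enum 'I_(_)]enum_ordSr filter_rcons rext_max filter_map.
  rewrite (eq_filter (a2 := (fun k : 'I_n => (w k).+1 == v'))); last first.
    by move=> k /=; rewrite rext_widen.
  rewrite [v' == _]eq_sym; congr LNode; case: ifP => _; rewrite ?cats0 -?map_comp//.
  by rewrite map_rcons -cats1 -map_comp lrrt_from_leaf.
elim: h v => [|h IH] v vn nhv; rewrite childE.
  rewrite (_ : [seq k <- enum 'I_n | _] = [::])//.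
  apply/eqP; rewrite -size_eq0 size_filter -leqn0 leqNgt -has_count.
  apply/hasPn => k _ /=; rewrite ltn_eqF//; apply: leq_ltn_trans (ltn_ord (w k)) _.
  by apply: leq_trans nhv; rewrite ltnS; exact: (ltn_ord k).
rewrite lrrt_fromS attachE; congr (LNode _ (_ ++ _)).
rewrite -map_comp; apply/eq_in_map => k; rewrite mem_filter => /andP[/eqP vE _].
have kn : (k < n)%N := ltn_ord k.
apply: (IH k.+2); [lia|by move: nhv; rewrite -vE; have := ltn_ord (w k); lia].
Qed.

Lemma rext_bij n : bijective (fun p : rrt_space n.+1 * 'I_n.+1 => rext p.1 p.2).
Proof.
pose res (w : rrt_space n.+2) : rrt_space n.+1 :=
  finfun (fun i : 'I_n => inord (w (widen_ord (leqnSn n) i)) : 'I_i.+1).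
exists (fun w => (res w, w (ord_max : 'I_n.+1))) => [[w j]|w] /=.
  congr pair; last by apply/val_inj; rewrite /= rext_max.
  apply/ffunP => k; apply/val_inj; rewrite /res ffunE /= rext_widen.
  by rewrite inordK.
apply/ffunP => i; apply/val_inj => /=.
case: (unliftP (ord_max : 'I_n.+1) i) => [k ->|->]; last by rewrite rext_max.
have -> : lift ord_max k = widen_ord (leqnSn n) k.
  by apply/val_inj; rewrite /= /bump leqNgt ltn_ord.
rewrite rext_widen /res ffunE inordK//.
Qed.

Lemma labels_lrrt n (w : rrt_space n.+1) : perm_eq (labels (lrrt_from n.+1 w 1)) (iota 1 n.+1).
Proof.
elim: n w => [|n IH] w.
  by rewrite /= enum_ord0.
have [e _ eK] := @rext_bij n; rewrite -(eK w); case: (e w) => {}w j.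
rewrite (lrrt_from_rext w j (h := n.+1))//; last by rewrite addn1.
apply/seq.permP => a; rewrite count_labels_attach (seq.permP (IH w)).
have jn : j.+1 \in iota 1 n.+1 by rewrite mem_iota add1n; exact: (ltn_ord j).
rewrite count_uniq_mem ?iota_uniq// jn mul1n.
rewrite (seq.permP (IH w)) -[in RHS](addn1 n.+1) [in RHS]iotaD count_cat /= addn0 addnC.
by rewrite add1n.
Qed.

Section rrt_law.
Context {R : realType}.

Lemma sum_rrt_rext n (g : otree -> R) (w : rrt_space n.+1) :
  \sum_(j < n.+1) g (rrt (rext w j)) = \sum_(us <- ogrow (rrt w)) g (ONode us).
Proof.
rewrite (_ : rrt w = erase (lrrt_from n.+1 w 1)); last by rewrite erase_lrrt_from.
rewrite -(sum_attach g n.+2); last first.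
  by rewrite (perm_uniq (labels_lrrt w)) iota_uniq.
rewrite (perm_big _ (labels_lrrt w)) -[X in iota X _](addn0 1%N) iotaDl big_map.
rewrite -[X in iota _ X](subn0 n.+1) -/(index_iota 0 n.+1) big_mkord.
apply: eq_bigr => j _; rewrite [in LHS]/rrt -erase_lrrt_from.
by rewrite (lrrt_from_rext w j (h := n.+1))//; last by rewrite addn1.
Qed.

Lemma uexp_rrt_growth n (g : otree -> R) :
  uexp (fun w : rrt_space n.+2 => g (rrt w)) =
  uexp (fun w : rrt_space n.+1 => \sum_(us <- ogrow (rrt w)) g (ONode us)) / n.+1%:R.
Proof.
have cE : #|rrt_space n.+2| = (#|rrt_space n.+1| * n.+1)%N.
  by rewrite -[X in (_ * X)%N]card_ord -card_prod; apply/esym/(bij_eq_card (rext_bij n)).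
rewrite /uexp cE natrM invfM mulrA; congr (_ / _ / _).
have [e eK' eK] := @rext_bij n.
rewrite (reindex (fun p : rrt_space n.+1 * 'I_n.+1 => rext p.1 p.2))/=; last first.
  by apply: onW_bij; exists e.
rewrite -(pair_bigA _ (fun w j => g (rrt (rext w j))))/=; apply: eq_bigr => w _.
exact: sum_rrt_rext.
Qed.

(** Both laws start from one tree and follow growth rules that [rotation] intertwines, so no
    bijection between permutations and attachment sequences is needed. *)
Lemma uexp_rrt n (g : otree -> R) :
  uexp (fun w : rrt_space n.+1 => g (rrt w)) = bexp n (fun t => g (rotation t)).
Proof.
elim: n g => [|n IH] g; last first.
  rewrite uexp_rrt_growth bexp_growth; congr (_ / _).
  rewrite (IH (fun t => \sum_(us <- ogrow t) g (ONode us))).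
  by apply: eq_bexp => t _; rewrite sum_bgrow_rotation.
rewrite bexp0 /uexp (eq_bigr (fun=> g (ONode [::]))); last first.
  by move=> w _; rewrite /rrt /= enum_ord0.
rewrite sumr_const -[_ *+ _]mulr_natr; apply: mulfK.
rewrite pnatr_eq0 -lt0n; apply/card_gt0P.
by exists (finfun (fun i : 'I_0 => ord0 : 'I_i.+1)).
Qed.

End rrt_law.

(** * Moments of additive functionals *)

Ltac nonzero := repeat (apply/andP; split); apply: lt0r_neq0; lra.

Section sequences_aux.
Context {R : realType}.
Implicit Types (u r x b : nat -> R).

Lemma cvg_of_tails (S r : nat -> R) :
  (forall n N, (n <= N)%N -> `|S N - S n| <= r n) -> r @ \oo --> (0 : R) ->
  exists2 l, S @ \oo --> l & forall n, `|l - S n| <= r n.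
Proof.
move=> Sr r0.
have cS : cvgn S.
  apply/cauchy_cvgP/cauchy_exP => e e0.
  have [n _ rn] : \forall n \near \oo, r n < e by exact: (cvgr_lt 0).
  exists (S n); exists n => //= N nN; rewrite /ball/= distrC.
  by apply: le_lt_trans (Sr _ _ nN) (rn n _) => /=.
exists (limn S) => // n.
apply: (@cvgr_to_le _ \oo _ _ (fun N => `|S N - S n|)).
  by apply: cvg_norm; apply: cvgB => //; exact: cvg_cst.
by exists n => //= N; exact: Sr.
Qed.

(** With S_n the sum of the x_j for j < n, the recurrence reads S_(n+1) = (n + 2)/n S_n + b_n. Hence
    S_n/(n (n + 1)) telescopes with increments b_n/((n + 1)(n + 2)), the origin of the weights
    [bst_coef]. *)
Lemma linear_recurrence x b : x 0%N = b 0%N ->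
  (forall n, x n.+1 = b n.+1 + 2 / n.+1%:R * \sum_(j < n.+1) x j) ->
  forall n, x n = b n + n.+1%:R * \sum_(j < n) bst_coef j * b j.
Proof.
move=> x0 xS; have pos n : 0 <= n%:R :> R by exact: ler0n.
have sx n : \sum_(j < n) x j = n%:R * n.+1%:R / 2 * \sum_(j < n) bst_coef j * b j.
  elim: n => [|n IH]; first by rewrite !big_ord0 mulr0.
  rewrite !big_ord_recr/= IH.
  have -> : x n = b n + n.+1%:R * \sum_(j < n) bst_coef j * b j.
    case: n IH => [|n] IH; first by rewrite x0 big_ord0 mulr0 addr0.
    rewrite xS IH; congr (_ + _); rewrite !mulrA; congr (_ * _).
    by move: (pos n) => ?; field; nonzero.
  move: (pos n) => ?; rewrite /bst_coef natrM !natrD -![n.+1%:R]natr1 -natr1; field; nonzero.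
case=> [|n]; first by rewrite x0 big_ord0 mulr0 addr0.
rewrite xS sx !mulrA; congr (_ + _ * _).
by move: (pos n) => ?; field; nonzero.
Qed.

Lemma sum_nat_succ n : 2 * \sum_(i < n) i.+1%:R = n%:R * n.+1%:R :> R.
Proof.
elim: n => [|n IH]; first by rewrite big_ord0 mulr0 mul0r.
by rewrite big_ord_recr/= mulrDr IH -[n.+2%:R]natr1 -[n.+1%:R]natr1; ring.
Qed.

(** Comparison with the telescoping sequence [w]. For y = 1/(j + 2), consecutive powers have ratio
    (1 - y)^th <= exp(- th y) <= 1/(1 + th y); as th y <= 1, the factor 4/th makes the increment of
    [w] at least 2 y (j + 1)^(- th), which is the term to be bounded. *)
Lemma powR_tail (th : R) n N : 0 < th <= 1 ->
  \sum_(n <= j < N) bst_coef j * j.+1%:R `^ (1 - th) <= 4 / th * n.+1%:R `^ (- th).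
Proof.
move=> /andP[th0 th1].
pose w j : R := 4 / th * j.+1%:R `^ (- th).
have step j : bst_coef j * j.+1%:R `^ (1 - th) <= w j - w j.+1.
  have j0 : 0 <= j%:R :> R by [].
  have j1 : 0 < j.+1%:R :> R by rewrite ltr0n.
  have j2 : 0 < j.+2%:R :> R by rewrite ltr0n.
  rewrite /w -mulrBr.
  have -> : bst_coef j * j.+1%:R `^ (1 - th) = 2 / j.+2%:R * j.+1%:R `^ (- th) :> R.
    rewrite powRD ?powRr1 ?ltW//; last by rewrite [j.+1%:R == 0]gt_eqF ?implybT.
    rewrite /bst_coef !addn1 addn2 natrM; field.
    nonzero.
  have -> : j.+2%:R `^ (- th) = j.+1%:R `^ (- th) * (1 - j.+2%:R^-1) `^ th :> R.
    have -> : 1 - j.+2%:R^-1 = j.+1%:R / j.+2%:R :> R.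
      by rewrite -[j.+2%:R]natr1; field; nonzero.
    rewrite powRM ?invr_ge0 ?ltW// mulrA -powRD; last by rewrite [j.+1%:R == 0]gt_eqF ?implybT.
    by rewrite addNr powRr0 mul1r -powR_inv1 ?ltW// -powRrM mulN1r.
  set P := _ `^ th; set X := _ `^ _.
  rewrite (_ : 4 / th * _ = 4 / th * (1 - P) * X); last by ring.
  rewrite ler_wpM2r ?powR_ge0//.
  pose y : R := j.+2%:R^-1.
  have [y0 y1] : 0 < y /\ y <= 1.
    by rewrite invr_gt0 j2 invf_le1// ler1n.
  have : P <= (1 + th * y)^-1.
    apply: (@le_trans _ _ (expR (- y) `^ th)).
      apply: ge0_ler_powR; first exact: ltW.
      - by rewrite nnegrE subr_ge0.
      - by rewrite nnegrE expR_ge0.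
      - exact: expR_ge1Dx.
    rewrite -expRM mulNr expRN lef_pV2 ?posrE ?expR_gt0 ?addr_gt0 ?mulr_gt0//.
    by rewrite mulrC expR_ge1Dx.
  rewrite -/y => Py; clearbody y P.
  have thy : th * y <= 1 by rewrite mulr_ile1// ltW.
  have thy0 : 0 < th * y by rewrite mulr_gt0.
  apply: (@le_trans _ _ (4 / th * (1 - (1 + th * y)^-1))); last first.
    by rewrite ler_wpM2l ?divr_ge0 ?(ltW th0)// lerD2l lerN2.
  rewrite (_ : 4 / th * _ = 4 * y / (1 + th * y)); last by field; nonzero.
  rewrite ler_pdivlMr ?addr_gt0//.
  have : y * (th * y) <= y by rewrite ler_piMr// ltW.
  lra.
have [nN|Nn] := leqP n N; last first.
  by rewrite big_geq ?(ltnW Nn)// mulr_ge0 ?powR_ge0 ?divr_ge0 ?(ltW th0).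
apply: (@le_trans _ _ (w n - w N)); last first.
  by rewrite gerBl /w mulr_ge0 ?powR_ge0 ?divr_ge0 ?(ltW th0).
rewrite -[w n - _]opprB -telescope_sumr// -sumrN; apply: ler_sum => j _.
by rewrite opprB.
Qed.

End sequences_aux.

Section toll.
Context {R : realType}.
Implicit Types (phi : bintree -> R) (mu : R).

Definition tsum phi t := \sum_(s <- bfringe t) phi s.

(* Centring by [bsize t + 1], the number of external nodes, makes [csum] exactly additive over the
   two subtrees of the root; the price is [csum phi mu BEmpty = - mu]. *)
Definition csum phi mu t := tsum phi t - mu * (bsize t).+1%:R.

Lemma tsum_node phi l r : tsum phi (BNode l r) = phi (BNode l r) + tsum phi l + tsum phi r.
Proof. by rewrite /tsum /= big_cons big_cat/= addrA. Qed.

Lemma csum_node phi mu l r :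
  csum phi mu (BNode l r) = phi (BNode l r) + csum phi mu l + csum phi mu r.
Proof. by rewrite /csum tsum_node /= -[_.+2%:R]natr1 -addSn natrD; ring. Qed.

Lemma csum_empty phi mu : csum phi mu BEmpty = - mu.
Proof. by rewrite /csum /tsum /= big_nil mulr1 sub0r. Qed.

Lemma sum_rev n (x : nat -> R) : \sum_(i < n.+1) x (n - i)%N = \sum_(i < n.+1) x i.
Proof.
rewrite [RHS](reindex_inj rev_ord_inj)/=.
by apply: eq_bigr => i _; rewrite subSS.
Qed.

Lemma bexp_csum_rec phi mu n :
  bexp n.+1 (csum phi mu) =
  bexp n.+1 phi + 2 / n.+1%:R * \sum_(i < n.+1) bexp i (csum phi mu).
Proof.
rewrite !bexp_split mulrAC -mulrDl; congr (_ / _).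
rewrite [X in _ = _ + X](_ : _ =
    \sum_(i < n.+1) (bexp i (csum phi mu) + bexp (n - i) (csum phi mu))); last first.
  by rewrite big_split/= (sum_rev n (fun i => bexp i (csum phi mu))) mulr_natl mulr2n.
rewrite -big_split/=; apply: eq_bigr => i _.
transitivity (bexp i (fun l => bexp (n - i) (fun r => phi (BNode l r)) +
  (csum phi mu l + bexp (n - i) (csum phi mu)))).
  apply: eq_bexp => l _; rewrite -[X in _ + (X + _)](bexp_cst (n - i)) -!bexpD.
  by apply: eq_bexp => r _; rewrite csum_node -[LHS]addrA.
rewrite bexpD; congr (_ + _); by rewrite [LHS]bexpD bexp_cst.
Qed.

Lemma bexp_tsum phi n : phi BEmpty = 0 ->
  bexp n (tsum phi) = bexp n phi + n.+1%:R * \sum_(j < n) bst_coef j * bexp j phi.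
Proof.
move=> phi0; have -> : tsum phi = csum phi 0 by apply/funext => t; rewrite /csum mul0r subr0.
apply: (@linear_recurrence _ (fun n => bexp n (csum phi 0)) (fun n => bexp n phi)) => [|m].
  by rewrite !bexp0 phi0 csum_empty oppr0.
exact: bexp_csum_rec.
Qed.

(** The toll of the recurrence for second moments. Squaring phi + Y_l + Y_r leaves, besides the two
    squares, phi (2 Y - phi) and 2 Y_l Y_r; the expectation of the latter factors by independence of
    the subtrees. At size 0, Y is - mu. *)
Definition toll2 phi mu n :=
  if n is k.+1 then
    bexp n (fun t => phi t * (2 * csum phi mu t - phi t)) +
    2 / n%:R * \sum_(i < n) bexp i (csum phi mu) * bexp (k - i) (csum phi mu)
  else mu ^+ 2.

Lemma bexp_csum2_rec phi mu n :
  bexp n.+1 (fun t => csum phi mu t ^+ 2) =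
  toll2 phi mu n.+1 + 2 / n.+1%:R * \sum_(i < n.+1) bexp i (fun t => csum phi mu t ^+ 2).
Proof.
rewrite /toll2 !bexp_split -!mulrA [_^-1 * _]mulrC [_^-1 * _ in X in _ = _ + X]mulrC !mulrA
  -!mulrDl.
congr (_ / _); rewrite -addrA !mulr_sumr.
rewrite [X in _ = _ + (_ + X)](_ : _ = \sum_(i < n.+1) (bexp i (fun t => csum phi mu t ^+ 2) +
    bexp (n - i) (fun t => csum phi mu t ^+ 2))); last first.
  rewrite big_split/= (sum_rev n (fun i => bexp i (fun t => csum phi mu t ^+ 2))).
  by rewrite -mulr_sumr mulr_natl mulr2n.
rewrite -!big_split/=; apply: eq_bigr => i _.
transitivity (bexp i (fun l =>
  bexp (n - i) (fun r => phi (BNode l r) * (2 * csum phi mu (BNode l r) - phi (BNode l r))) +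
  (2 * csum phi mu l * bexp (n - i) (csum phi mu) +
  (csum phi mu l ^+ 2 + bexp (n - i) (fun t => csum phi mu t ^+ 2))))).
  apply: eq_bexp => l _; rewrite -[X in _ + (_ + (X + _))](bexp_cst (n - i)) -bexpZ -!bexpD.
  by apply: eq_bexp => r _; rewrite csum_node; ring.
rewrite bexpD; congr (_ + _); rewrite bexpD bexpZr (bexpZ i 2 (csum phi mu)).
by rewrite -mulrA; congr (_ + _); rewrite bexpD bexp_cst.
Qed.

Lemma bexp_csum2 phi mu n :
  bexp n (fun t => csum phi mu t ^+ 2) =
  toll2 phi mu n + n.+1%:R * \sum_(j < n) bst_coef j * toll2 phi mu j.
Proof.
apply: (@linear_recurrence _ (fun n => bexp n (fun t => csum phi mu t ^+ 2))).
  by rewrite bexp0 csum_empty sqrrN.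
by move=> {}n; rewrite bexp_csum2_rec.
Qed.

Lemma bexp_csum phi mu n : phi BEmpty = 0 ->
  bexp n (csum phi mu) =
  bexp n phi - n.+1%:R * (mu - \sum_(j < n) bst_coef j * bexp j phi).
Proof.
move=> phi0; rewrite (_ : bexp _ _ = bexp n (tsum phi) - mu * n.+1%:R).
  by rewrite bexp_tsum//; ring.
by rewrite -[X in _ = _ - X](bexp_cst n) -bexpB; apply: eq_bexp => t tn; rewrite /csum tn.
Qed.

End toll.

Section bounds.
Context {R : realType}.

Definition toll_mu (phi : bintree -> R) : R :=
  limn (fun n => \sum_(j < n) bst_coef j * bexp j phi).

Definition toll_sigma2 (phi : bintree -> R) : R :=
  limn (fun n => \sum_(j < n) bst_coef j * toll2 phi (toll_mu phi) j).

Lemma cvg_powRN (th : R) : 0 < th -> (fun n => n.+1%:R `^ (- th)) @ \oo --> (0 : R).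
Proof.
move=> th0; apply/cvgrPdist_lt => e e0; near=> n.
rewrite sub0r normrN ger0_norm ?powR_ge0// powRN.
rewrite -[e]invrK ltf_pV2 ?posrE ?invr_gt0 ?powR_gt0 ?ltr0n//.
have -> : e^-1 = (e^-1 `^ th^-1) `^ th.
  by rewrite -powRrM mulVf ?lt0r_neq0// powRr1// invr_ge0 ltW.
apply: gt0_ltr_powR; rewrite ?nnegrE ?powR_ge0//.
apply: (@le_lt_trans _ _ n%:R); last by rewrite ltr_nat.
by near: n; exact: nbhs_infty_ger.
Unshelve. all: by end_near. Qed.

Lemma powR_tail_sum (th : R) (u : nat -> R) (c : R) : 0 <= c -> 0 < th <= 1 ->
  (forall j, `|u j| <= c * j.+1%:R `^ (1 - th)) ->
  forall n N, (n <= N)%N ->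
  `|\sum_(j < N) bst_coef j * u j - \sum_(j < n) bst_coef j * u j| <=
    c * (4 / th) * n.+1%:R `^ (- th).
Proof.
move=> c0 th01 uc n N nN.
rewrite -(big_mkord xpredT (fun j => bst_coef j * u j)) (big_cat_nat (leq0n n) nN)//= big_mkord
  addrC addrK.
apply: le_trans (ler_norm_sum _ _ _) _.
rewrite -mulrA; apply: le_trans (ler_wpM2l c0 (powR_tail n N th01)).
rewrite mulr_sumr; apply: ler_sum => j _.
have b0 : 0 <= bst_coef j :> R by rewrite divr_ge0.
by rewrite normrM ger0_norm// mulrCA ler_wpM2l.
Qed.

End bounds.

(** * Bounds on the first two moments for tolls of order n^al *)

Section toll_bounds.
Context {R : realType}.
Variables (phi : bintree -> R) (c al : R).
Hypotheses (phi0 : phi BEmpty = 0) (al0 : 0 <= al) (al2 : al < 1 / 2) (c0 : 0 < c).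
Hypothesis phi_le : forall t, `|phi t| <= c * (bsize t).+1%:R `^ al.

Let p n : R := n.+1%:R `^ al.
Let q n : R := n.+1%:R `^ (1 / 2).

Let p_ge1 n : 1 <= p n.
Proof.
by rewrite -[X in X <= _](powRr0 (n.+1%:R : R)) ler_powR// ler1n.
Qed.

Let p_le_q n : p n <= q n.
Proof. by rewrite ler_powR ?ler1n// ltW. Qed.

Let p_homo m n : (m <= n)%N -> p m <= p n.
Proof. by move=> mn; rewrite ge0_ler_powR ?nnegrE ?ler_nat. Qed.

Let q_sqr n : q n * q n = n.+1%:R.
Proof.
rewrite -powRD ?pnatr_eq0 ?implybT// (_ : 1 / 2 + 1 / 2 = 1 :> R); last by lra.
by rewrite powRr1.
Qed.

(** The room left by al < 1/2: toll times fluctuation, [p n * q n], is of order n^(1 - th), and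
    [powR_tail] sums exactly such sequences. *)
Let th : R := 1 / 2 - al.

Let pq n : p n * q n = n.+1%:R `^ (1 - th).
Proof.
by rewrite -powRD ?pnatr_eq0 ?implybT//; congr powR; rewrite /th; lra.
Qed.

Lemma bexp_phi_le n : `|bexp n phi| <= c * n.+1%:R `^ al.
Proof.
apply: le_trans (ler_norm_bexp _ _) _; rewrite -(bexp_cst n (c * _)).
by apply: ler_bexp => t <-.
Qed.

Lemma toll_mu_cvg :
  (fun n => \sum_(j < n) bst_coef j * bexp j phi) @ \oo --> toll_mu phi /\
  forall n, `|toll_mu phi - \sum_(j < n) bst_coef j * bexp j phi| <= 8 * c * n.+1%:R `^ (al - 1).
Proof.
move: (al0) (al2) (c0) => al_ge0 al_lt c_gt0.
have al1 : 0 < 1 - al <= 1 by apply/andP; split; lra.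
have H n N : (n <= N)%N -> 
  `|\sum_(j < N) bst_coef j * bexp j phi - \sum_(j < n) bst_coef j * bexp j phi| <=
  8 * c * n.+1%:R `^ (al - 1).
  move=> nN; have := @powR_tail_sum R (1 - al) (fun j => bexp j phi) c (ltW c0) al1.
  rewrite (_ : 1 - (1 - al) = al); last by ring.
  move=> /(_ bexp_phi_le n N nN)/le_trans; apply.
  (* Here 4/(1 - al) <= 8 because al < 1/2. *)
  rewrite opprB ler_wpM2r ?powR_ge0// mulrC ler_wpM2r ?ltW//.
  by rewrite ltr_pdivrMr; lra.
have [] := cvg_of_tails H.
  rewrite -[0](mulr0 (8 * c)); apply: cvgM; first exact: cvg_cst.
  by rewrite -(opprB 1 al); apply: cvg_powRN; lra.
move=> l Sl lS; have lE : toll_mu phi = l by apply: cvg_lim.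
by rewrite lE.
Qed.

Let mu := toll_mu phi.

(** The linear growth cancels: what remains is the mean toll plus n + 1 times the tail of the series
    for mu, both of order n^al, whence 9 = 1 + 8. *)
Lemma bexp_csum_le n : `|bexp n (csum phi mu)| <= 9 * c * n.+1%:R `^ al.
Proof.
rewrite bexp_csum//; apply: le_trans (ler_normB _ _) _.
rewrite normrM ger0_norm//.
have -> : 9 * c * n.+1%:R `^ al = c * n.+1%:R `^ al + n.+1%:R * (8 * c * n.+1%:R `^ (al - 1)).
  rewrite [n.+1%:R * _]mulrCA -[X in X * _ `^ (al - 1)]powRr1// -powRD ?pnatr_eq0 ?implybT//.
  by rewrite (addrC 1) subrK; ring.
by rewrite lerD ?bexp_phi_le// ler_wpM2l//; apply: toll_mu_cvg.2.
Qed.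

(* Bootstrap: if the second moments of smaller sizes are at most [K ^+ 2 * c ^+ 2] per node, the
   quadratic toll is controlled with [A * K], and solving the recurrence costs the factor
   [1 + 4 / th]; so [K = A * (1 + 4 / th)] reproduces itself. *)
Lemma bexp_csum2_le (B A K : R) : 1 <= B -> A = 4 * B ^+ 2 + 3 -> K = A * (1 + 4 / th) ->
  (forall n, `|bexp n (csum phi mu)| <= B * c * n.+1%:R `^ al) -> forall n,
  bexp n (fun t => csum phi mu t ^+ 2) <= K ^+ 2 * c ^+ 2 * n.+1%:R /\
  `|toll2 phi mu n| <= A * K * c ^+ 2 * n.+1%:R `^ (1 - th).
Proof.
move=> B1 AE KE e_le n.
move: (al0) (al2) (c0) => al_ge0 al_lt c_gt0.
have th0 : 0 < th by rewrite /th; lra.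
have th1 : 0 < th <= 1 by rewrite /th; apply/andP; split; lra.
have B2 : 1 <= B ^+ 2 by rewrite exprn_ege1.
have A1 : 1 <= A by lra.
have K1 : A <= K by rewrite KE ler_peMr ?lerDl ?divr_ge0 ?(ltW th0)//; lra.
have [K0 c2] : 0 < K /\ 0 <= c ^+ 2 by split; [lra|exact: sqr_ge0].
elim/ltn_ind: n => n IH.
have toll_le : `|toll2 phi mu n| <= A * K * c ^+ 2 * n.+1%:R `^ (1 - th).
  rewrite -pq; have p1 := p_ge1 n; have pleq := p_le_q n.
  case: n IH p1 pleq => [|n] IH.
    have := e_le 0%N; rewrite bexp0 csum_empty normrN powR1 mulr1 => mu_le p1 pleq.
    rewrite /= ger0_norm ?sqr_ge0// -real_normK ?num_real//.
    apply: (@le_trans _ _ ((B * c) ^+ 2)); first by rewrite ler_pXn2r ?nnegrE// mulr_ge0//; lra.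
    rewrite exprMn; have : 1 <= p 0 * q 0 by nra.
    move: (p 0 * q 0) (c ^+ 2) (B ^+ 2) c2 B2 AE => x y z y0 z1 AE x1.
    have yx : y <= y * x by rewrite ler_peMr.
    have h1 : A * (y * x) <= A * K * (y * x) by rewrite ler_wpM2r ?ler_peMr// ?mulr_ge0//; lra.
    have h2 : z * y <= A * y by rewrite ler_wpM2r//; lra.
    have : A * y <= A * (y * x) by rewrite ler_wpM2l//; lra.
    lra.
  have := q_sqr n.+1; rewrite /toll2; set P := p n.+1; set Q := q n.+1 => QQ P1 PQ.
  set ee := _ / _ * _.
  have ee_le : `|ee| <= 2 * (B ^+ 2 * c ^+ 2 * P ^+ 2).
    rewrite normrM ger0_norm ?divr_ge0//.
    rewrite mulrAC ler_pdivrMr ?ltr0n// -[leRHS]mulrA ler_wpM2l//.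
    rewrite -!exprMn; set X := (B * c * P) ^+ 2.
    apply: (@le_trans _ _ (\sum_(i < n.+1) X)); last by rewrite sumr_const card_ord mulr_natr.
    apply: le_trans (ler_norm_sum _ _ _) _; apply: ler_sum => i _; rewrite normrM /X expr2.
    have le_P j : (j <= n)%N -> `|bexp j (csum phi mu)| <= B * c * P.
      move=> jn; apply: le_trans (e_le j) _.
      by apply: ler_wpM2l; [apply: mulr_ge0; lra|apply: p_homo; exact: leqW].
    by apply: ler_pM => //; apply: le_P; rewrite ?leq_subr// -ltnS.
  (* [csum phi mu t - phi t] is the sum of the contributions of the two subtrees, so its second
     moment involves smaller sizes only and the induction hypothesis applies. *)
  have Z2 : bexp n.+1 (fun t => (csum phi mu t - phi t) ^+ 2) <=
      2 * (B ^+ 2 * c ^+ 2 * P ^+ 2) + K ^+ 2 * c ^+ 2 * (Q * Q).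
    have -> : bexp n.+1 (fun t => (csum phi mu t - phi t) ^+ 2) =
        ee + 2 / n.+1%:R * \sum_(i < n.+1) bexp i (fun t => csum phi mu t ^+ 2).
      apply: (addrI (bexp n.+1 (fun t => phi t * (2 * csum phi mu t - phi t)))).
      rewrite addrA; have := bexp_csum2_rec phi mu n; rewrite /toll2 -/ee => <-.
      by rewrite -bexpD; apply: eq_bexp => t _; ring.
    apply: lerD; first exact: le_trans (ler_norm _) ee_le.
    rewrite mulrAC ler_pdivrMr ?ltr0n//.
    apply: (@le_trans _ _ (2 * \sum_(i < n.+1) (K ^+ 2 * c ^+ 2 * i.+1%:R))).
      by rewrite ler_wpM2l//; apply: ler_sum => i _; exact: (IH i (ltn_ord i)).1.
    have S2 := @sum_nat_succ R n.+1.
    by rewrite QQ -mulr_sumr [leLHS]mulrCA S2 [_%:R * _]mulrC mulrA.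
  have P0 : 0 <= P by lra.
  have Q0 : 0 < Q by lra.
  (* The cross term is split with weight c K Q, the order that the induction claims for the standard
     deviation at this size. *)
  have phi2 t : bsize t = n.+1 -> `|phi t * (2 * csum phi mu t - phi t)| <=
      c ^+ 2 * P ^+ 2 + c * P * (c * K * Q + (csum phi mu t - phi t) ^+ 2 / (c * K * Q)).
    move=> tn; have pt : `|phi t| <= c * P by apply: le_trans (phi_le t) _; rewrite tn.
    have L0 : 0 < c * K * Q by rewrite !mulr_gt0.
    move: (c * K * Q) L0 => L L0; set Z := csum phi mu t - phi t.
    have -> : 2 * csum phi mu t - phi t = phi t + 2 * Z by rewrite /Z; ring.
    rewrite mulrDr; apply: le_trans (ler_normD _ _) _; apply: lerD.
      by rewrite normrM -exprMn expr2 ler_pM.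
    rewrite normrM ler_pM//.
    have Z2L : `|2 * Z| * L <= L * L + Z ^+ 2.
      rewrite normrM ger0_norm// -(real_normK (num_real Z)).
      by have := sqr_ge0 (`|Z| - L); rewrite !expr2; lra.
    have -> : L + Z ^+ 2 / L = (L * L + Z ^+ 2) / L by field; rewrite lt0r_neq0.
    by rewrite ler_pdivlMr.
  have PQ2 : P ^+ 2 <= P * Q by rewrite expr2 ler_wpM2l.
  have phi_part : `|bexp n.+1 (fun t => phi t * (2 * csum phi mu t - phi t))| <=
      c ^+ 2 * P ^+ 2 + c * P * (c * K * Q +
        (2 * (B ^+ 2 * c ^+ 2 * P ^+ 2) + K ^+ 2 * c ^+ 2 * (Q * Q)) / (c * K * Q)).
    apply: le_trans (ler_norm_bexp _ _) _; apply: le_trans (ler_bexp phi2) _.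
    rewrite bexpD bexp_cst lerD2l bexpZ ler_wpM2l ?mulr_ge0 ?(ltW c0)//.
    rewrite bexpD bexp_cst lerD2l bexpZr ler_wpM2r// invr_ge0.
    by rewrite !mulr_ge0// ltW.
  apply: le_trans (ler_normD _ _) _; apply: le_trans (lerD phi_part ee_le) _.
  rewrite (_ : _ / (c * K * Q) = 2 * B ^+ 2 / K * c * (P ^+ 2 / Q) + K * c * Q); last first.
    by field; rewrite !lt0r_neq0.
  have h1 : P ^+ 2 / Q <= P by rewrite ler_pdivrMr.
  have h2 : 2 * B ^+ 2 / K <= 2 * B ^+ 2 by rewrite ler_pdivrMr// ler_peMr; lra.
  have h3 : 2 * B ^+ 2 / K * (P ^+ 2 / Q) <= 2 * B ^+ 2 * Q.
    apply: ler_pM h2 (le_trans h1 PQ); rewrite divr_ge0 ?sqr_ge0 ?(ltW Q0) ?(ltW K0)//.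
    by rewrite mulr_ge0// sqr_ge0.
  move: (2 * B ^+ 2 / K) (P ^+ 2 / Q) h3 => X Y h3.
  have h4 : c ^+ 2 * P * (X * Y) <= c ^+ 2 * P * (2 * B ^+ 2 * Q).
    by rewrite ler_wpM2l// mulr_ge0.
  have h5 : c ^+ 2 * (P ^+ 2 * (1 + 2 * B ^+ 2)) <= c ^+ 2 * (P * Q * (1 + 2 * B ^+ 2)).
    by rewrite ler_wpM2l// ler_wpM2r//; lra.
  have h6 : c ^+ 2 * (P * Q) * (1 + 4 * B ^+ 2) <= c ^+ 2 * (P * Q) * (K * (1 + 4 * B ^+ 2)).
    apply: ler_wpM2l; first by rewrite !mulr_ge0// ltW.
    by apply: ler_peMl; lra.
  (* In units of c^2 P Q the coefficients add up to 2 K + 1 + 4 B^2 <= K (4 B^2 + 3), which dictates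
     [A]. *)
  rewrite AE; lra.
split=> //; rewrite bexp_csum2.
have n1 : 0 < n.+1%:R :> R by rewrite ltr0n.
have C0 : 0 <= A * K * c ^+ 2 by rewrite !mulr_ge0// ltW//; lra.
apply: (@le_trans _ _ (A * K * c ^+ 2 * n.+1%:R + n.+1%:R * (A * K * c ^+ 2 * (4 / th))));
  last first.
  by rewrite [in leRHS]expr2 [in X in _ <= X * _ * _ * _]KE;
    move: (4 / th) (c ^+ 2) (n.+1%:R) => x y z; lra.
apply: lerD.
  apply: le_trans (ler_norm _) _; apply: le_trans toll_le _.
  rewrite ler_wpM2l// -[leRHS]powRr1// ler_powR ?ler1n//; lra.
rewrite ler_wpM2l// -(big_mkord xpredT (fun j => bst_coef j * toll2 phi mu j)).
have := powR_tail 0 n th1; rewrite powR1 mulr1 => /(ler_wpM2l C0); apply: le_trans.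
rewrite !big_mkord mulr_sumr; apply: ler_sum => i _; rewrite mulrCA ler_wpM2l//.
  by rewrite divr_ge0.
by apply: le_trans (ler_norm _) _; exact: (IH i (ltn_ord i)).2.
Qed.

Lemma toll_sigma2_cvg_aux (C : R) : 0 <= C ->
  (forall n, `|toll2 phi mu n| <= C * n.+1%:R `^ (1 - th)) ->
  (fun n => \sum_(j < n) bst_coef j * toll2 phi mu j) @ \oo --> toll_sigma2 phi /\
  (fun n => bexp n (fun t => csum phi mu t ^+ 2) / n.+1%:R) @ \oo --> toll_sigma2 phi.
Proof.
move=> C0 toll_le; move: (al0) (al2) => al_ge0 al_lt.
have th0 : 0 < th by rewrite /th; lra.
have th1 : 0 < th <= 1 by rewrite /th; apply/andP; split; lra.
have sig : (fun n => \sum_(j < n) bst_coef j * toll2 phi mu j) @ \oo --> toll_sigma2 phi.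
  have [|l Sl _] := cvg_of_tails (powR_tail_sum C0 th1 toll_le).
    rewrite -[0](mulr0 (C * (4 / th))); apply: cvgM; first exact: cvg_cst.
    exact: cvg_powRN.
  by rewrite (_ : toll_sigma2 phi = l)//; apply: cvg_lim.
split=> //; rewrite -[toll_sigma2 phi]add0r.
rewrite (_ : (fun n => bexp _ _ / _) = (fun n => toll2 phi mu n / n.+1%:R +
    \sum_(j < n) bst_coef j * toll2 phi mu j)); last first.
  by apply/funext => n; rewrite bexp_csum2; field; rewrite nat1r pnatr_eq0.
apply: cvgD => //; apply/cvgr0Pnorm_le => e e0.
have : (fun n => C * n.+1%:R `^ (- th)) @ \oo --> (0 : R).
  by rewrite -[X in _ --> X](mulr0 C); apply: cvgM; [exact: cvg_cst|exact: cvg_powRN].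
move=> /cvgr0Pnorm_le/(_ _ e0); apply: filterS => n; apply: le_trans.
rewrite normrM normfV (ger0_norm (ler0n _ n.+1)) ler_pdivrMr ?ltr0n//.
apply: le_trans (toll_le n) _; apply: le_trans (ler_wpM2r _ (ler_norm _)) => //.
rewrite -mulrA ler_wpM2l// -[X in _ * X]powRr1// -powRD ?pnatr_eq0 ?implybT//.
by rewrite addrC.
Qed.

End toll_bounds.

Section toll_bounds_uniform.
Context {R : realType}.

Definition toll_le (phi : bintree -> R) (c al : R) :=
  forall t, `|phi t| <= c * (bsize t).+1%:R `^ al.

Lemma bexp_csum2_uniform (al : R) : 0 <= al -> al < 1 / 2 ->
  exists C : R, forall (phi : bintree -> R) (c : R), phi BEmpty = 0 -> 0 < c -> toll_le phi c al ->
  forall n, bexp n (fun t => csum phi (toll_mu phi) t ^+ 2) <= C * c ^+ 2 * n.+1%:R.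
Proof.
move=> al0 al2; exists (((4 * 9 ^+ 2 + 3) * (1 + 4 / (1 / 2 - al))) ^+ 2).
move=> phi c phi0 c0 le n; have e_le := bexp_csum_le phi0 al0 al2 c0 le.
have h9 : 1 <= 9 :> R by rewrite ler1n.
by have [] := bexp_csum2_le al0 al2 c0 le h9 erefl erefl e_le n.
Qed.

Lemma toll_sigma2_cvg (phi : bintree -> R) (c al : R) : phi BEmpty = 0 ->
  0 <= al -> al < 1 / 2 -> 0 < c -> toll_le phi c al ->
  (fun n => \sum_(j < n) bst_coef j * toll2 phi (toll_mu phi) j) @ \oo --> toll_sigma2 phi /\
  (fun n => bexp n (fun t => csum phi (toll_mu phi) t ^+ 2) / n.+1%:R) @ \oo --> toll_sigma2 phi.
Proof.
move=> phi0 al0 al2 c0 le; have e_le := bexp_csum_le phi0 al0 al2 c0 le.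
have h9 : 1 <= 9 :> R by rewrite ler1n.
have H n := (bexp_csum2_le al0 al2 c0 le h9 erefl erefl e_le n).2.
apply: (toll_sigma2_cvg_aux al0 al2 _ H).
have th0 : 0 < 1 / 2 - al by lra.
have h : 0 <= 4 / (1 / 2 - al) by rewrite divr_ge0// ltW.
have h9' : 0 <= 9 ^+ 2 :> R by exact: sqr_ge0.
by rewrite !mulr_ge0 ?sqr_ge0//; lra.
Qed.

End toll_bounds_uniform.

(** * Gaussian smoothing *)

Section normal_cdf.
Context {R : realType}.
Implicit Types s x : R.

Definition ncdf s x : R := fine (normal_prob 0 s `]-oo, x]).

(** The identity seen as a random variable under the normal law: monotonicity and limits of [ncdf]
    are inherited from general distribution functions. *)
Lemma ncdf_cdf s : exists X : {RV (normal_prob 0 s : probability (measurableTypeR R) R) >-> R},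
  forall x, cdf X x = (ncdf s x)%:E.
Proof.
have mid : measurable_fun setT (idfun : measurableTypeR R -> R).
  exact: measurable_id.
pose M := isMeasurableFun.Build _ _ (measurableTypeR R) R _ mid.
pose X : {RV (normal_prob 0 s : probability (measurableTypeR R) R) >-> R} :=
  HB.pack (idfun : measurableTypeR R -> R) M.
exists X => x; rewrite /cdf /distribution /pushforward /ncdf fineK//.
exact: fin_num_measure.
Qed.

Lemma ncdf_ge0 s x : 0 <= ncdf s x. Proof. by rewrite fine_ge0. Qed.

Lemma ncdf_le1 s x : ncdf s x <= 1.
Proof.
have [X XE] := ncdf_cdf s; rewrite -lee_fin -XE; exact: cdf_le1.
Qed.

Lemma ncdf_homo s x y : x <= y -> ncdf s x <= ncdf s y.
Proof.
move=> xy; have [X XE] := ncdf_cdf s.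
by rewrite -lee_fin -!XE; apply: cdf_nondecreasing.
Qed.

Lemma ncdf_cvgy s : ncdf s x @[x --> +oo] --> (1 : R).
Proof.
have [X XE] := ncdf_cdf s; have E : fine \o cdf X = ncdf s by apply/funext => x; have := XE x;
  rewrite /= => ->.
have := fine_cvg (cvg_cdfy1 X); rewrite E; exact.
Qed.

Lemma ncdf_cvgNy s : ncdf s x @[x --> -oo] --> (0 : R).
Proof.
have [X XE] := ncdf_cdf s; have E : fine \o cdf X = ncdf s by apply/funext => x; have := XE x;
  rewrite /= => ->.
have := fine_cvg (cvg_cdfNy0 X); rewrite E; exact.
Qed.

Lemma is_derive_ncdf s x : s != 0 -> is_derive x 1 (ncdf s) (normal_pdf 0 s x).
Proof.
move=> s0.
have [] := @continuous_FTC1 R (normal_pdf 0 s) -oo%O x (x + 1).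
- by rewrite ltrDl.
- by apply: integrableS (integrable_normal_pdf 0 s).
- by rewrite ltNyr.
- exact: continuous_normal_pdf.
move=> dF FE; apply: DeriveDef; first exact: dF.
by rewrite -FE derive1E.
Qed.

Lemma MVT_all (f df : R -> R) : (forall x : R, is_derive x (1 : R) f (df x)) ->
  forall x h, exists c, `|c - x| <= `|h| /\ f (x + h) - f x = df c * h.
Proof.
move=> fdf; have cf : continuous f.
  by move=> z; apply: differentiable_continuous; apply/derivable1_diffP; case: (fdf z).
have mv a b : a <= b -> exists2 c, a <= c <= b & f b - f a = df c * (b - a).
  move=> ab; have [|c + ->] := @MVT_segment R f df a b ab (fun z _ => fdf z).
    exact: continuous_subspaceT.
  by rewrite in_itv/= => cab; exists c.
move=> x h; have [h0|h0] := leP 0 h.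
  have [|c /andP[xc cx] E] := mv x (x + h); first by rewrite lerDl.
  exists c; rewrite E; split; last by rewrite addrC addKr.
  by rewrite !ger0_norm ?subr_ge0// lerBlDl.
have [|c /andP[xc cx] E] := mv (x + h) x; first by rewrite gerDl ltW.
exists c; split; last by rewrite -opprB E; ring.
by rewrite !ler0_norm ?subr_le0 ?(ltW h0)//; lra.
Qed.

Lemma derive0_cst (f : R -> R) : (forall x : R, is_derive x (1 : R) f 0) -> forall x y, f x = f y.
Proof.
move=> f0 x y; have [c [_]] := MVT_all f0 y (x - y).
by rewrite subrKC mul0r => /subr0_eq.
Qed.

Definition Phi : R -> R := ncdf 1.
Definition gauss (x : R) : R := normal_pdf 0 1 x.

Lemma gaussE x : gauss x = normal_peak 1 * expR (- x ^+ 2 / 2).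
Proof. by rewrite /gauss normal_pdfE ?oner_neq0// /normal_fun subr0 expr1n. Qed.

Lemma is_derive_Phi x : is_derive x 1 Phi (gauss x).
Proof. exact: is_derive_ncdf. Qed.

Lemma is_derive_gauss (x : R) : is_derive x (1 : R) gauss (- x * gauss x).
Proof.
have d1 := is_deriveM (is_derive_id x (1 : R)) (is_derive_id x (1 : R)).
have d2 := is_deriveZ (- 2^-1) d1.
have d3 := is_deriveZ (normal_peak 1) (is_derive1_comp (is_derive_expR _) d2).
rewrite (_ : gauss = normal_peak 1 *: (expR \o (- 2^-1 *: (id * id)))); last first.
  apply/funext => y; rewrite gaussE; congr (_ * expR _).
  by rewrite mulNr mulrC -mulNr.
apply: is_derive_eq d3 _; set E := expR _.
change (normal_peak 1 * (E * (- 2^-1 * (x * 1 + x * 1))) = - x * (normal_peak 1 * E)).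
by field.
Qed.

(** Both sides have the same derivative and vanish at minus infinity. *)
Lemma ncdf_scale s x : 0 < s -> ncdf s x = Phi (x / s).
Proof.
move=> s0; apply/eqP; rewrite -subr_eq0; apply/eqP.
pose h x := ncdf s x - Phi (x / s).
have dh y : is_derive y (1 : R) h 0.
  have d1 := is_derive_ncdf y (lt0r_neq0 s0).
  have d2 : is_derive y (1 : R) (fun y => y / s) s^-1.
    have d := is_deriveZ s^-1 (is_derive_id y (1 : R)).
    rewrite (_ : (fun y => y / s) = s^-1 *: id); last by apply/funext => z; rewrite mulrC.
    by apply: is_derive_eq d _; rewrite [LHS]mulr1.
  have d3 := @is_derive1_comp R Phi (fun y => y / s) y _ _ (is_derive_Phi (y / s)) d2.
  apply: is_derive_eq (is_deriveB d1 d3) _.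
  rewrite gaussE normal_pdfE ?lt0r_neq0// /normal_fun subr0.
  have -> : normal_peak s = normal_peak 1 / s.
    rewrite /normal_peak expr1n mul1r -mulrnAr sqrtrM ?sqr_ge0// sqrtr_sqr gtr0_norm//.
    by rewrite invfM mulrC.
  have -> : - y ^+ 2 / (s ^+ 2 *+ 2) = - (y / s) ^+ 2 / 2.
    by rewrite -mulr_natr; field; rewrite lt0r_neq0.
  by rewrite mulrAC subrr.
rewrite -/(h x).
suff : h y @[y --> -oo] --> (0 : R).
  rewrite (_ : h = cst (h x)); last by apply/funext => y; apply: derive0_cst.
  by move=> /cvg_lim <- //; rewrite lim_cst.
rewrite -[0]subr0; apply: cvgB; first exact: ncdf_cvgNy.
apply: (cvg_comp _ Phi); last exact: ncdf_cvgNy.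
by apply: gt0_cvgMlNy; rewrite ?invr_gt0//; exact: cvg_id.
Qed.

Lemma gauss_ge0 x : 0 <= gauss x. Proof. exact: normal_pdf_ge0. Qed.

(** With y = x^2/4, 1 + x^4 = 1 + 16 y^2 <= 17 (1 + y)^2 <= 17 exp(x^2/2), and the peak is at most
    1. Degree 4 dominates every polynomial factor in the derivatives of [heat] used below. *)
Lemma gauss_poly_le x : gauss x * (1 + x ^+ 4) <= 17.
Proof.
have peak1 : normal_peak 1 <= 1 :> R.
  rewrite /normal_peak invf_le1 ?sqrtr_gt0 ?mulrn_wgt0 ?mulr_gt0 ?expr1n ?pi_gt0//.
  rewrite -[X in X <= _]sqrtr1 ler_wsqrtr// mul1r -mulr_natr.
  by have := pi_ge2 R; lra.
rewrite gaussE -mulrA; apply: (@le_trans _ _ (1 * 17)); last by rewrite mul1r.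
apply: ler_pM => //; first exact: normal_peak_ge0.
  by rewrite mulr_ge0 ?expR_ge0// addr_ge0// exprn_even_ge0.
pose y := x ^+ 2 / 4; have y0 : 0 <= y by rewrite divr_ge0 ?sqr_ge0.
have -> : - x ^+ 2 / 2 = - (y + y) by rewrite /y; field.
rewrite expRN mulrC ler_pdivrMr ?expR_gt0// expRD.
have ey : 1 + y <= expR y by exact: expR_ge1Dx.
have : (1 + y) * (1 + y) <= expR y * expR y by rewrite ler_pM// addr_ge0.
have -> : x ^+ 4 = 16 * (y * y) by rewrite /y; field.
move: (expR y * expR y) => E; nra.
Qed.

End normal_cdf.

Section heat.
Context {R : realType}.
Implicit Types t x y h : R.

Lemma gauss_mul_le (k p x : R) : `|p| <= k * (1 + x ^+ 4) -> `|p * gauss x| <= k * 17.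
Proof.
move=> pk; have x4 : 0 <= x ^+ 4 by rewrite exprn_even_ge0.
have k0 : 0 <= k by have := le_trans (normr_ge0 p) pk; rewrite pmulr_lge0//; lra.
rewrite normrM (ger0_norm (gauss_ge0 x)).
apply: le_trans (ler_wpM2r (gauss_ge0 x) pk) _.
by rewrite -mulrA ler_wpM2l// mulrC gauss_poly_le.
Qed.

Lemma taylor3 (F F1 F2 F3 : R -> R) (M : R) :
  (forall z : R, is_derive z (1 : R) F (F1 z)) -> (forall z : R, is_derive z (1 : R) F1 (F2 z)) ->
  (forall z : R, is_derive z (1 : R) F2 (F3 z)) -> (forall z, `|F3 z| <= M) ->
  forall z h, `|F (z + h) - F z - h * F1 z - h ^+ 2 / 2 * F2 z| <= M * `|h| ^+ 3.
Proof.
move=> d0 d1 d2 M3 z.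
have M0 : 0 <= M by apply: le_trans (M3 0).
have b2 h : `|F2 (z + h) - F2 z| <= M * `|h|.
  by have [c [_ ->]] := MVT_all d2 z h; rewrite normrM ler_wpM2r.
have b1 h : `|F1 (z + h) - F1 z - h * F2 z| <= M * `|h| ^+ 2.
  have dG s : is_derive s (1 : R) (F1 - F2 z *: id) (F2 s - F2 z).
    apply: is_derive_eq (is_deriveB (d1 s) (is_deriveZ (F2 z) (is_derive_id s (1 : R)))) _.
    by congr (_ - _); exact: mulr1.
  have [c [cz E]] := MVT_all dG z h.
  have E' : F1 (z + h) - F2 z * (z + h) - (F1 z - F2 z * z) = (F2 c - F2 z) * h := E.
  rewrite (_ : F1 (z + h) - F1 z - h * F2 z = (F2 c - F2 z) * h); last by rewrite -E'; ring.
  rewrite normrM expr2 mulrA ler_wpM2r//.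
  by have := b2 (c - z); rewrite [z + _]addrC subrK => /le_trans; apply; rewrite ler_wpM2l.
move=> h.
have dG s : is_derive s (1 : R) (F - F1 z *: id - (F2 z / 2) *: ((id - cst z) * (id - cst z)))
    (F1 s - F1 z - (s - z) * F2 z).
  have dz := is_deriveB (is_derive_id s (1 : R)) (is_derive_cst z s (1 : R)).
  apply: is_derive_eq (is_deriveB (is_deriveB (d0 s) (is_deriveZ (F1 z) (is_derive_id s (1 : R))))
    (is_deriveZ (F2 z / 2) (is_deriveM dz dz))) _.
  change (F1 s - F1 z * 1 - F2 z / 2 * ((s - z) * (1 - 0) + (s - z) * (1 - 0)) =
          F1 s - F1 z - (s - z) * F2 z).
  by field.
have [c [cz E]] := MVT_all dG z h.
have E' : F (z + h) - F1 z * (z + h) - F2 z / 2 * ((z + h - z) * (z + h - z)) -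
  (F z - F1 z * z - F2 z / 2 * ((z - z) * (z - z))) = (F1 c - F1 z - (c - z) * F2 z) * h := E.
rewrite (_ : F (z + h) - F z - h * F1 z - h ^+ 2 / 2 * F2 z = (F1 c - F1 z - (c - z) * F2 z) * h).
  rewrite normrM exprSr mulrA ler_wpM2r//.
  have := b1 (c - z); rewrite [z + _]addrC subrK => /le_trans; apply.
  by rewrite ler_wpM2l// lerXn2r ?nnegrE.
by rewrite -E'; field.
Qed.

Lemma MVT_pos (f df : R -> R) : (forall t : R, 0 < t -> is_derive t (1 : R) f (df t)) ->
  forall t h, 0 < t -> 0 <= h -> exists c, t <= c <= t + h /\ f (t + h) - f t = df c * h.
Proof.
move=> fdf t h t0 h0.
have [|z|z|c + E] := @MVT_segment R f df t (t + h); first by rewrite lerDl.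
- by rewrite in_itv/= => /andP[tz _]; apply: fdf; exact: lt_trans tz.
- apply: derivable_within_continuous => {}z; rewrite in_itv/= => /andP[tz _].
  by case: (fdf z (lt_le_trans t0 tz)).
rewrite in_itv/= => tc; exists c; split => //.
by rewrite E addrC addKr.
Qed.

(** [heat_x] and [heat_xx] are the derivatives in [x]; the derivative in [t] is half of [heat_xx],
    so that a second-order term in [x] is compensated by a shift of [t]. *)
Definition heat t x : R := Phi (x / Num.sqrt t).
Definition heat_x t x : R := (Num.sqrt t)^-1 * gauss (x / Num.sqrt t).
Definition heat_xx t x : R := t^-1 * (- (x / Num.sqrt t) * gauss (x / Num.sqrt t)).

Lemma is_derive_gauss2 (z : R) :
  is_derive z (1 : R) (fun z => - z * gauss z) ((z ^+ 2 - 1) * gauss z).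
Proof.
have d := is_deriveM (is_deriveN (is_derive_id z (1 : R))) (is_derive_gauss z).
apply: is_derive_eq d _.
change (- z * (- z * gauss z) + gauss z * (- 1) = (z ^+ 2 - 1) * gauss z).
by ring.
Qed.

Lemma heat_taylor_x t x y : 0 < t ->
  `|heat t (x + y) - heat t x - y * heat_x t x - y ^+ 2 / 2 * heat_xx t x| <=
    17 * `|y| ^+ 3 / (t * Num.sqrt t).
Proof.
move=> t0; have s0 : 0 < Num.sqrt t by rewrite sqrtr_gt0.
have b (z : R) : `|(z ^+ 2 - 1) * gauss z| <= 17.
  have := @gauss_mul_le 1 (z ^+ 2 - 1) z; rewrite !mul1r; apply; rewrite ler_norml.
  by have := sqr_ge0 (z ^+ 2); have := sqr_ge0 (z ^+ 2 - 1); have := sqr_ge0 z; nra.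
have T := taylor3 is_derive_Phi is_derive_gauss is_derive_gauss2 b (x / Num.sqrt t)
  (y / Num.sqrt t).
have tE : t = Num.sqrt t * Num.sqrt t by rewrite -expr2 sqr_sqrtr// ltW.
move: T; rewrite /heat /heat_x /heat_xx.
move: (Num.sqrt t) s0 tE => s s0 ->.
have -> : 17 * `|y / s| ^+ 3 = 17 * `|y| ^+ 3 / (s * s * s).
  by rewrite normrM normfV (gtr0_norm s0); field; rewrite lt0r_neq0.
apply: le_trans; rewrite -mulrDl le_eqVlt; apply/orP; left; apply/eqP; congr (`|_|).
move: (gauss _) (Phi _) (Phi _) => g p1 p2.
by field; rewrite lt0r_neq0.
Qed.

Lemma is_derive_comp_sqrt (k : R -> R) (k1 : R -> R) t x : 0 < t ->
  (forall z : R, is_derive z (1 : R) k (k1 z)) ->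
  is_derive t (1 : R) (fun t => k (x / Num.sqrt t))
    (k1 (x / Num.sqrt t) * (- (x / Num.sqrt t) / (2 * t))).
Proof.
move=> t0 dk; have s0 : 0 < Num.sqrt t by rewrite sqrtr_gt0.
have dV := is_deriveV (lt0r_neq0 s0) (is_derive1_sqrt t0).
have dx := is_deriveZ x dV.
have d := @is_derive1_comp R k (x \*: (fun y => (Num.sqrt y)^-1)) t _ _ (dk (x / Num.sqrt t)) dx.
apply: is_derive_eq d _; congr (_ * _).
change (x * (- (Num.sqrt t) ^- 2 * (2 * Num.sqrt t)^-1) = - (x / Num.sqrt t) / (2 * t)).
rewrite sqr_sqrtr ?ltW//; field; by rewrite !lt0r_neq0.
Qed.

Lemma heat_lip_xx t h x : 0 < t -> 0 <= h -> `|heat_xx (t + h) x - heat_xx t x| <= 34 * h / t ^+ 2.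
Proof.
move=> t0 h0.
pose p (z : R) := z - z * (z ^+ 2 - 1) / 2.
have d (s : R) : 0 < s -> is_derive s (1 : R) (heat_xx^~ x)
    (s ^- 2 * (p (x / Num.sqrt s) * gauss (x / Num.sqrt s))).
  move=> s0; have d1 := is_derive_comp_sqrt x s0 is_derive_gauss2.
  have d2 := is_deriveV (lt0r_neq0 s0) (is_derive_id s (1 : R)).
  apply: is_derive_eq (is_deriveM d2 d1) _.
  move: (x / Num.sqrt s) => z; move: (gauss z) => g; rewrite /p /GRing.scale/=.
  by field; rewrite lt0r_neq0.
have [c [/andP[tc _] ->]] := MVT_pos d t0 h0.
have c0 : 0 < c := lt_le_trans t0 tc.
have b : `|p (x / Num.sqrt c) * gauss (x / Num.sqrt c)| <= 2 * 17.
  apply: gauss_mul_le; rewrite /p; move: (x / Num.sqrt c) => z; rewrite ler_norml.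
  have := sqr_ge0 (z ^+ 2); have := sqr_ge0 (z - 1); have := sqr_ge0 (z + 1).
  have := sqr_ge0 (z ^+ 2 - z); have := sqr_ge0 (z ^+ 2 + z).
  by move=> ? ? ? ? ?; apply/andP; split; nra.
rewrite normrM (ger0_norm h0) [leRHS]mulrAC ler_wpM2r// normrM mulrC.
rewrite normfV (@ger0_norm _ (c ^+ 2)) ?sqr_ge0//.
apply: ler_pM; rewrite ?invr_ge0 ?sqr_ge0//; first by apply: le_trans b _; lra.
by rewrite lef_pV2 ?posrE ?exprn_gt0// lerXn2r ?nnegrE ?(ltW t0) ?(ltW c0).
Qed.

Lemma heat_lip_x t h x : 0 < t -> 0 <= h ->
  `|heat_x (t + h) x - heat_x t x| <= 17 * h / (t * Num.sqrt t).
Proof.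
move=> t0 h0.
pose p (z : R) := (z ^+ 2 - 1) / 2.
have d (s : R) : 0 < s -> is_derive s (1 : R) (heat_x^~ x)
    ((s * Num.sqrt s)^-1 * (p (x / Num.sqrt s) * gauss (x / Num.sqrt s))).
  move=> s0; have r0 : 0 < Num.sqrt s by rewrite sqrtr_gt0.
  have d1 := is_derive_comp_sqrt x s0 is_derive_gauss.
  have d2 := is_deriveV (lt0r_neq0 r0) (is_derive1_sqrt s0).
  apply: is_derive_eq (is_deriveM d2 d1) _.
  move: (gauss (x / _)) => g; rewrite /p /GRing.scale/=.
  have sE : s = Num.sqrt s * Num.sqrt s by rewrite -expr2 sqr_sqrtr// ltW.
  move: (Num.sqrt s) r0 sE => r r0 ->.
  by field; rewrite lt0r_neq0.
have [c [/andP[tc _] ->]] := MVT_pos d t0 h0.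
have c0 : 0 < c := lt_le_trans t0 tc.
have b : `|p (x / Num.sqrt c) * gauss (x / Num.sqrt c)| <= 1 * 17.
  apply: gauss_mul_le; rewrite /p; move: (x / Num.sqrt c) => z; rewrite ler_norml.
  by have := sqr_ge0 (z ^+ 2); have := sqr_ge0 (z ^+ 2 - 1); have := sqr_ge0 z; nra.
rewrite normrM (ger0_norm h0) [leRHS]mulrAC ler_wpM2r// normrM mulrC.
rewrite normfV (@ger0_norm _ (c * _)) ?mulr_ge0 ?sqrtr_ge0 ?(ltW c0)//.
apply: ler_pM; rewrite ?invr_ge0 ?mulr_ge0 ?sqrtr_ge0 ?(ltW c0)//; first by apply: le_trans b _;
  lra.
rewrite lef_pV2 ?posrE ?mulr_gt0 ?sqrtr_gt0//.
by apply: ler_pM; rewrite ?sqrtr_ge0 ?ler_wsqrtr ?(ltW t0).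
Qed.

Lemma heat_taylor_t t h x : 0 < t -> 0 <= h ->
  `|heat (t + h) x - heat t x - h / 2 * heat_xx t x| <= 34 * h ^+ 2 / t ^+ 2.
Proof.
move=> t0 h0.
have d (s : R) : 0 < s -> is_derive s (1 : R) (heat^~ x) (heat_xx s x / 2).
  move=> s0; apply: is_derive_eq (is_derive_comp_sqrt x s0 is_derive_Phi) _.
  by rewrite /heat_xx; move: (x / _) => z; move: (gauss z) => g; field; rewrite lt0r_neq0.
have [c [/andP[tc ct] ->]] := MVT_pos d t0 h0.
have L := @heat_lip_xx t (c - t) x t0; rewrite subrKC subr_ge0 in L.
rewrite (_ : _ - _ = h / 2 * (heat_xx c x - heat_xx t x)); last by field.
rewrite normrM ger0_norm ?divr_ge0//.
apply: (@le_trans _ _ (h / 2 * (34 * h / t ^+ 2))).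
  apply: ler_wpM2l; first by rewrite divr_ge0.
  apply: le_trans (L tc) _; rewrite ler_wpM2r ?invr_ge0 ?sqr_ge0// ler_wpM2l//.
  by rewrite lerBlDl.
rewrite !mulrA ler_wpM2r ?invr_ge0 ?sqr_ge0//.
by have := sqr_ge0 h; rewrite expr2; lra.
Qed.

End heat.

Section bexp_more.
Context {R : realType}.

Lemma bexp_exchange i j (G : bintree -> bintree -> R) :
  bexp i (fun l => bexp j (fun r => G l r)) = bexp j (fun r => bexp i (fun l => G l r)).
Proof.
rewrite !bexp.unlock /uexp.
rewrite -!mulr_suml [in RHS]mulrAC; congr (_ / _ / _).
exact: exchange_big.
Qed.

Lemma bexp_heat_taylor j (y : bintree -> R) (t x : R) : 0 < t ->
  `|bexp j (fun T => heat t (x - y T)) - heat t x + bexp j y * heat_x t x -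
    bexp j (fun T => y T ^+ 2) / 2 * heat_xx t x| <=
  17 * bexp j (fun T => `|y T| ^+ 3) / (t * Num.sqrt t).
Proof.
move=> t0.
rewrite (_ : bexp j _ - _ + _ - _ = bexp j (fun T => heat t (x + - y T) - heat t x -
    - y T * heat_x t x - (- y T) ^+ 2 / 2 * heat_xx t x)); last first.
  rewrite !bexpB bexp_cst !bexpZr bexpN mulNr opprK; congr (_ - _ / _ * _).
  by apply: eq_bexp => T _; rewrite sqrrN.
apply: le_trans (ler_norm_bexp _ _) _; rewrite -bexpZ -bexpZr.
apply: ler_bexp => T _; apply: le_trans (heat_taylor_x _ _ t0) _.
by rewrite normrN.
Qed.

End bexp_more.

(** * The central limit theorem for smoothed distribution functions *)

Section bounded_toll.
Context {R : realType}.
Variables (phi : bintree -> R) (K : nat).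
Hypotheses (phi0 : phi BEmpty = 0) (phiK : forall t, (K < bsize t)%N -> phi t = 0).

Let mu := toll_mu phi.
Let Y := csum phi mu.
Let s := toll_sigma2 phi.
(** At sizes from [H] on, the two subtrees have at least 2 K + 1 nodes together, so one of them
    exceeds [K] and has mean 0; thus the products of means in [toll2] vanish. *)
Let H := (K + K).+2.

Lemma lim_ultimately_cst (u : nat -> R) N a : (forall n, (N <= n)%N -> u n = a) -> limn u = a.
Proof.
move=> ua; apply: cvg_lim => //; apply: cvg_near_cst; by exists N.
Qed.

Lemma bexp_phi_big n (g : bintree -> R) : (K < n)%N -> bexp n (fun t => phi t * g t) = 0.
Proof.
by move=> Kn; rewrite -(bexp_cst (R := R) n 0); apply: eq_bexp => t tn; rewrite phiK ?tn// mul0r.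
Qed.

Lemma bexp_phi_big1 n : (K < n)%N -> bexp n phi = 0.
Proof.
by move=> Kn; rewrite -(bexp_cst (R := R) n 0); apply: eq_bexp => t tn; rewrite phiK ?tn.
Qed.

Lemma sum_ultimately_cst (u : nat -> R) N n : (forall j, (N <= j)%N -> u j = 0) -> (N <= n)%N ->
  \sum_(j < n) u j = \sum_(j < N) u j.
Proof.
move=> u0 Nn; rewrite -!(big_mkord xpredT u) (big_cat_nat (leq0n N) Nn)//=.
by rewrite [X in _ + X]big_nat_cond [X in _ + X]big1 ?addr0// => j /andP[/andP[Nj _] _]; exact: u0.
Qed.

Lemma toll_mu_sum n : (K < n)%N -> mu = \sum_(j < n) bst_coef j * bexp j phi.
Proof.
move=> Kn; rewrite /mu /toll_mu; apply: (@lim_ultimately_cst _ n) => m nm.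
apply: (@sum_ultimately_cst (fun j => bst_coef j * bexp j phi) _ _ _ nm) => j nj.
by rewrite bexp_phi_big1 ?mulr0// (leq_trans Kn).
Qed.

Lemma bexp_csum_big n : (K < n)%N -> bexp n Y = 0.
Proof.
by move=> Kn; rewrite /Y bexp_csum// -toll_mu_sum// subrr mulr0 subr0 bexp_phi_big1.
Qed.

Lemma toll2_big n : (H <= n)%N -> toll2 phi mu n = 0.
Proof.
case: n => // n Hn; rewrite /toll2 bexp_phi_big; last by rewrite /H in Hn; lia.
rewrite big1 ?mulr0 ?addr0// => i _.
have [Ki|iK] := ltnP K i; first by rewrite [bexp i _](bexp_csum_big Ki) mul0r.
by rewrite [X in _ * X]bexp_csum_big ?mulr0//; rewrite /H in Hn; lia.
Qed.

Lemma bexp_csum2_big n : (H <= n)%N -> bexp n (fun t => Y t ^+ 2) = s * n.+1%:R.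
Proof.
move=> Hn; rewrite /Y bexp_csum2 toll2_big// add0r mulrC; congr (_ * _).
rewrite /s /toll_sigma2; apply/esym/(@lim_ultimately_cst _ n) => m nm.
apply: (@sum_ultimately_cst (fun j => bst_coef j * toll2 phi mu j) _ _ _ nm) => j nj.
by rewrite toll2_big ?mulr0// (leq_trans Hn).
Qed.

Lemma supported_sigma2_ge0 : 0 <= s.
Proof.
have : 0 <= s * H.+1%:R by rewrite -bexp_csum2_big//; apply: bexp_ge0 => t _; exact: sqr_ge0.
by rewrite pmulr_lge0.
Qed.

(** The recurrence read backwards: at a large size the mean and the toll both vanish, hence so does
    the sum over smaller sizes. [sum_excess] is the analogue for second moments. *)
Lemma sum_bexp_csum n : (K < n)%N -> \sum_(i < n) bexp i Y = 0.
Proof.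
case: n => // n Kn; have := bexp_csum_big Kn;
  rewrite /Y bexp_csum_rec bexp_phi_big1// add0r => /eqP.
by rewrite mulf_eq0 mulf_eq0 invr_eq0 !pnatr_eq0/= => /eqP.
Qed.

Let w i : R := bexp i (fun t => Y t ^+ 2) - s * i.+1%:R.

Lemma sum_excess n : (H <= n)%N -> \sum_(i < n) w i = 0.
Proof.
case: n => // n Hn; rewrite big_split/= sumrN -mulr_sumr.
have := bexp_csum2_big Hn; rewrite /Y bexp_csum2_rec toll2_big// add0r -/Y => E.
have n1 : n.+1%:R != 0 :> R by rewrite pnatr_eq0.
apply: (mulfI (x := 2)) => //; rewrite mulr0 mulrBr mulrCA sum_nat_succ; apply/eqP.
by rewrite subr_eq0 mulrCA -E; apply/eqP; field; rewrite nat1r.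
Qed.

Let D (t : R) : R := (t * Num.sqrt t)^-1.

Let D_ge0 t : 0 <= t -> 0 <= D t.
Proof. by move=> t0; rewrite invr_ge0 mulr_ge0 ?sqrtr_ge0. Qed.

Let D_anti t h : 0 < t -> 0 <= h -> D (t + h) <= D t.
Proof.
move=> t0 h0; have th0 : 0 < t + h by rewrite ltr_wpDr.
rewrite lef_pV2 ?posrE ?mulr_gt0 ?sqrtr_gt0//.
by apply: ler_pM; rewrite ?sqrtr_ge0 ?ler_wsqrtr ?lerDl ?(ltW t0).
Qed.

Let D_sqr t : 1 <= t -> (t ^+ 2)^-1 <= D t.
Proof.
move=> t1; have t0 : 0 < t by rewrite (lt_le_trans _ t1).
rewrite lef_pV2 ?posrE ?mulr_gt0 ?sqrtr_gt0//.
rewrite expr2 ler_pM2l// -[leRHS]ger0_norm ?(ltW t0)// -sqrtr_sqr ler_wsqrtr//.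
by rewrite expr2 ler_peMl// ltW.
Qed.

(* The two correction terms vanish for [j >= H]; for the finitely many smaller [j] they cancel
   on averaging over the split, by [sum_bexp_csum] and [sum_excess]. *)
Let estimate j (C : R) := forall t x, 1 <= t ->
  `|bexp j (fun T => heat t (x - Y T)) - heat (t + s * j.+1%:R) x +
    (bexp j Y * heat_x t x - w j / 2 * heat_xx t x)| <= C * D t.

(** The constant contains a third moment and is not controlled in [j]; [heat_clt] uses it only for
    [j < H + H]. *)
Lemma estimate_fixed j : exists2 C, 0 <= C & estimate j C.
Proof.
pose T3 : R := bexp j (fun T => `|Y T| ^+ 3).
have h0 : 0 <= s * j.+1%:R by rewrite mulr_ge0 ?supported_sigma2_ge0.
exists (17 * T3 + 34 * (s * j.+1%:R) ^+ 2).
  have T30 : 0 <= T3 by apply: bexp_ge0 => T _; rewrite exprn_ge0.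
  by rewrite addr_ge0// mulr_ge0// sqr_ge0.
move=> t x t1; have t0 : 0 < t by rewrite (lt_le_trans _ t1).
rewrite /w; move: (s * j.+1%:R) h0 => h h0.
have A := bexp_heat_taylor j Y x t0; rewrite -/T3 -/(D t) in A.
have B := heat_taylor_t x t0 h0.
have B' : `|heat (t + h) x - heat t x - h / 2 * heat_xx t x| <= 34 * h ^+ 2 * D t.
  by apply: le_trans B _; rewrite ler_wpM2l ?mulr_ge0 ?sqr_ge0// D_sqr.
rewrite [leRHS]mulrDl.
move: A B'; move: (bexp j (fun T => heat _ _)) (bexp j (fun T => Y T ^+ 2)) (bexp j Y) =>
  a b c A B'.
rewrite (_ : _ + _ = (a - heat t x + c * heat_x t x - b / 2 * heat_xx t x) -
  (heat (t + h) x - heat t x - h / 2 * heat_xx t x)); last by field.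
by apply: le_trans (ler_normB _ _) _; rewrite lerD.
Qed.

(** Given [l], the estimate for [r] is applied at x - Y l; it has no correction since [r] is large.
    The one for [i] then applies at the later time [t'], where [D] is smaller. Its correction is
    moved to the final time by the Lipschitz bounds: only there do the corrections of different
    splits have common factors and cancel in the sum. *)
Lemma estimate_pair i r (C C' : R) : (H <= r)%N -> estimate i C -> estimate r C' ->
  forall t x, 1 <= t ->
  `|bexp i (fun l => bexp r (fun r' => heat t (x - (Y l + Y r')))) -
    heat (t + s * (i + r).+2%:R) x +
    (bexp i Y * heat_x (t + s * (i + r).+2%:R) x - w i / 2 * heat_xx (t + s * (i + r).+2%:R) x)| <=
  (C + C' + (17 * `|bexp i Y| + 34 * `|w i / 2|) * (s * i.+1%:R)) * D t.
Proof.
move=> Hr ei er t x t1; have t0 : 0 < t by rewrite (lt_le_trans _ t1).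
have r0 : bexp r Y = 0 by apply: bexp_csum_big; rewrite /H in Hr; lia.
have wr0 : w r = 0 by rewrite /w bexp_csum2_big// subrr.
have hr0 : 0 <= s * r.+1%:R by rewrite mulr_ge0 ?supported_sigma2_ge0.
have hi0 : 0 <= s * i.+1%:R by rewrite mulr_ge0 ?supported_sigma2_ge0.
have -> : t + s * (i + r).+2%:R = t + s * r.+1%:R + s * i.+1%:R.
  by rewrite -addnS -addSn natrD; ring.
have C'0 : 0 <= C' * D t by apply: le_trans (er t x t1).
set t' := t + s * r.+1%:R.
have t'1 : 1 <= t' by rewrite (le_trans t1)// lerDl.
have t'0 : 0 < t' by rewrite (lt_le_trans _ t'1).
have Dt' : D t' <= D t by exact: D_anti.
have A1 : `|bexp i (fun l => bexp r (fun r' => heat t (x - (Y l + Y r')))) -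
    bexp i (fun l => heat t' (x - Y l))| <= C' * D t.
  rewrite -bexpB; apply: le_trans (ler_norm_bexp _ _) _.
  rewrite -[leRHS](bexp_cst i); apply: ler_bexp => l _.
  have := er t (x - Y l) t1; rewrite r0 wr0 !mul0r subrr addr0 -/t'; apply: le_trans.
  rewrite le_eqVlt; apply/orP; left; apply/eqP; congr `|_ - _|.
  by apply: eq_bexp => T _; rewrite opprD addrA.
have C0 : 0 <= C.
  have := le_trans (normr_ge0 _) (ei t x t1); rewrite pmulr_lge0// invr_gt0 mulr_gt0//.
  by rewrite sqrtr_gt0.
have A2 := le_trans (ei t' x t'1) (ler_wpM2l C0 Dt').
move: A2; move: (s * i.+1%:R) hi0 => hi hi0 A2.
have A3 : `|bexp i Y * (heat_x (t' + hi) x - heat_x t' x)| <= 17 * `|bexp i Y| * hi * D t.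
  rewrite normrM -![in leRHS]mulrA [leRHS]mulrCA ler_wpM2l//.
  apply: le_trans (heat_lip_x x t'0 hi0) _.
  by rewrite [leRHS]mulrA; apply: ler_wpM2l; first exact: mulr_ge0.
have A4 : `|w i / 2 * (heat_xx (t' + hi) x - heat_xx t' x)| <= 34 * `|w i / 2| * hi * D t.
  rewrite normrM -![in leRHS]mulrA [leRHS]mulrCA ler_wpM2l//.
  apply: le_trans (heat_lip_xx x t'0 hi0) _.
  rewrite [leRHS]mulrA; apply: ler_wpM2l; first exact: mulr_ge0.
  exact: le_trans (D_sqr t'1) Dt'.
rewrite (_ : (C + _ + _) * _ = C' * D t + C * D t + 17 * `|bexp i Y| * hi * D t +
  34 * `|w i / 2| * hi * D t); last by ring.
rewrite (_ : _ - _ + _ = (bexp i (fun l => bexp r (fun r' => heat t (x - (Y l + Y r')))) -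
    bexp i (fun l => heat t' (x - Y l))) +
  (bexp i (fun T => heat t' (x - Y T)) - heat (t' + hi) x +
    (bexp i Y * heat_x t' x - w i / 2 * heat_xx t' x)) +
  bexp i Y * (heat_x (t' + hi) x - heat_x t' x) -
  w i / 2 * (heat_xx (t' + hi) x - heat_xx t' x)); last by ring.
apply: le_trans (ler_normB _ _) _; apply: lerD => //.
apply: le_trans (ler_normD _ _) _; apply: lerD => //.
by apply: le_trans (ler_normD _ _) _; apply: lerD.
Qed.

Lemma heat_clt : exists2 C, 0 <= C & forall n, (H <= n)%N -> forall t x, 1 <= t ->
  `|bexp n (fun T => heat t (x - Y T)) - heat (t + s * n.+1%:R) x| <= C * n.+1%:R * D t.
Proof.
have /choice[cf cfP] : forall j, exists C, 0 <= C /\ estimate j C.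
  by move=> j; have [C] := estimate_fixed j; exists C.
pose ex i := (17 * `|bexp i Y| + 34 * `|w i / 2|) * (s * i.+1%:R).
have ex0 i : 0 <= ex i by rewrite mulr_ge0 ?addr_ge0 ?mulr_ge0 ?supported_sigma2_ge0.
pose C0 := \sum_(j < H + H) cf j; pose E := C0 + \sum_(j < H) ex j.
have cf_ge0 j : 0 <= cf j by case: (cfP j).
have C00 : 0 <= C0 by apply: sumr_ge0.
have E0 : 0 <= E by rewrite addr_ge0// sumr_ge0.
have cfC0 j : (j < H + H)%N -> cf j <= C0.
  move=> jH; rewrite /C0 (bigD1 (Ordinal jH))//= lerDl; exact: sumr_ge0.
have exE j : (j < H)%N -> C0 + ex j <= E.
  move=> jH; rewrite /E lerD2l (bigD1 (Ordinal jH))//= lerDl; exact: sumr_ge0.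
pose C := C0 + 2 * E; have CC : 0 <= C by rewrite addr_ge0// mulr_ge0.
have Ybig j : (H <= j)%N -> bexp j Y = 0 by move=> Hj; apply: bexp_csum_big; rewrite /H in Hj; lia.
have wbig j : (H <= j)%N -> w j = 0 by move=> Hj; rewrite /w bexp_csum2_big// subrr.
exists C => //; elim/ltn_ind => n IH Hn t x t1.
have t0 : 0 < t by rewrite (lt_le_trans _ t1).
have Dt0 : 0 <= D t by apply: D_ge0; exact: ltW.
have [nHH|HHn] := ltnP n (H + H).
  have [_ /(_ t x t1)] := cfP n; rewrite Ybig// wbig// !mul0r subrr addr0 => /le_trans; apply.
  rewrite ler_wpM2r//; apply: le_trans (cfC0 n nHH) _.
  by apply: (@le_trans _ _ C); [rewrite lerDl mulr_ge0|rewrite ler_peMr// ler1n].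
case: n IH Hn HHn => // m IH Hm HHm.
pose de j : R := if (j < H)%N then E else C * j.+1%:R.
have est j : (j <= m)%N -> estimate j (if (j < H)%N then C0 else C * j.+1%:R).
  move=> jm t' x' t'1; case: ifP => jH.
    have [_ /(_ t' x' t'1)/le_trans] := cfP j; apply.
    have t'0 : 0 <= t' by rewrite (le_trans _ t'1).
    by rewrite ler_wpM2r ?D_ge0// cfC0// ltn_addr.
  have Hj : (H <= j)%N by rewrite leqNgt jH.
  by rewrite Ybig// wbig// !mul0r subrr addr0; apply: IH.
pose t' := t + s * m.+2%:R.
pose W i := bexp i Y * heat_x t' x - w i / 2 * heat_xx t' x.
pose A i r := bexp i (fun l => bexp r (fun r' => heat t (x - (Y l + Y r')))) - heat t' x.
have pair i r : (i + r)%N = m -> (H <= r)%N -> `|A i r + W i + W r| <= (de i + de r) * D t.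
  move=> irm Hr; rewrite {2}/W Ybig// wbig// !mul0r subrr addr0.
  have im : (i <= m)%N by rewrite -irm leq_addr.
  have rm : (r <= m)%N by rewrite -irm leq_addl.
  have := estimate_pair Hr (est i im) (est r rm) x t1; rewrite irm -/t' => /le_trans; apply.
  rewrite ler_wpM2r// /de [in X in _ + X + _]ltnNge Hr/= [in X in _ <= _ + X]ltnNge Hr/= addrAC
    lerD2r.
  case: ifP => iH; first exact: exE.
  have Hi : (H <= i)%N by rewrite leqNgt iH.
  by rewrite Ybig// wbig// !mul0r !normr0 !mulr0 addr0 mul0r addr0.
(* Since [H + H <= m.+1], one of the two subtrees has size at least [H]; exchanging them if
   necessary, it is the right one. *)
have pair' i : (i <= m)%N -> `|A i (m - i)%N + (W i + W (m - i)%N)| <= (de i + de (m - i)%N) * D t.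
  move=> im; rewrite addrA; have [Hr|rH] := leqP H (m - i); first by apply: pair; rewrite ?subnKC.
  rewrite addrAC [de i + _]addrC.
  have -> : A i (m - i)%N = A (m - i)%N i.
    rewrite /A bexp_exchange; congr (_ - _); apply: eq_bexp => l _; apply: eq_bexp => r _.
    by rewrite [X in x - X]addrC.
  apply: pair; first by rewrite subnK.
  by move: HHm rH; rewrite /H; lia.
have m0 : 0 < m.+1%:R :> R by rewrite ltr0n.
have -> : bexp m.+1 (fun T => heat t (x - Y T)) - heat t' x =
    (\sum_(i < m.+1) (A i (m - i)%N + (W i + W (m - i)%N))) / m.+1%:R.
  have W0 : \sum_(i < m.+1) W i = 0.
    rewrite big_split/= sumrN -!mulr_suml sum_bexp_csum ?sum_excess ?mul0r ?subrr//.
    by rewrite /H in Hm; lia.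
  have -> : \sum_(i < m.+1) (A i (m - i)%N + (W i + W (m - i)%N)) = \sum_(i < m.+1) A i (m - i)%N.
    rewrite big_split/= -[RHS]addr0; congr (_ + _).
    by rewrite big_split/= (sum_rev m W) W0 addr0.
  have -> : \sum_(i < m.+1) A i (m - i)%N = \sum_(i < m.+1) bexp i (fun l =>
      bexp (m - i) (fun r' => heat t (x - (Y l + Y r')))) - heat t' x * m.+1%:R.
    by rewrite big_split/= sumrN sumr_const card_ord mulr_natr.
  rewrite bexp_split mulrBl mulfK ?lt0r_neq0//; congr (_ / _ - _).
  apply: eq_bigr => i _; apply: eq_bexp => l li; apply: eq_bexp => r ri.
  rewrite /Y csum_node phiK ?add0r//= li ri subnKC; last by rewrite -ltnS.
  by rewrite /H in Hm; lia.
rewrite normrM normfV (ger0_norm (ltW m0)) ler_pdivrMr//.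
apply: le_trans (ler_norm_sum _ _ _) _.
apply: (@le_trans _ _ (\sum_(i < m.+1) (de i + de (m - i)%N) * D t)).
  by apply: ler_sum => i _; apply: pair'; rewrite -ltnS.
rewrite -mulr_suml big_split/= (sum_rev m de) mulrAC ler_wpM2r//.
have -> : \sum_(i < m.+1) de i = H%:R * E + C * (\sum_(i < m.+1) i.+1%:R - \sum_(i < H) i.+1%:R).
  have cut (F : nat -> R) : \sum_(i < m.+1) F i = \sum_(i < H) F i + \sum_(H <= i < m.+1) F i.
    by rewrite -!(big_mkord xpredT F) (big_cat_nat (leq0n H) Hm).
  rewrite (cut de) (cut (fun i => i.+1%:R)) [X in _ * (X - _)]addrC addrK; congr (_ + _).
    rewrite (eq_bigr (fun=> E)); last by move=> i _; rewrite /de ltn_ord.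
    by rewrite sumr_const card_ord mulr_natl.
  rewrite mulr_sumr; apply: eq_big_nat => i /andP[Hi _].
  by rewrite /de ltnNge Hi.
have S1 := @sum_nat_succ R m.+1; have S2 := @sum_nat_succ R H.
have h2 : 2 <= H.+1%:R :> R by rewrite ler_nat.
(* The small sizes cost 2 H E, while their share C H (H + 1) of the target is still free; as E <= C
   and H + 1 >= 2 the constant [C] reproduces itself. *)
have : 2 * (H%:R * E) <= C * (H%:R * H.+1%:R).
  have EC : E <= C by rewrite /C; lra.
  have h3 : H%:R * E <= H%:R * C by rewrite ler_wpM2l.
  have h4 : C * H%:R * 2 <= C * H%:R * H.+1%:R by rewrite ler_wpM2l// mulr_ge0.
  lra.
move: S1 S2; move: (\sum_(i < m.+1) _) (\sum_(i < H) _) => a b S1 S2 h.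
rewrite [leLHS](_ : _ = 2 * (H%:R * E) + C * (2 * a) - C * (2 * b)); last by ring.
by rewrite S1 S2; lra.
Qed.

End bounded_toll.

(** * Continuity of the centred functional and of sigma^2 in the toll *)

Section perturbation.
Context {R : realType}.
Implicit Types (phi psi : bintree -> R).

Lemma tsumB phi psi t : tsum (fun t => phi t - psi t) t = tsum phi t - tsum psi t.
Proof. by rewrite /tsum big_split/= sumrN. Qed.

Lemma csumB phi psi mu nu t :
  csum (fun t => phi t - psi t) (mu - nu) t = csum phi mu t - csum psi nu t.
Proof. by rewrite /csum tsumB; ring. Qed.

Lemma toll_leB phi psi c d al : toll_le phi c al -> toll_le psi d al ->
  toll_le (fun t => phi t - psi t) (c + d) al.
Proof.
by move=> hc hd t; apply: le_trans (ler_normB _ _) _; rewrite mulrDl lerD.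
Qed.

Lemma toll_le_weaken phi c d al bt : c <= d -> 0 <= d -> al <= bt -> toll_le phi c al ->
  toll_le phi d bt.
Proof.
move=> cd d0 albt le t; apply: le_trans (le t) _.
apply: (@le_trans _ _ (d * (bsize t).+1%:R `^ al)); first by rewrite ler_wpM2r ?powR_ge0.
by rewrite ler_wpM2l// ler_powR// ler1n.
Qed.

Lemma toll_muB phi psi c d al : 0 <= al -> al < 1 / 2 -> 0 < c -> 0 < d ->
  toll_le phi c al -> toll_le psi d al ->
  toll_mu (fun t => phi t - psi t) = toll_mu phi - toll_mu psi.
Proof.
move=> al0 al2 c0 d0 phil psil.
have [h1 _] := toll_mu_cvg al0 al2 c0 phil; have [h2 _] := toll_mu_cvg al0 al2 d0 psil.
apply: cvg_lim => //; rewrite (_ : (fun n => _) = (fun n => \sum_(j < n) bst_coef j * bexp j phi -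
  \sum_(j < n) bst_coef j * bexp j psi)); first exact: cvgB.
apply/funext => n; rewrite -sumrB; apply: eq_bigr => j _.
by rewrite bexpB mulrBr.
Qed.

(** A form of the Cauchy-Schwarz inequality without roots of expectations; [la] is to be taken of
    the order of the standard deviation. *)
Lemma bexp_norm_le n (g : bintree -> R) (la : R) : 0 < la ->
  bexp n (fun t => `|g t|) <= (la + bexp n (fun t => g t ^+ 2) / la) / 2.
Proof.
move=> la0; rewrite -[X in X + _](bexp_cst n) -bexpZr -bexpD -bexpZr; apply: ler_bexp => t _.
rewrite ler_pdivlMr// -(real_normK (num_real (g t))).
rewrite (_ : la + _ = (la * la + `|g t| ^+ 2) / la); last by field; rewrite lt0r_neq0.
by rewrite ler_pdivlMr//; have := sqr_ge0 (`|g t| - la); rewrite !expr2; lra.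
Qed.

Lemma toll_perturbation al : 0 <= al -> al < 1 / 2 ->
  exists2 C : R, 0 <= C & forall phi psi c e,
  phi BEmpty = 0 -> psi BEmpty = 0 -> 0 < c -> 0 < e ->
  toll_le phi c al -> toll_le (fun t => phi t - psi t) e al ->
  (forall n, bexp n (fun t => `|csum phi (toll_mu phi) t - csum psi (toll_mu psi) t|) <=
     e * C * Num.sqrt n.+1%:R) /\
  `|toll_sigma2 phi - toll_sigma2 psi| <= C * (e ^+ 2 + e + e * c ^+ 2).
Proof.
move=> al0 al2; have [C0 HC] := @bexp_csum2_uniform R al al0 al2.
exists (1 + `|C0|) => [|phi psi c e phi0 psi0 c0 e0 lephi lediff]; first by rewrite addr_ge0.
set C := 1 + `|C0|; have C0C : C0 <= C by rewrite /C; have := ler_norm C0; lra.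
have C1 : 1 <= C by rewrite /C lerDl.
have lepsi : toll_le psi (c + e) al.
  move=> t; rewrite -[psi t](subKr (phi t)); exact: (toll_leB lephi lediff t).
have ce0 : 0 < c + e by rewrite addr_gt0.
have muE := toll_muB al0 al2 c0 ce0 lephi lepsi.
have diff2 n : bexp n (fun t => (csum phi (toll_mu phi) t - csum psi (toll_mu psi) t) ^+ 2) <=
    C * e ^+ 2 * n.+1%:R.
  have := HC (fun t => phi t - psi t) e _ e0 lediff n; rewrite phi0 psi0 subrr muE.
  under [in X in X -> _]eq_bexp do rewrite csumB.
  move=> /(_ erefl)/le_trans; apply.
  by rewrite ler_wpM2r// ler_wpM2r// sqr_ge0.
split=> [n|].
  have s0 : 0 < Num.sqrt n.+1%:R :> R by rewrite sqrtr_gt0.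
  have la0 : 0 < e * Num.sqrt n.+1%:R by rewrite mulr_gt0.
  apply: le_trans (bexp_norm_le _ _ la0) _.
  rewrite ler_pdivrMr// [leLHS](_ : _ = ((e * Num.sqrt n.+1%:R) ^+ 2 +
    bexp n (fun t => (csum phi (toll_mu phi) t - csum psi (toll_mu psi) t) ^+ 2)) /
    (e * Num.sqrt n.+1%:R)); last first.
    by field; rewrite !lt0r_neq0.
  rewrite ler_pdivrMr//; apply: le_trans (lerD (lexx _) (diff2 n)) _.
  have := sqr_sqrtr (ler0n R n.+1); move: (Num.sqrt _) s0 => r r0 <-.
  have : (e * r) ^+ 2 <= C * (e * r) ^+ 2 by rewrite ler_peMl ?sqr_ge0.
  rewrite !exprMn !expr2; lra.
have [_ sphi] := toll_sigma2_cvg phi0 al0 al2 c0 lephi.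
have [_ spsi] := toll_sigma2_cvg psi0 al0 al2 ce0 lepsi.
apply: (@cvgr_to_le _ \oo _ _ _ _ _ (cvg_norm (cvgB sphi spsi))).
apply: nearW => n.
change (`|bexp n (fun t => csum phi (toll_mu phi) t ^+ 2) / n.+1%:R -
  bexp n (fun t => csum psi (toll_mu psi) t ^+ 2) / n.+1%:R| <= C * (e ^+ 2 + e + e * c ^+ 2)).
rewrite -mulrBl -bexpB normrM normfV (ger0_norm (ler0n R n.+1)) ler_pdivrMr ?ltr0n//.
apply: le_trans (ler_norm_bexp _ _) _.
set X := csum phi _; set Y := csum psi _.
(* For d = x - y, |x^2 - y^2| <= d^2 (1 + 1/e) + e x^2. The second moment of d is O(e^2 n) and that
   of x is O(c^2 n), which gives e^2 + e + e c^2. *)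
apply: (@le_trans _ _ (bexp n (fun t => (X t - Y t) ^+ 2 * (1 + e^-1) + e * X t ^+ 2))).
  apply: ler_bexp => t _.
  have -> : X t ^+ 2 - Y t ^+ 2 = 2 * (X t * (X t - Y t)) - (X t - Y t) ^+ 2 by ring.
  move: (X t) (X t - Y t) => x d.
  have h : `|2 * (x * d)| <= d ^+ 2 / e + e * x ^+ 2.
    rewrite [leRHS](_ : _ = (d ^+ 2 + (e * x) ^+ 2) / e); last by field; rewrite lt0r_neq0.
    rewrite ler_pdivlMr// -[X in _ * X]gtr0_norm// -normrM ler_norml.
    by have := sqr_ge0 (d - e * x); have := sqr_ge0 (d + e * x); rewrite !expr2; lra.
  apply: le_trans (ler_normB _ _) _; rewrite (ger0_norm (sqr_ge0 d)); lra.
rewrite bexpD bexpZr bexpZ.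
have h1 := HC phi c phi0 c0 lephi n; have h2 := diff2 n.
have i0 : 0 <= 1 + e^-1 by rewrite addr_ge0// invr_ge0 ltW.
have h3 : e * bexp n (fun t => X t ^+ 2) <= e * (C * c ^+ 2 * n.+1%:R).
  rewrite ler_wpM2l ?(ltW e0)//; apply: le_trans h1 _.
  by rewrite ler_wpM2r// ler_wpM2r// sqr_ge0.
apply: le_trans (lerD (ler_wpM2r i0 h2) h3) _.
rewrite le_eqVlt; apply/orP; left; apply/eqP; field.
by rewrite lt0r_neq0.
Qed.

End perturbation.

(** * The smoothed limit theorem for general tolls *)

Section smooth_clt.
Context {R : realType}.

Lemma Phi_lipschitz (x y : R) : `|Phi x - Phi y| <= 17 * `|x - y|.
Proof.
have [c [_ E]] := MVT_all (@is_derive_Phi R) y (x - y).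
rewrite subrKC in E; rewrite E normrM ler_wpM2r//.
have := @gauss_mul_le R 1 1 c; rewrite !mul1r; apply.
by rewrite normr1 lerDl exprn_even_ge0.
Qed.

Lemma heat_lipschitz (t x y : R) : `|heat t x - heat t y| <= 17 / Num.sqrt t * `|x - y|.
Proof.
apply: le_trans (Phi_lipschitz _ _) _.
by rewrite -mulrBl normrM normfV (ger0_norm (sqrtr_ge0 t)) mulrA mulrAC.
Qed.

Lemma Phi_continuous : continuous (@Phi R).
Proof.
by move=> z; apply: differentiable_continuous; apply/derivable1_diffP; case: (is_derive_Phi z).
Qed.

Lemma heat_cvg (T : Type) (F : set_system T) (FF : Filter F) (u v : T -> R) (t x : R) : 0 < t ->
  u @ F --> t -> v @ F --> x -> (fun n => heat (u n) (v n)) @ F --> heat t x.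
Proof.
move=> t0 ut vx; apply: (@continuous_cvg _ _ _ _ _ (fun n => v n / Num.sqrt (u n)) Phi).
  exact: Phi_continuous.
apply: cvgM => //; apply: cvgV; first by rewrite gt_eqF// sqrtr_gt0.
by apply: continuous_cvg => //; exact: sqrt_continuous.
Qed.

Lemma heat_scale (t x r : R) : 0 < r -> heat (t * (r * r)) (x * r) = heat t x.
Proof.
move=> r0; rewrite /heat; have -> : Num.sqrt (t * (r * r)) = Num.sqrt t * r.
  by rewrite [t * _]mulrC sqrtrM ?mulr_ge0 ?(ltW r0)// -expr2 sqrtr_sqr gtr0_norm// mulrC.
by rewrite -mulf_div divff ?mulr1 ?lt0r_neq0.
Qed.

Definition trunc_toll (phi : bintree -> R) K t := if (bsize t <= K)%N then phi t else 0.

(** Beyond the cut, n^al = n^(al - bt) n^bt with a first factor at most (K + 1)^(al - bt): a larger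
    exponent buys a small constant. *)
Lemma trunc_toll_diff (phi : bintree -> R) (c al bt : R) K : 0 <= c -> al <= bt ->
  toll_le phi c al ->
  toll_le (fun t => phi t - trunc_toll phi K t) (c * K.+1%:R `^ (al - bt)) bt.
Proof.
move=> c0 albt le t; rewrite /trunc_toll; case: ifP => tK.
  by rewrite subrr normr0 !mulr_ge0// powR_ge0.
rewrite subr0; apply: le_trans (le t) _; rewrite -mulrA ler_wpM2l//.
rewrite -[al in leLHS](subrK bt) [leLHS]powRD ?pnatr_eq0 ?implybT// ler_wpM2r ?powR_ge0//.
rewrite -[al - bt]opprB !powRN lef_pV2 ?posrE ?powR_gt0//.
apply: ge0_ler_powR; rewrite ?nnegrE ?subr_ge0// ler_nat ltnS ltnW//.
by rewrite ltnNge tK.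
Qed.

Lemma smooth_clt_trunc (phi : bintree -> R) K (tau x : R) : phi BEmpty = 0 ->
  (forall t, (K < bsize t)%N -> phi t = 0) -> 0 < tau ->
  (fun n => bexp n (fun T => heat tau (x - csum phi (toll_mu phi) T / Num.sqrt n.+1%:R)))
    @ \oo --> heat (tau + toll_sigma2 phi) x.
Proof.
move=> phi0 phiK tau0; have [C C0 clt] := heat_clt phi0 phiK.
have s0 : 0 < Num.sqrt tau by rewrite sqrtr_gt0.
have lim0 : (fun n => C / (tau * Num.sqrt tau) * n.+1%:R `^ (- 2^-1)) @ \oo --> (0 : R).
  rewrite -[0](mulr0 (C / (tau * Num.sqrt tau))); apply: cvgM; first exact: cvg_cst.
  by apply: cvg_powRN; rewrite invr_gt0.
apply/cvgrPdist_le => e e0.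
have ev : \forall n \near \oo, 1 <= tau * n.+1%:R.
  near=> n; rewrite -ler_pdivrMl// mulr1; apply: (@le_trans _ _ n%:R); last by rewrite ler_nat.
  by near: n; exact: nbhs_infty_ger.
near=> n; rewrite distrC.
have r0 : 0 < Num.sqrt n.+1%:R :> R by rewrite sqrtr_gt0.
have rr : Num.sqrt n.+1%:R * Num.sqrt n.+1%:R = n.+1%:R :> R by rewrite -expr2 sqr_sqrtr.
have t1 : 1 <= tau * n.+1%:R by near: n.
have Hn : ((K + K).+2 <= n)%N by near: n; exists (K + K).+2.
have := clt n Hn _ (x * Num.sqrt n.+1%:R) t1.
have E0 : heat ((tau + toll_sigma2 phi) * n.+1%:R) (x * Num.sqrt n.+1%:R) =
    heat (tau + toll_sigma2 phi) x by rewrite -[RHS](heat_scale _ _ r0) rr.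
rewrite -mulrDl E0.
rewrite (_ : bexp n _ = bexp n (fun T =>
  heat tau (x - csum phi (toll_mu phi) T / Num.sqrt n.+1%:R))).
  move=> /le_trans; apply.
  have -> : C * n.+1%:R * (tau * n.+1%:R * Num.sqrt (tau * n.+1%:R))^-1 =
      C / (tau * Num.sqrt tau) * n.+1%:R `^ (- 2^-1).
    rewrite powRN powR12_sqrt// sqrtrM ?(ltW tau0)//.
    move: (Num.sqrt n.+1%:R) r0 rr => r r0 <-; by field; rewrite !lt0r_neq0.
  near: n; move/cvgr0Pnorm_le : lim0 => /(_ _ e0); apply: filterS => n; apply: le_trans.
  exact: ler_norm.
apply: eq_bexp => T _; rewrite -[RHS](heat_scale _ _ r0) rr; congr heat.
by rewrite mulrBl divfK// lt0r_neq0.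
Unshelve. all: by end_near. Qed.

Lemma bexp_heat_lipschitz (g h : bintree -> R) n (tau x : R) :
  `|bexp n (fun T => heat tau (x - g T)) - bexp n (fun T => heat tau (x - h T))| <=
  17 / Num.sqrt tau * bexp n (fun T => `|g T - h T|).
Proof.
rewrite -bexpB; apply: le_trans (ler_norm_bexp _ _) _; rewrite -bexpZ.
apply: ler_bexp => T _; apply: le_trans (heat_lipschitz _ _ _) _.
by rewrite (_ : x - g T - (x - h T) = - (g T - h T)) ?normrN//; ring.
Qed.

Lemma toll_sigma2_ge0 (phi : bintree -> R) (c al : R) : phi BEmpty = 0 -> 0 <= al -> al < 1 / 2 ->
  0 < c -> toll_le phi c al -> 0 <= toll_sigma2 phi.
Proof.
move=> phi0 al0 al2 c0 le; have [_ lim] := toll_sigma2_cvg phi0 al0 al2 c0 le.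
apply: (@cvgr_to_ge _ \oo _ _ _ _ _ lim); apply: nearW => n /=.
by rewrite divr_ge0//; apply: bexp_ge0 => t _; exact: sqr_ge0.
Qed.

Lemma toll_sigma2_cvg_seq (phi : bintree -> R) (psi : nat -> bintree -> R) (c al : R) (e : nat ->
  R) :
  0 <= al -> al < 1 / 2 -> phi BEmpty = 0 -> (forall N, psi N BEmpty = 0) -> 0 < c ->
  toll_le phi c al -> (forall N, 0 < e N) -> e @ \oo --> (0 : R) ->
  (forall N, toll_le (fun t => phi t - psi N t) (e N) al) ->
  (fun N => toll_sigma2 (psi N)) @ \oo --> toll_sigma2 phi.
Proof.
move=> al0 al2 phi0 psi0 c0 le e0 e_lim lediff; have [C C0 HC] := @toll_perturbation R al al0 al2.
have lim : (fun N => C * (e N ^+ 2 + e N + e N * c ^+ 2)) @ \oo --> (0 : R).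
  rewrite -[0](mulr0 C); apply: cvgM; first exact: cvg_cst.
  rewrite -[X in _ --> X](_ : 0 * 0 + 0 + 0 * c ^+ 2 = 0); last by rewrite !mul0r !addr0.
  by apply: cvgD; [apply: cvgD => //; exact: (cvgM e_lim e_lim)|apply: cvgM => //; exact: cvg_cst].
apply/cvgrPdist_le => d d0; move/cvgr0Pnorm_le : lim => /(_ _ d0); apply: filterS => N.
apply: le_trans; apply: le_trans (ler_norm _).
by have [_] := HC phi (psi N) c (e N) phi0 (psi0 N) c0 (e0 N) le (lediff N).
Qed.

Lemma smooth_clt (phi : bintree -> R) (c al tau x : R) : phi BEmpty = 0 -> 0 <= al -> al < 1 / 2 ->
  0 < c -> toll_le phi c al -> 0 < tau ->
  (fun n => bexp n (fun T => heat tau (x - csum phi (toll_mu phi) T / Num.sqrt n.+1%:R)))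
    @ \oo --> heat (tau + toll_sigma2 phi) x.
Proof.
move=> phi0 al0 al2 c0 le tau0.
(* Any exponent strictly between al and 1/2 would do: above al the truncation error tends to 0,
   below 1/2 the moment bounds hold. *)
pose bt := (al + 1 / 2) / 2.
have [albt bt0 bt2] : [/\ al < bt, 0 <= bt & bt < 1 / 2] by rewrite /bt; split; lra.
pose e K := c * K.+1%:R `^ (al - bt).
have e0 K : 0 < e K by rewrite mulr_gt0// powR_gt0.
have e_lim : e @ \oo --> (0 : R).
  rewrite -[0](mulr0 c); apply: cvgM; first exact: cvg_cst.
  by rewrite -[al - bt]opprB; apply: cvg_powRN; lra.
have lebt : toll_le phi c bt by apply: toll_le_weaken le => //; exact: ltW.
pose psi := trunc_toll phi.
have psi0 K : psi K BEmpty = 0 by [].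
have lediff K : toll_le (fun t => phi t - psi K t) (e K) bt by apply: trunc_toll_diff => //;
  exact: ltW.
have sig := toll_sigma2_cvg_seq bt0 bt2 phi0 psi0 c0 lebt e0 e_lim lediff.
have [C C0 HC] := @toll_perturbation R bt bt0 bt2.
have heatlim : (fun K => heat (tau + toll_sigma2 (psi K)) x) @ \oo -->
  heat (tau + toll_sigma2 phi) x.
  apply: heat_cvg; [|by apply: cvgD => //; exact: cvg_cst|exact: cvg_cst].
  by rewrite ltr_wpDr// (toll_sigma2_ge0 phi0 al0 al2 c0 le).
have blim : (fun K => 17 / Num.sqrt tau * (e K * C)) @ \oo --> (0 : R).
  rewrite -[X in _ --> X](_ : 17 / Num.sqrt tau * (0 * C) = 0); last by rewrite mul0r mulr0.
  by apply: cvgM; [exact: cvg_cst|apply: cvgM => //; exact: cvg_cst].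
apply/cvgrPdist_le => d d0.
have d3 : 0 < d / 3 by rewrite divr_gt0.
have [K [hK bK]] : exists K, `|heat (tau + toll_sigma2 phi) x -
  heat (tau + toll_sigma2 (psi K)) x| <= d / 3 /\
    17 / Num.sqrt tau * (e K * C) <= d / 3.
  near \oo => K; exists K; split; near: K; first by move/cvgrPdist_le : heatlim; apply.
  move/cvgr0Pnorm_le : blim => /(_ _ d3); apply: filterS => K; apply: le_trans; exact: ler_norm.
have psiK t : (K < bsize t)%N -> psi K t = 0 by move=> Kt; rewrite /psi /trunc_toll leqNgt Kt.
have := smooth_clt_trunc (x := x) (psi0 K) psiK tau0.
move/cvgrPdist_le => /(_ _ d3); apply: filterS => n hn.
have r0 : 0 < Num.sqrt n.+1%:R :> R by rewrite sqrtr_gt0.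
have [/(_ n) hd _] := HC phi (psi K) c (e K) phi0 (psi0 K) c0 (e0 K) lebt (lediff K).
have hL := bexp_heat_lipschitz (fun T => csum (psi K) (toll_mu (psi K)) T / Num.sqrt n.+1%:R)
  (fun T => csum phi (toll_mu phi) T / Num.sqrt n.+1%:R) n tau x.
have {}hL := le_trans hL (_ : _ <= d / 3).
rewrite [d](_ : _ = d / 3 + d / 3 + d / 3); last by field.
set a := heat _ x; set z := bexp n _.
rewrite (_ : a - z = (a - heat (tau + toll_sigma2 (psi K)) x) +
  (heat (tau + toll_sigma2 (psi K)) x -
    bexp n (fun T => heat tau (x - csum (psi K) (toll_mu (psi K)) T / Num.sqrt n.+1%:R))) +
  (bexp n (fun T => heat tau (x - csum (psi K) (toll_mu (psi K)) T / Num.sqrt n.+1%:R)) - z));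
    last by ring.
apply: le_trans (ler_normD _ _) _; apply: lerD.
  by apply: le_trans (ler_normD _ _) _; apply: lerD.
apply: hL; apply: le_trans bK; rewrite ler_wpM2l ?divr_ge0 ?sqrtr_ge0//.
rewrite -(ler_pM2r r0); apply: le_trans hd; rewrite -bexpZr; apply: ler_bexp => t _.
by rewrite -mulrBl normrM normfV (gtr0_norm r0) divfK ?lt0r_neq0// distrC.
Unshelve. all: by end_near. Qed.

End smooth_clt.

(** * From smoothed to actual distribution functions *)

Section uniform_lemmas.
Context {R : realType} {Omega : finType}.
Implicit Types (X Y : Omega -> R).

Lemma uprob_uexp (A : pred Omega) : uprob A = uexp (fun w => (A w)%:R) :> R.
Proof.
rewrite /uprob /uexp -sum1_card natr_sum big_mkcond/=; congr (_ / _).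
by apply: eq_bigr => w _; rewrite unfold_in; case: (A w).
Qed.

Lemma ler_uexp X Y : (forall w, X w <= Y w) -> uexp X <= uexp Y.
Proof. by move=> XY; rewrite /uexp ler_wpM2r ?invr_ge0//; apply: ler_sum. Qed.

Lemma uexpD X Y : uexp (fun w => X w + Y w) = uexp X + uexp Y.
Proof. by rewrite /uexp big_split/= mulrDl. Qed.

Lemma uexpZ (a : R) X : uexp (fun w => a * X w) = a * uexp X.
Proof. by rewrite /uexp -mulr_sumr mulrA. Qed.

(** Only an inequality, because the average over an empty [Omega] is 0. *)
Lemma uexp_cst_le (a : R) : 0 <= a -> uexp (fun _ : Omega => a) <= a.
Proof.
move=> a0; rewrite /uexp (_ : \sum_w a = a * #|Omega|%:R); last by rewrite sumr_const mulr_natr.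
have [->|N0] := eqVneq (#|Omega|%:R : R) 0; first by rewrite mulr0 mul0r.
by rewrite mulfK.
Qed.

End uniform_lemmas.

Section smooth_convergence.
Context {R : realType}.
Variable Omega : nat -> finType.
Implicit Types W : forall n, Omega n -> R.

(** [heat tau (x - W n w)] is the distribution function at [x] of the value plus normal noise of
    variance [tau]: convergence in law after adding independent noise. *)
Definition smooth_cvg W (s2 : R) := forall tau x, 0 < tau ->
  (fun n => uexp (fun w => heat tau (x - W n w))) @ \oo --> heat (tau + s2) x.

Lemma Phi_tails (e : R) : 0 < e -> exists k, Phi (- k) <= e /\ 1 - Phi k <= e.
Proof.
move=> e0.
have hN : \forall x \near (-oo : set_system R), Phi x <= e.
  have /cvgr0Pnorm_le/(_ _ e0) := @ncdf_cvgNy R 1; apply: filterS => x.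
  by apply: le_trans; exact: ler_norm.
have hy : \forall x \near (+oo : set_system R), 1 - Phi x <= e.
  have /cvgrPdist_le/(_ _ e0) := @ncdf_cvgy R 1; apply: filterS => x.
  by apply: le_trans; exact: ler_norm.
have [M [_ hM]] := hy; have [N [_ hN']] := hN.
pose k := Num.max (M + 1) (1 - N).
exists k; split.
  by apply: hN'; rewrite ltrNl /k lt_max; apply/orP; right; lra.
by apply: hM; rewrite /k lt_max; apply/orP; left; lra.
Qed.

(** Noise of variance tau rarely exceeds k sqrt(tau), so the indicator of W <= c lies, up to e/3,
    between the smoothed ones at c - k sqrt(tau) and c + k sqrt(tau). The hypothesis keeps this
    shift inside [heat], in order to cover the degenerate case s2 = 0 as well. *)
Lemma smooth_cvg_uprob W s2 (c G : R) : smooth_cvg W s2 ->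
  (forall k, (fun m => heat (m.+1%:R^-1 + s2) (c + k * Num.sqrt m.+1%:R^-1)) @ \oo --> G) ->
  (fun n => uprob (fun w => W n w <= c)) @ \oo --> G.
Proof.
move=> sW hG; apply/cvgrPdist_le => e e0.
have e3 : 0 < e / 3 by rewrite divr_gt0.
have [k [kN ky]] := Phi_tails e3.
have [m [m1 m2]] : exists m,
    `|G - heat (m.+1%:R^-1 + s2) (c + k * Num.sqrt m.+1%:R^-1)| <= e / 3 /\
    `|G - heat (m.+1%:R^-1 + s2) (c + - k * Num.sqrt m.+1%:R^-1)| <= e / 3.
  near \oo => m; exists m; split; near: m.
    by have /cvgrPdist_le := hG k; apply.
  by have /cvgrPdist_le := hG (- k); apply.
set tau := m.+1%:R^-1 in m1 m2; have tau0 : 0 < tau by rewrite invr_gt0.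
have r0 : 0 < Num.sqrt tau by rewrite sqrtr_gt0.
have up (w : R) : (w <= c)%R%:R <= heat tau (c + k * Num.sqrt tau - w) + e / 3.
  case: (leP w c) => wc /=; last first.
    by rewrite addr_ge0 ?(ltW e3)//; exact: ncdf_ge0.
  apply: (@le_trans _ _ (Phi k + e / 3)); first by lra.
  rewrite lerD2r /heat; apply: ncdf_homo.
  by rewrite ler_pdivlMr//; lra.
have lo (w : R) : heat tau (c + - k * Num.sqrt tau - w) <= (w <= c)%R%:R + e / 3.
  case: (leP w c) => wc /=.
    by apply: le_trans (ncdf_le1 _ _) _; lra.
  rewrite add0r; apply: le_trans kN; rewrite /heat; apply: ncdf_homo.
  by rewrite ler_pdivrMr//; lra.
near=> n.
rewrite uprob_uexp.
have h1 : uexp (fun w => (W n w <= c)%R%:R) <=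
  uexp (fun w => heat tau (c + k * Num.sqrt tau - W n w)) + e / 3.
  apply: (@le_trans _ _ (uexp (fun w => heat tau (c + k * Num.sqrt tau - W n w) + e / 3))).
    exact: ler_uexp.
  by rewrite uexpD lerD2l uexp_cst_le// ltW.
have h2 : uexp (fun w => heat tau (c + - k * Num.sqrt tau - W n w)) <=
  uexp (fun w => (W n w <= c)%R%:R) + e / 3.
  apply: (@le_trans _ _ (uexp (fun w => (W n w <= c)%R%:R + e / 3))).
    exact: ler_uexp.
  by rewrite uexpD lerD2l uexp_cst_le// ltW.
have h3 : `|heat (tau + s2) (c + k * Num.sqrt tau) -
    uexp (fun w => heat tau (c + k * Num.sqrt tau - W n w))| <= e / 3.
  by near: n; have /cvgrPdist_le := sW tau (c + k * Num.sqrt tau) tau0; apply.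
have h4 : `|heat (tau + s2) (c + - k * Num.sqrt tau) -
    uexp (fun w => heat tau (c + - k * Num.sqrt tau - W n w))| <= e / 3.
  by near: n; have /cvgrPdist_le := sW tau (c + - k * Num.sqrt tau) tau0; apply.
move: m1 m2 h1 h2 h3 h4; rewrite !ler_norml.
move: (heat (tau + s2) _) (heat (tau + s2) _) (uexp _) (uexp _) (uexp _) => a b p q r.
move=> /andP[? ?] /andP[? ?] ? ? /andP[? ?] /andP[? ?].
by apply/andP; split; lra.
Unshelve. all: by end_near. Qed.

Lemma cvg_harmonic_sqrt (k : R) : (fun m => k * Num.sqrt m.+1%:R^-1) @ \oo --> (0 : R).
Proof.
rewrite -[0](mulr0 k); apply: cvgM; first exact: cvg_cst.
rewrite -[0](sqrtr0 R); apply: continuous_cvg; first exact: sqrt_continuous.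
exact: cvg_harmonic.
Qed.

Lemma smooth_cvg_distribution W s2 : 0 <= s2 -> smooth_cvg W s2 ->
  cvg_in_distribution W (centered_normal s2).
Proof.
move=> s20 sW c; rewrite /centered_normal; case: eqVneq => [s2E|s2N] cont.
  have dirac_cdf (y : R) : fine ((\d_(0 : measurableTypeR R) : probability (measurableTypeR R) R)
    `]-oo, y]) =
      (0 <= y)%R%:R.
    by rewrite /= indicE mem_setE in_itv.
  rewrite dirac_cdf.
  (* The point mass jumps at 0: along - 1/(m + 1) its distribution function is 0, whereas its value
     at 0 is 1. *)
  have c0 : c != 0.
    apply/eqP => cE; rewrite cE in cont.
    have ucvg : (fun m => - m.+1%:R^-1 : R) @ \oo --> (0 : R).
      by rewrite -[0]oppr0; apply: cvgN; exact: cvg_harmonic.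
    have := cvg_comp _ _ ucvg cont; rewrite dirac_cdf lexx/= => lim1.
    have : (fun m => (0 <= - m.+1%:R^-1 :> R)%R%:R : R) @ \oo --> (0 : R).
      rewrite (_ : (fun m => _) = cst 0); first exact: cvg_cst.
      by apply/funext => m; rewrite oppr_ge0 leNgt invr_gt0 ltr0n.
    move: lim1; rewrite (_ : _ \o _ = (fun m => (0 <= - m.+1%:R^-1 :> R)%R%:R : R)); last first.
      by apply/funext => m; exact: dirac_cdf.
    move=> l1 l0; have E : true%:R = 0 :> R by apply: cvg_unique l1 l0.
    by have := oner_neq0 R; rewrite -[1]/(true%:R) E eqxx.
  apply: smooth_cvg_uprob sW _ => k; rewrite s2E.
  have r0 m : 0 < Num.sqrt m.+1%:R^-1 :> R by rewrite sqrtr_gt0 invr_gt0.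
  have -> : (fun m => heat (m.+1%:R^-1 + 0) (c + k * Num.sqrt m.+1%:R^-1)) =
      (fun m => Phi (c / Num.sqrt m.+1%:R^-1 + k)).
    by apply/funext => m; rewrite /heat addr0 mulrDl mulfK ?lt0r_neq0.
  (* For s2 = 0 the argument of [Phi] is c/sqrt(tau) + k, which tends to plus or minus infinity
     according to the sign of [c]. *)
  have small A : (fun m => (A - k) * Num.sqrt m.+1%:R^-1) @ \oo --> (0 : R).
    exact: cvg_harmonic_sqrt.
  have [c_lt0|c_gt0|cE] := ltgtP c 0; last by rewrite cE eqxx in c0.
    apply: (cvg_comp _ Phi); last exact: ncdf_cvgNy.
    apply/cvgrNyPle => A; have : \forall m \near \oo, c < (A - k) * Num.sqrt m.+1%:R^-1.
      by apply: (cvgr_gt 0 (small A)).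
    apply: filterS => m hm.
    by rewrite -lerBrDr ler_pdivrMr// ltW.
  apply: (cvg_comp _ Phi); last exact: ncdf_cvgy.
  apply/cvgryPge => A; have : \forall m \near \oo, (A - k) * Num.sqrt m.+1%:R^-1 < c.
    by apply: (cvgr_lt 0 (small A)).
  apply: filterS => m hm.
  by rewrite -lerBlDr ler_pdivlMr// ltW.
have s2p : 0 < s2 by rewrite lt_neqAle eq_sym s2N.
have -> : fine (normal_prob 0 (Num.sqrt s2) `]-oo, c]) = heat s2 c.
  by rewrite -[LHS]/(ncdf (Num.sqrt s2) c) ncdf_scale// sqrtr_gt0.
apply: smooth_cvg_uprob sW _ => k; apply: heat_cvg => //.
  by rewrite -[X in _ --> X]add0r; apply: cvgD; [exact: cvg_harmonic|exact: cvg_cst].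
rewrite -[X in _ --> X]addr0; apply: cvgD; first exact: cvg_cst.
exact: cvg_harmonic_sqrt.
Qed.

End smooth_convergence.

(** * The variance constants *)

Section constants.
Context {R : realType}.
Implicit Types (k m n : nat).

(** At [(i + j).+1] this is the weight in sigma^2 of the product of the means at subtree sizes [i]
    and [j]. *)
Definition bst_kernel n : R := 4 / (n * n.+1 * n.+2)%:R.

Lemma bst_coef_kernel n : bst_coef n.+1 * (2 / n.+1%:R) = bst_kernel n.+1.
Proof.
rewrite /bst_coef /bst_kernel !natrM !natrD -![n.+3%:R]natr1 -![n.+2%:R]natr1 -![n.+1%:R]natr1.
by have := ler0n R n => ?; field; nonzero.
Qed.

Lemma sum_kernel k m :
  \sum_(i < m.+1) i.+1%:R * bst_kernel (k + i).+1 =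
  2 * m.+1%:R * m.+2%:R / (k.+1%:R * (k + m).+2%:R * (k + m).+3%:R).
Proof.
have nn n : n.+1%:R = n%:R + 1 :> R by rewrite natr1.
elim: m => [|m IH].
  rewrite big_ord1/= /bst_kernel !addn0 !natrM !nn.
  by move: (ler0n R k) => ?; field; nonzero.
rewrite big_ord_recr/= IH /bst_kernel !addnS !natrM !nn natrD.
by move: (ler0n R k) (ler0n R m) => ? ?; field; nonzero.
Qed.

Lemma sum_kernel2 k m :
  \sum_(i < k.+1) i.+1%:R * (\sum_(j < m.+1) j.+1%:R * bst_kernel (i + j).+1) =
  2 * k.+1%:R * m.+1%:R / (k + m).+3%:R.
Proof.
have nn n : n.+1%:R = n%:R + 1 :> R by rewrite natr1.
under eq_bigr do rewrite sum_kernel.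
elim: k => [|k IH].
  rewrite big_ord1/= !add0n !nn.
  by move: (ler0n R m) => ?; field; nonzero.
rewrite big_ord_recr/= IH !addSn !nn natrD.
by move: (ler0n R k) (ler0n R m) => ? ?; field; nonzero.
Qed.

Lemma sum_triangle (F : nat -> nat -> R) n :
  \sum_(l < n) \sum_(i < l.+1) F i (l - i)%N = \sum_(i < n) \sum_(j < n - i) F i j.
Proof.
elim: n => [|n IH]; first by rewrite !big_ord0.
rewrite big_ord_recr/= IH [RHS]big_ord_recr/= subSnn big_ord1.
rewrite [X in _ + X]big_ord_recr/= subnn addrA; congr (_ + _).
rewrite -big_split/=; apply: eq_bigr => i _.
by rewrite subSn 1?ltnW// big_ord_recr.
Qed.

Lemma sum_triangle_square (F : nat -> nat -> R) N n :
  (forall i j, (N <= i)%N -> F i j = 0) -> (forall i j, (N <= j)%N -> F i j = 0) ->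
  (N + N <= n)%N ->
  \sum_(l < n) \sum_(i < l.+1) F i (l - i)%N = \sum_(i < N) \sum_(j < N) F i j.
Proof.
move=> F1 F2 Nn; rewrite sum_triangle.
rewrite (@sum_ultimately_cst _ (fun i => \sum_(j < n - i) F i j) N); last 2 first.
- by move=> i Ni; rewrite big1// => j _; exact: F1.
- by apply: leq_trans Nn; exact: leq_addr.
apply: eq_bigr => i _; apply: sum_ultimately_cst => [j|]; first exact: F2.
by have := ltn_ord i; lia.
Qed.

(* For a toll [phi] supported on sizes below [N], [bexp i (csum phi (toll_mu phi))] is
   [\sum_(k < N) bexp k phi * mean_coef 1 1 k i]; the other values of [al] and [ga] serve the tolls
   [left_toll psi]. *)
Definition mean_coef (al ga : R) k i : R :=
  al * (i == k)%:R - ga * bst_coef k * (i.+1%:R * (i <= k)%N%:R).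

Lemma sum_mean_coef (al ga : R) k N (G : nat -> R) : (k < N)%N ->
  \sum_(i < N) mean_coef al ga k i * G i =
  al * G k - ga * bst_coef k * \sum_(i < k.+1) i.+1%:R * G i.
Proof.
move=> kN; rewrite /mean_coef; move: (bst_coef k) => b.
under eq_bigr do rewrite mulrBl -!mulrA.
rewrite sumrB; congr (_ - _).
  rewrite (bigD1 (Ordinal kN))//= eqxx mul1r big1 ?addr0// => i ik.
  have -> : (i == k :> nat) = false by apply: contraNF ik => /eqP ik; apply/eqP/val_inj.
  by rewrite mul0r mulr0.
rewrite (eq_bigr (fun i : 'I_N => ga * (b * (i.+1%:R * ((i <= k)%N%:R * G i)))))//.
rewrite -!mulr_sumr mulrA; congr (_ * _).
rewrite (@sum_ultimately_cst _ (fun i => i.+1%:R * ((i <= k)%N%:R * G i)) k.+1)//; last first.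
  by move=> j kj; rewrite leqNgt kj mul0r mulr0.
by apply: eq_bigr => i _; rewrite -ltnS ltn_ord mul1r.
Qed.

Lemma kernel_form (al ga al' ga' : R) k m N : (k < N)%N -> (m < N)%N ->
  \sum_(i < N) \sum_(j < N)
    bst_kernel (i + j).+1 * mean_coef al ga k i * mean_coef al' ga' m j =
  al * al' * bst_kernel (k + m).+1
  - al * ga' * bst_coef m * (2 * m.+1%:R * m.+2%:R / (k.+1%:R * (k + m).+2%:R * (k + m).+3%:R))
  - al' * ga * bst_coef k * (2 * k.+1%:R * k.+2%:R / (m.+1%:R * (k + m).+2%:R * (k + m).+3%:R))
  + ga * ga' * bst_coef k * bst_coef m * (2 * k.+1%:R * m.+1%:R / (k + m).+3%:R).
Proof.
move=> kN mN.
under eq_bigr => i _.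
  under eq_bigr do rewrite [_ * mean_coef al ga k i]mulrC -mulrA [bst_kernel _ * _]mulrC.
  rewrite -mulr_sumr (sum_mean_coef _ _ (fun j => bst_kernel (i + j).+1) mN) sum_kernel.
  over.
rewrite (sum_mean_coef _ _ (fun i => al' * bst_kernel (i + m).+1 - ga' * bst_coef m *
  (2 * m.+1%:R * m.+2%:R / (i.+1%:R * (i + m).+2%:R * (i + m).+3%:R))) kN).
under eq_bigr do rewrite mulrBr mulrCA [X in _ - X]mulrCA -sum_kernel.
rewrite sumrB -!mulr_sumr sum_kernel2.
have -> : \sum_(i < k.+1) i.+1%:R * bst_kernel (i + m).+1 =
    2 * k.+1%:R * k.+2%:R / (m.+1%:R * (k + m).+2%:R * (k + m).+3%:R).
  by under eq_bigr do rewrite addnC; rewrite sum_kernel [(m + k)%N]addnC.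
by ring.
Qed.

(** The three terms are what a pair of sizes contributes to mu^2, to the centring inside phi (2 Y -
    phi), and to the products of subtree means. *)
Lemma bst_beta_form k m N : (k < N)%N -> (m < N)%N ->
  bst_coef k * bst_coef m - (k.+1%:R + m.+1%:R) * bst_coef k * bst_coef m +
  \sum_(i < N) \sum_(j < N) bst_kernel (i + j).+1 * mean_coef 1 1 k i * mean_coef 1 1 m j =
  - bst_beta k m :> R.
Proof.
move=> kN mN; rewrite kernel_form// /bst_kernel /bst_coef /bst_beta.
have nn n : n.+1%:R = n%:R + 1 :> R by rewrite natr1.
rewrite !(natrM, natrD, natrX, nn).
by move: (ler0n R k) (ler0n R m) => ? ?; field; nonzero.
Qed.

Lemma rrt_beta_form k m N : (k < N)%N -> (m < N)%N ->
  bst_coef k * bst_coef m / 4 - (k.+1%:R + m.+1%:R) * bst_coef k * bst_coef m / 4 +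
  (\sum_(i < N) \sum_(j < N) bst_kernel (i + j).+1 * mean_coef 1 (1 / 2) k i * mean_coef 0 (1 / 2)
    m j +
   \sum_(i < N) \sum_(j < N) bst_kernel (i + j).+1 * mean_coef 1 (1 / 2) m i * mean_coef 0 (1 / 2)
     k j) / 2 =
  - rrt_beta k.+1 m.+1 :> R.
Proof.
move=> kN mN; rewrite !kernel_form// [(m + k)%N]addnC /bst_kernel /bst_coef /rrt_beta.
have nn n : n.+1%:R = n%:R + 1 :> R by rewrite natr1.
rewrite !(natrM, natrD, natrX, nn).
by move: (ler0n R k) (ler0n R m) => ? ?; field; nonzero.
Qed.

End constants.

Section bilinear.
Context {R : realType}.

Lemma bilinear_exchange (n : nat) (a b : nat -> R) (K u v : nat -> nat -> R) :
  \sum_(i < n) \sum_(j < n)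
    K i j * (\sum_(k < n) a k * u k i) * (\sum_(m < n) b m * v m j) =
  \sum_(k < n) \sum_(m < n) a k * b m * \sum_(i < n) \sum_(j < n) K i j * u k i * v m j.
Proof.
transitivity (\sum_(i < n) \sum_(j < n) \sum_(k < n) \sum_(m < n)
    a k * b m * (K i j * u k i * v m j)).
  apply: eq_bigr => i _; apply: eq_bigr => j _.
  rewrite -mulrA big_distrlr/= mulr_sumr; apply: eq_bigr => k _.
  by rewrite mulr_sumr; apply: eq_bigr => m _; ring.
transitivity (\sum_(k < n) \sum_(m < n) \sum_(i < n) \sum_(j < n)
    a k * b m * (K i j * u k i * v m j)).
  rewrite [RHS]exchange_big/=; under [RHS]eq_bigr do rewrite exchange_big/=.
  rewrite [RHS]exchange_big/=; apply: eq_bigr => i _.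
  under [RHS]eq_bigr do rewrite exchange_big/=.
  rewrite [RHS]exchange_big/=; apply: eq_bigr => j _.
  by rewrite exchange_big.
apply: eq_bigr => k _; apply: eq_bigr => m _; rewrite mulr_sumr.
by apply: eq_bigr => i _; rewrite mulr_sumr.
Qed.

Lemma mean_coef_sum (al ga : R) n i (a : nat -> R) : (i < n)%N ->
  \sum_(k < n) a k * mean_coef al ga k i =
  al * a i - ga * i.+1%:R * (\sum_(k < n) bst_coef k * a k - \sum_(k < i) bst_coef k * a k).
Proof.
move=> inn.
have -> : \sum_(k < n) bst_coef k * a k - \sum_(k < i) bst_coef k * a k =
    \sum_(k < n) (i <= k)%N%:R * (bst_coef k * a k).
  rewrite (@big_ord_widen _ _ _ i n (fun k => bst_coef k * a k)) 1?ltnW//.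
  rewrite [X in _ - X]big_mkcond/= -sumrB; apply: eq_bigr => k _.
  by case: (leqP i k) => _; rewrite ?subrr ?mul0r ?subr0 ?mul1r.
rewrite /mean_coef; under eq_bigr do rewrite mulrBr.
rewrite sumrB mulr_sumr; congr (_ - _); last by apply: eq_bigr => k _; ring.
rewrite (bigD1 (Ordinal inn))//= eqxx mulr1 mulrC big1 ?addr0// => k ik.
have -> : (i == k) = false by apply: contraNF ik => /eqP ik; apply/eqP/val_inj.
by rewrite !mulr0.
Qed.

End bilinear.

(** * The variance constant of the search tree *)

Section bst_variance.
Context {R : realType}.
Variables (phi : bintree -> R) (N : nat).
Hypotheses (phi0 : phi BEmpty = 0) (phiN : forall t, (N < bsize t)%N -> phi t = 0).

(** Replacing Y by [tsum phi t - mu * (bsize t).+1%:R] isolates the first sum; all the rest is a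
    quadratic form in the means [bexp k phi], with coefficients given by [bst_beta_form]. *)
Lemma bst_sigma2_formula :
  toll_sigma2 phi =
  \sum_(k < N.+1) bst_coef k * bexp k (fun t => phi t * (2 * tsum phi t - phi t)) -
  \sum_(k < N.+1) \sum_(m < N.+1) bst_beta k m * bexp k phi * bexp m phi.
Proof.
pose a k := bexp k phi; pose mu := toll_mu phi; pose e i := bexp i (csum phi mu).
have muE : mu = \sum_(k < N.+1) bst_coef k * a k by exact: (toll_mu_sum phiN (ltnSn N)).
have e_big i : (N < i)%N -> e i = 0 by exact: (bexp_csum_big phi0 phiN).
have eE i : (i < N.+1)%N -> e i = \sum_(k < N.+1) a k * mean_coef 1 1 k i.
  by move=> iN; rewrite mean_coef_sum// /e bexp_csum// -muE !mul1r.
have -> : toll_sigma2 phi = \sum_(j < (N.+1 + N.+1).+1) bst_coef j * toll2 phi mu j.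
  apply: (@lim_ultimately_cst _ _ (N.+1 + N.+1).+1) => m Nm.
  apply: (@sum_ultimately_cst _ (fun j => bst_coef j * toll2 phi mu j) _ _ _ Nm) => j Nj.
  by rewrite (toll2_big phi0 phiN) ?mulr0//; lia.
rewrite big_ord_recl /= {1}/bst_coef !add0n mul1n divff// mul1r.
under eq_bigr do rewrite /bump/= add1n mulrDr [bst_coef _ * (_ * _)]mulrA bst_coef_kernel.
rewrite big_split/=.
have -> : \sum_(i < N.+1 + N.+1) bst_coef i.+1 *
      bexp i.+1 (fun t => phi t * (2 * csum phi mu t - phi t)) =
    \sum_(k < N.+1) bst_coef k * bexp k (fun t => phi t * (2 * tsum phi t - phi t)) -
    2 * mu * \sum_(k < N.+1) bst_coef k * (k.+1%:R * a k).
  pose G k := bst_coef k * bexp k (fun t => phi t * (2 * csum phi mu t - phi t)).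
  transitivity (\sum_(k < (N.+1 + N.+1).+1) G k).
    by rewrite [RHS]big_ord_recl/= /G bexp0 phi0 mul0r mulr0 add0r.
  rewrite (@sum_ultimately_cst _ G N.+1); last 2 first.
  - by move=> j Nj; rewrite /G (bexp_phi_big phiN) ?mulr0.
  - by lia.
  rewrite mulr_sumr -sumrB; apply: eq_bigr => k _; rewrite /G mulrCA -mulrBr; congr (_ * _).
  rewrite mulrA /a -bexpZ -bexpB; apply: eq_bexp => t tk.
  by rewrite /csum tk; ring.
have -> : \sum_(l < N.+1 + N.+1) bst_kernel l.+1 * \sum_(i < l.+1)
      bexp i (csum phi mu) * bexp (l - i) (csum phi mu) =
    \sum_(k < N.+1) \sum_(m < N.+1) a k * a m * \sum_(i < N.+1) \sum_(j < N.+1)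
      bst_kernel (i + j).+1 * mean_coef 1 1 k i * mean_coef 1 1 m j.
  rewrite -(@bilinear_exchange R N.+1 a a (fun i j => bst_kernel (i + j).+1) (mean_coef 1 1)
    (mean_coef 1 1)).
  pose F i j := bst_kernel (i + j).+1 * e i * e j.
  transitivity (\sum_(l < N.+1 + N.+1) \sum_(i < l.+1) F i (l - i)%N).
    apply: eq_bigr => l _; rewrite mulr_sumr; apply: eq_bigr => i _.
    by rewrite /F subnKC ?mulrA// -ltnS.
  rewrite (@sum_triangle_square _ F N.+1)//.
  - by apply: eq_bigr => i _; apply: eq_bigr => j _; rewrite /F !eE.
  - by move=> i j Ni; rewrite /F e_big// mulr0 mul0r.
  - by move=> i j Nj; rewrite /F (e_big j)// mulr0.
set A := \sum_(k < N.+1) bst_coef k * bexp k _; set B := 2 * mu * _; set Q := \sum_(k < N.+1) _.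
rewrite (_ : mu ^+ 2 + (A - B + Q) = A + (mu ^+ 2 - B + Q)); last by ring.
congr (_ + _); rewrite /B /Q.
have -> : mu ^+ 2 = \sum_(k < N.+1) \sum_(m < N.+1) a k * a m * (bst_coef k * bst_coef m).
  rewrite expr2 muE big_distrlr/=; apply: eq_bigr => k _; apply: eq_bigr => m _; ring.
have -> : 2 * mu * \sum_(k < N.+1) bst_coef k * (k.+1%:R * a k) =
    \sum_(k < N.+1) \sum_(m < N.+1) a k * a m * ((k.+1%:R + m.+1%:R) * bst_coef k * bst_coef m).
  pose S := \sum_(k < N.+1) bst_coef k * (k.+1%:R * a k);
    rewrite -/S (_ : 2 * mu * S = S * mu + mu * S); last by ring.
  rewrite muE /S big_distrlr/=.
  rewrite big_distrlr/=.
  rewrite -big_split/=.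
  apply: eq_bigr => k _; rewrite -big_split/=; apply: eq_bigr => m _; ring.
rewrite -sumrB -big_split/= -sumrN; apply: eq_bigr => k _.
rewrite -sumrB -big_split/= -sumrN; apply: eq_bigr => m _.
rewrite -mulrBr -mulrDr bst_beta_form//.
by rewrite /a; ring.
Qed.

End bst_variance.

(** * The variance constant of the recursive tree *)

Section rrt_variance.
Context {R : realType}.

(* [rotation] maps the internal nodes of [t] to the non-root nodes of [rotation t], and the fringe
   subtree at such a node is the image of the left subtree in [t]. *)
Definition left_toll (psi : bintree -> R) t : R := if t is BNode l r then psi l else 0.

Definition average (b : nat -> R) j : R := (\sum_(i < j) b i) / j%:R.

Lemma bexp_left_toll psi n : bexp n (left_toll psi) = average (fun i => bexp i psi) n.
Proof.
case: n => [|n]; first by rewrite bexp0 /average big_ord0 mul0r.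
rewrite bexp_split; congr (_ / _); apply: eq_bigr => i _.
by apply: eq_bexp => l _; rewrite -[RHS](bexp_cst (n - i)).
Qed.

(** The sum of 2/(j (j + 1)(j + 2)) over j > i is 1/((i + 1)(i + 2)), half of [bst_coef i] and also
    [rrt_coef i.+1]; stopping at [n] leaves the boundary term. *)
Lemma sum_coef_average (b : nat -> R) n :
  \sum_(j < n) bst_coef j * average b j =
  \sum_(i < n) b i * (bst_coef i / 2) - (\sum_(i < n) b i) / (n%:R * n.+1%:R).
Proof.
have nn k : k.+1%:R = k%:R + 1 :> R by rewrite natr1.
elim: n => [|n IH]; first by rewrite !big_ord0 mul0r subr0.
rewrite !big_ord_recr/= IH /average.
case: n IH => [|n] _.
  by rewrite !big_ord0 /bst_coef !add0n mul1n !mul0r mulr0; field.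
move: (\sum_(i < n.+1) b i) (\sum_(i < n.+1) _) => s s'.
rewrite /bst_coef natrM !natrD !nn.
by have := ler0n R n => ?; field; nonzero.
Qed.

(** A left toll has unbounded support, so its partial sums do not become constant; they miss the
    limit by the boundary term of [sum_coef_average]. *)
Lemma lim_inverse_square (u : nat -> R) (x y : R) M :
  (forall n, (M <= n)%N -> u n = x - y / (n%:R * n.+1%:R)) -> limn u = x.
Proof.
move=> uE; apply: cvg_lim => //.
have hx : (fun n => x - y * (n.+1%:R^-1 * n.+2%:R^-1)) @ \oo --> x.
  rewrite -[X in _ --> X]subr0; apply: cvgB; first exact: cvg_cst.
  rewrite -[X in _ --> X](_ : y * (0 * 0) = 0); last by rewrite !mulr0.
  apply: cvgM; first exact: cvg_cst.
  apply: cvgM; first exact: cvg_harmonic.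
  by have := @cvg_harmonic R; rewrite -(cvg_shiftS (@harmonic R)).
rewrite -(cvg_shiftS u); apply: cvg_trans hx; apply: near_eq_cvg.
exists M => // n /= Mn; rewrite uE; last exact: leqW.
by rewrite invfM.
Qed.

Variables (psi : bintree -> R) (N : nat).
Hypothesis psiN : forall t, (N <= bsize t)%N -> psi t = 0.

Let phi := left_toll psi.
Let mu := toll_mu phi.
Let a k := bexp k psi.
Let e i := bexp i (csum phi mu).

Let bexp_psi_big n (g : bintree -> R) : (N <= n)%N -> bexp n (fun t => psi t * g t) = 0.
Proof.
by move=> Nn; rewrite -(bexp_cst (R := R) n 0); apply: eq_bexp => t tn; rewrite psiN ?tn// mul0r.
Qed.

Let a_big n : (N <= n)%N -> a n = 0.
Proof.
by move=> Nn; rewrite /a -(bexp_cst (R := R) n 0); apply: eq_bexp => t tn; rewrite psiN ?tn.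
Qed.

Lemma left_toll_mu : mu = \sum_(k < N) bst_coef k * a k / 2.
Proof.
apply: (@lim_inverse_square _ _ (\sum_(i < N) a i) N) => n Nn.
under eq_bigr do rewrite bexp_left_toll.
rewrite sum_coef_average; congr (_ - _ / _); last exact: sum_ultimately_cst.
rewrite (@sum_ultimately_cst _ (fun i => a i * (bst_coef i / 2)) N)//.
  by apply: eq_bigr => i _; ring.
by move=> j Nj; rewrite a_big// mul0r.
Qed.

(** The mean toll, an average, cancels against n + 1 times that boundary term. Hence the mean
    vanishes for [N <= n], as for a toll of bounded support. *)
Lemma left_toll_mean n : e n = - (n.+1%:R * (mu - \sum_(k < n) bst_coef k * a k / 2)).
Proof.
rewrite /e bexp_csum// bexp_left_toll.
under eq_bigr do rewrite bexp_left_toll.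
rewrite sum_coef_average.
rewrite (eq_bigr (fun k : 'I_n => bst_coef k * a k / 2)); last by move=> k _; rewrite /a; ring.
rewrite /average.
case: n => [|n]; first by rewrite !big_ord0; ring.
move: (\sum_(i < n.+1) bexp i psi) (\sum_(i < n.+1) _) => s s'.
have nn k : k.+1%:R = k%:R + 1 :> R by rewrite natr1.
by rewrite !nn; have := ler0n R n => ?; field; nonzero.
Qed.

Let e_big i : (N <= i)%N -> e i = 0.
Proof.
move=> Ni; rewrite left_toll_mean left_toll_mu.
rewrite (@sum_ultimately_cst _ (fun k => bst_coef k * a k / 2) N i)// ?subrr ?mulr0 ?oppr0//.
by move=> j Nj; rewrite a_big// mulr0 mul0r.
Qed.

Let eE i : (i < N)%N -> e i = \sum_(k < N) a k * mean_coef 0 (1 / 2) k i.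
Proof.
move=> iN; rewrite mean_coef_sum// left_toll_mean left_toll_mu -!mulr_suml.
by rewrite mul0r; field.
Qed.

Let fE i : (i < N)%N -> a i + e i = \sum_(k < N) a k * mean_coef 1 (1 / 2) k i.
Proof.
move=> iN; rewrite mean_coef_sum// left_toll_mean left_toll_mu -!mulr_suml.
by rewrite mul1r; field.
Qed.

Let B i := bexp i (fun t => psi t * (psi t + 2 * csum phi mu t)).

(** The toll depends on the left subtree alone, so the square expands as psi (psi + 2 Y_l) + 2 (psi
    + Y_l) Y_r plus the two squares, and the factors of the middle product are independent. *)
Lemma left_toll2 l : toll2 phi mu l.+1 =
  average B l.+1 + 2 / l.+1%:R * \sum_(i < l.+1) (a i + e i) * e (l - i)%N.
Proof.
rewrite /toll2 bexp_split /average -[2 / _ * _]mulrAC -[X in _ = _ + X]mulrAC -!mulrDl.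
congr (_ / _); rewrite !mulr_sumr -!big_split/=; apply: eq_bigr => i _.
rewrite (_ : bexp i _ = B i + 2 * (a i * e (l - i)%N)); first by rewrite /e; ring.
transitivity (bexp i (fun l' => psi l' * (psi l' + 2 * csum phi mu l') + 2 * e (l - i)%N * psi l')).
  apply: eq_bexp => l' _; rewrite -[X in X + _](bexp_cst (l - i)) mulrAC /e -bexpZ -bexpD.
  by apply: eq_bexp => r _; rewrite csum_node /=; ring.
by rewrite bexpD bexpZ /a /B; ring.
Qed.

Lemma left_sigma2_formula :
  toll_sigma2 phi =
  \sum_(k < N) bst_coef k / 2 * bexp k (fun t => psi t * (psi t + 2 * tsum phi t)) -
  \sum_(k < N) \sum_(m < N) rrt_beta k.+1 m.+1 * bexp k psi * bexp m psi.
Proof.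
pose V k m : R := \sum_(i < N) \sum_(j < N)
  bst_kernel (i + j).+1 * mean_coef 1 (1 / 2) k i * mean_coef 0 (1 / 2) m j.
have B_big n : (N <= n)%N -> B n = 0 by exact: bexp_psi_big.
have lim : toll_sigma2 phi = mu ^+ 2 + \sum_(k < N) B k * (bst_coef k / 2) +
    \sum_(k < N) \sum_(m < N) a k * a m * V k m.
  apply: (@lim_inverse_square _ _ (\sum_(i < N) B i) (N + N).+1) => -[//|n] Nn.
  rewrite big_ord_recl.
  under eq_bigr do rewrite lift0 -/mu left_toll2 mulrDr [bst_coef _ * (2 / _ * _)]mulrA
    bst_coef_kernel.
  rewrite big_split/= {1}/bst_coef !add0n mul1n divff// mul1r.
  have -> : \sum_(i < n) bst_coef i.+1 * average B i.+1 =
      \sum_(k < N) B k * (bst_coef k / 2) - (\sum_(i < N) B i) / (n.+1%:R * n.+2%:R).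
    have := sum_coef_average B n.+1.
    rewrite big_ord_recl /= {1 2}/average big_ord0 mul0r mulr0 add0r => ->.
    congr (_ - _ / _); last by apply: sum_ultimately_cst => //; lia.
    apply: (@sum_ultimately_cst _ (fun i => B i * (bst_coef i / 2))); last by lia.
    by move=> j Nj; rewrite B_big// mul0r.
  have -> : \sum_(l < n) bst_kernel l.+1 * \sum_(i < l.+1) (a i + e i) * e (l - i)%N =
      \sum_(k < N) \sum_(m < N) a k * a m * V k m.
    rewrite -(@bilinear_exchange R N a a (fun i j => bst_kernel (i + j).+1) (mean_coef 1 (1 / 2))
      (mean_coef 0 (1 / 2))).
    pose F i j := bst_kernel (i + j).+1 * (a i + e i) * e j.
    transitivity (\sum_(l < n) \sum_(i < l.+1) F i (l - i)%N).
      apply: eq_bigr => l _; rewrite mulr_sumr; apply: eq_bigr => i _.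
      by rewrite /F subnKC ?mulrA// -ltnS.
    rewrite (@sum_triangle_square _ F N)//.
    - by apply: eq_bigr => i _; apply: eq_bigr => j _; rewrite /F fE// eE.
    - by move=> i j Ni; rewrite /F e_big// a_big// addr0 mulr0 mul0r.
    - by move=> i j Nj; rewrite /F (e_big Nj) mulr0.
  by rewrite -/mu; ring.
rewrite lim.
have -> : \sum_(k < N) B k * (bst_coef k / 2) =
    \sum_(k < N) bst_coef k / 2 * bexp k (fun t => psi t * (psi t + 2 * tsum phi t)) -
    2 * mu * \sum_(k < N) bst_coef k / 2 * (k.+1%:R * a k).
  rewrite mulr_sumr -sumrB; apply: eq_bigr => k _; rewrite mulrC [2 * mu * _]mulrCA -mulrBr;
    congr (_ * _).
  rewrite mulrA /a -bexpZ -bexpB; apply: eq_bexp => t tk.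
  by rewrite /csum tk; ring.
have -> : mu ^+ 2 = \sum_(k < N) \sum_(m < N) a k * a m * (bst_coef k * bst_coef m / 4).
  rewrite expr2 left_toll_mu.
  rewrite big_distrlr/=.
  by apply: eq_bigr => k _; apply: eq_bigr => m _; field.
pose S := \sum_(k < N) bst_coef k / 2 * (k.+1%:R * a k).
have -> : 2 * mu * S =
    \sum_(k < N) \sum_(m < N) a k * a m * ((k.+1%:R + m.+1%:R) * bst_coef k * bst_coef m / 4).
  rewrite (_ : 2 * mu * S = S * mu + mu * S); last by ring.
  rewrite left_toll_mu /S.
  rewrite big_distrlr/=.
  rewrite big_distrlr/=.
  rewrite -big_split/=.
  by apply: eq_bigr => k _; rewrite -big_split/=; apply: eq_bigr => m _; field.
(* The left and right subtrees play different roles in [V], whereas [rrt_beta] is symmetric; only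
   the symmetric part of [V] matters to the quadratic form. *)
have -> : \sum_(k < N) \sum_(m < N) a k * a m * V k m =
    \sum_(k < N) \sum_(m < N) a k * a m * ((V k m + V m k) / 2).
  have E : \sum_(k < N) \sum_(m < N) a k * a m * V m k =
    \sum_(k < N) \sum_(m < N) a k * a m * V k m.
    by rewrite exchange_big/=; apply: eq_bigr => k _; apply: eq_bigr => m _; rewrite [a m * _]mulrC.
  set X := LHS; rewrite [X](_ : _ = (X + X) / 2); last by field.
  rewrite {2}/X -E -big_split/= mulr_suml; apply: eq_bigr => k _.
  by rewrite -big_split/= mulr_suml; apply: eq_bigr => m _; ring.
set A := \sum_(k < N) bst_coef k / 2 * bexp k _; set P := \sum_(k < N) _; set Q := \sum_(k < N) _;
  set W := \sum_(k < N) _.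
rewrite (_ : P + (A - Q) + W = A + (P - Q + W)); last by ring.
congr (_ + _); rewrite /P /Q /W.
rewrite -sumrB -big_split/= -sumrN; apply: eq_bigr => k _.
rewrite -sumrB -big_split/= -sumrN; apply: eq_bigr => m _.
rewrite -mulrBr -mulrDr rrt_beta_form//.
by rewrite /a; ring.
Qed.

End rrt_variance.

(** * The covariance sum over trees as a sum over sizes *)

Section quadratic.
Context {R : realType}.
Variable M : random_trees.

Hypothesis tsize_rtree : forall n (w : rspace M n), (0 < n)%N -> Defs.tsize (rtree w) = n.
Hypothesis fringe_cons : forall T : M, (0 < Defs.tsize T)%N ->
  exists2 r, fringe T = T :: r & {in r, forall S, (0 < Defs.tsize S < Defs.tsize T)%N}.
Hypothesis finite_trees : forall N, finite_set [set T : M | (0 < Defs.tsize T <= N)%N].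

Let trees N : seq M := finmap.enum_fset (fset_set [set T : M | (0 < Defs.tsize T <= N)%N]).

Let trees_uniq N : uniq (trees N).
Proof. exact: finmap.fset_uniq. Qed.

Let mem_trees N T : (T \in trees N) = (0 < Defs.tsize T <= N)%N.
Proof. by rewrite in_fset_set// mem_setE. Qed.

Let sum_pred1 (s : seq M) (U : M) (g : M -> R) : uniq s -> U \in s ->
  \sum_(T <- s) (T == U)%:R * g T = g U.
Proof.
move=> us Us; rewrite (bigD1_seq U)//= eqxx mul1r big1 ?addr0// => T /negbTE ->.
by rewrite mul0r.
Qed.

Lemma sum_tprob N (g : M -> R) :
  \sum_(T <- trees N) g T * tprob T = \sum_(1 <= k < N.+1) uexp (at_random g k).
Proof.
have E k : (0 < k <= N)%N -> uexp (at_random g k) =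
    \sum_(T <- trees N) g T * uprob (fun w : rspace M k => rtree w == T).
  move=> /andP[k0 kN]; under [RHS]eq_bigr do rewrite uprob_uexp -uexpZ.
  rewrite /uexp -mulr_suml exchange_big/=; congr (_ / _); apply: eq_bigr => w _.
  rewrite /at_random -[LHS](@sum_pred1 (trees N))//; last by rewrite mem_trees tsize_rtree ?k0.
  by apply: eq_bigr => T _; rewrite mulrC eq_sym.
rewrite [RHS](eq_big_nat _ _ (F2 := fun k =>
    \sum_(T <- trees N) g T * uprob (fun w : rspace M k => rtree w == T))); last first.
  by move=> k /andP[k1 kN]; apply: E; rewrite k1.
rewrite exchange_big/=; apply: eq_big_seq => T; rewrite mem_trees => /andP[T0 TN].
rewrite -mulr_sumr; congr (_ * _).
rewrite (bigD1_seq (Defs.tsize T)) ?iota_uniq//=; last by rewrite mem_index_iota T0 ltnS.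
rewrite big1_seq ?addr0// => k /andP[kT]; rewrite mem_index_iota => /andP[k0 _].
rewrite /uprob (_ : #|_| = 0%N) ?mul0r//; apply: eq_card0 => w; rewrite !inE.
by apply: contraNF kT => /eqP <-; rewrite tsize_rtree.
Qed.

(** [q T T'] vanishes unless [T'] is a fringe subtree of [T], so the distinction by size in
    [tcov_of] amounts to adding both orders and removing the diagonal once. Summing f(T') times the
    number of its copies in [T] gives the additive functional of [T], since every fringe subtree is
    within the size bound. *)
Lemma quadratic_sumE (c : nat -> R) (b : nat -> nat -> R) (f : M -> R) N :
  (forall k m, b k m = b m k) ->
  quadratic_sum (tcov_of c b) f N =
  \sum_(1 <= k < N.+1) c k * uexp
    (at_random (fun T => f T * (2 * additive_functional f T - f T)) k) -
  \sum_(1 <= k < N.+1) \sum_(1 <= m < N.+1) b k m * uexp (at_random f k) * uexp (at_random f m).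
Proof.
move=> bsym.
have fsE (h : M -> R) : \sum_(T \in [set T : M | (0 < Defs.tsize T <= N)%N]) h T =
  \sum_(T <- trees N) h T.
  by rewrite fsbig_finite.
rewrite /quadratic_sum fsE; under eq_bigr do rewrite fsE.
pose q (T T' : M) : R := c (Defs.tsize T) * (count_mem T' (fringe T))%:R * tprob T.
have q0 (T T' : M) : (0 < Defs.tsize T)%N -> T != T' -> (Defs.tsize T <= Defs.tsize T')%N ->
  q T T' = 0.
  move=> T0 TT' TleT'; rewrite /q; have [r -> rT] := fringe_cons T0.
  rewrite (_ : count_mem _ _ = 0%N) ?mulr0 ?mul0r//; apply/count_memPn.
  rewrite inE negb_or eq_sym TT'/=; apply/negP => /rT /andP[_].
  by rewrite ltnNge TleT'.
have q1 (T : M) : (0 < Defs.tsize T)%N -> q T T = c (Defs.tsize T) * tprob T.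
  move=> T0; rewrite /q; have [r -> rT] := fringe_cons T0; rewrite /= eqxx.
  rewrite (_ : count_mem _ _ = 0%N) ?mulr1//; apply/count_memPn/negP => /rT /andP[_].
  by rewrite ltnn.
have covE (T T' : M) : T \in trees N -> T' \in trees N -> tcov_of c b T T' =
    q T T' + q T' T - (T' == T)%:R * q T T - b (Defs.tsize T) (Defs.tsize T') * tprob T * tprob T'.
  rewrite !mem_trees => /andP[T0 _] /andP[T'0 _]; rewrite /tcov_of -/(q T T') -/(q T' T).
  have [->|TT'] := eqVneq T' T; first by rewrite leqnn mul1r addrK.
  rewrite mul0r subr0; case: leqP => h; first by rewrite (q0 T' T)// addr0.
  have -> : q T T' = 0 by apply: q0 => //; [rewrite eq_sym|exact: ltnW].
  by rewrite bsym; ring.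
transitivity (\sum_(T <- trees N)
  (2 * f T * \sum_(T' <- trees N) f T' * q T T' - f T * f T * q T T) -
    \sum_(T <- trees N) \sum_(T' <- trees N) f T * f T' *
      (b (Defs.tsize T) (Defs.tsize T') * tprob T * tprob T')).
  transitivity (\sum_(T <- trees N) \sum_(T' <- trees N)
    (f T * f T' * q T T' + f T' * f T * q T' T -
      (T' == T)%:R * (f T * f T' * q T T) -
        f T * f T' * (b (Defs.tsize T) (Defs.tsize T') * tprob T * tprob T'))).
    apply: eq_big_seq => T Tin; apply: eq_big_seq => T' T'in; rewrite covE//; ring.
  under eq_bigr do rewrite !sumrB big_split/=.
  rewrite !sumrB big_split/=; congr (_ - _).
  have X2 : \sum_(T <- trees N) \sum_(T' <- trees N) f T' * f T * q T' T =
    \sum_(T <- trees N) \sum_(T' <- trees N) f T * f T' * q T T' by rewrite exchange_big.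
  rewrite X2; set P := \sum_(T <- trees N) _; rewrite (_ : P + P = 2 * P); last by ring.
  rewrite /P mulr_sumr; congr (_ - _).
    by apply: eq_bigr => T _; rewrite -mulrA; congr (_ * _); rewrite mulr_sumr;
      apply: eq_bigr => T' _; rewrite mulrA.
  by apply: eq_big_seq => T Tin; rewrite (sum_pred1 (fun T' => f T * f T' * q T T)).
congr (_ - _).
  transitivity (\sum_(T <- trees N)
    (c (Defs.tsize T) * (f T * (2 * additive_functional f T - f T))) * tprob T).
    apply: eq_big_seq => T; rewrite mem_trees => /andP[T0 TN]; rewrite q1//.
    have -> : \sum_(T' <- trees N) f T' * q T T' =
      c (Defs.tsize T) * tprob T * additive_functional f T.
      rewrite /additive_functional.
      have sub S : S \in fringe T -> S \in trees N.
        have [r -> rT] := fringe_cons T0; rewrite inE mem_trees => /orP[/eqP->|/rT /andP[-> ST]].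
          by rewrite T0.
        by rewrite (leq_trans (ltnW ST)).
      have cnt : \sum_(T' <- trees N) f T' * (count_mem T' (fringe T))%:R =
        \sum_(S <- fringe T) f S.
        transitivity (\sum_(S <- fringe T) \sum_(T' <- trees N) (T' == S)%:R * f T').
          rewrite exchange_big/=; apply: eq_bigr => T' _.
          rewrite -sum1_count natr_sum big_mkcond/= mulr_sumr; apply: eq_bigr => S _.
          by rewrite eq_sym mulrC; case: (T' == S).
        by apply: eq_big_seq => S ST; rewrite sum_pred1// sub.
      by rewrite -cnt mulr_sumr; apply: eq_bigr => T' _; rewrite /q; ring.
    by ring.
  rewrite sum_tprob; apply: eq_big_nat => k /andP[k0 _].
  rewrite -uexpZ /uexp; congr (_ / _); apply: eq_bigr => w _.
  by rewrite /at_random tsize_rtree.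
transitivity (\sum_(T <- trees N)
  (f T * \sum_(1 <= m < N.+1) b (Defs.tsize T) m * uexp (at_random f m)) * tprob T).
  apply: eq_bigr => T _.
  have -> : \sum_(1 <= m < N.+1) b (Defs.tsize T) m * uexp (at_random f m) =
      \sum_(T' <- trees N) (b (Defs.tsize T) (Defs.tsize T') * f T') * tprob T'.
    rewrite sum_tprob; apply: eq_big_nat => m /andP[m0 _].
    rewrite -uexpZ /uexp; congr (_ / _); apply: eq_bigr => w _.
    by rewrite /at_random tsize_rtree.
  by rewrite mulr_sumr mulr_suml; apply: eq_bigr => T' _; ring.
rewrite sum_tprob; apply: eq_big_nat => k /andP[k0 _].
transitivity (\sum_(1 <= m < N.+1) b k m * uexp (at_random f m) * uexp (at_random f k)).
  rewrite -mulr_suml -uexpZ /uexp; congr (_ / _); apply: eq_bigr => w _.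
  by rewrite /at_random tsize_rtree// mulrC.
by apply: eq_bigr => m _; ring.
Qed.

End quadratic.

(** * Sizes and fringe subtrees in the three classes of trees *)

Section trees.

Lemma bfringe_size t : {in bfringe t, forall S, (0 < bsize S <= bsize t)%N}.
Proof.
elim: t => //= l IHl r IHr S; rewrite inE mem_cat => /or3P[/eqP->|/IHl|/IHr] /=; lia.
Qed.

Lemma bfringe_cons t : (0 < bsize t)%N ->
  exists2 r, bfringe t = t :: r & {in r, forall S, (0 < bsize S < bsize t)%N}.
Proof.
case: t => //= l r _; exists (bfringe l ++ bfringe r) => // S.
by rewrite mem_cat => /orP[]/bfringe_size /=; lia.
Qed.

Lemma finite_bintrees N : finite_set [set t | (bsize t <= N)%N].
Proof.
elim: N => [|N IH].
  apply: (sub_finite_set _ (finite_set1 BEmpty)) => t /=.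
  by case: t.
have fin2 : finite_set ([set t | (bsize t <= N)%N] `*` [set t | (bsize t <= N)%N]).
  exact: finite_setX.
have fin3 : finite_set ([set BEmpty] `|` [set BNode p.1 p.2 | p in
    [set t | (bsize t <= N)%N] `*` [set t | (bsize t <= N)%N]]).
  by rewrite finite_setU; split; [exact: finite_set1|exact: finite_image].
apply: sub_finite_set fin3 => -[|l r] /=; first by left.
by rewrite ltnS => lr; right; exists (l, r) => //=; split => /=; lia.
Qed.

Lemma otree_seq_ind (P : otree -> Prop) :
  (forall ts, foldr (fun t Q => P t /\ Q) True ts -> P (ONode ts)) -> forall t, P t.
Proof.
move=> H; fix IH 1; case=> ts; apply: H.
elim: ts => [|t ts IHts]; [exact: I|split; [exact: IH|exact: IHts]].
Qed.

Lemma rotation_surj T : exists t, rotation t = T.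
Proof.
elim/otree_seq_ind: T => ts; elim: ts => [|c ts IH] /=; first by exists BEmpty.
by move=> [[l <-] /IH[r rE]]; exists (BNode l r); rewrite /= rE.
Qed.

Lemma osize_rotation t : osize (rotation t) = (bsize t).+1.
Proof.
elim: t => //= l IHl r; rewrite IHl; case: (rotation r) => ts /= [->].
by rewrite addSn.
Qed.

Lemma ofringe_size t : {in ofringe t, forall S, (0 < osize S <= osize t)%N}.
Proof.
elim/otree_seq_ind: t => ts IH S /=; rewrite inE => /predU1P[->|]; first by rewrite /= leqnn.
move=> /flattenP[s /mapP[c cts ->] Sc].
have : (0 < osize S <= osize c)%N.
  elim: ts IH cts => //= t ts IHts [IHt IH]; rewrite inE => /predU1P[ct|cts].
    by move: Sc; rewrite ct => /IHt.
  exact: IHts.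
move=> /andP[-> h]; apply: leq_trans h _; apply: leqW.
elim: ts cts {IH} => //= t ts IHts; rewrite inE => /predU1P[->|/IHts h]; first exact: leq_addr.
by apply: leq_trans h _; exact: leq_addl.
Qed.

Lemma ofringe_cons T :
  exists2 r, ofringe T = T :: r & {in r, forall S, (0 < osize S < osize T)%N}.
Proof.
case: T => ts /=; exists (flatten (map ofringe ts)) => // S.
move=> /flattenP[s /mapP[c cts ->] /ofringe_size/andP[-> h]]; rewrite ltnS /=.
apply: leq_trans h _.
elim: ts cts => //= t ts IHts; rewrite inE => /predU1P[->|/IHts h]; first exact: leq_addr.
by apply: leq_trans h _; exact: leq_addl.
Qed.

(** Sums of isomorphism invariants stand in for the multiset of fringe subtrees; the constant 1
    gives the invariance of the size. *)
Lemma oiso_ind_sum (V : nmodType) (g : otree -> V) t u :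
  (forall x y, oiso x y -> g x = g y) -> oiso t u ->
  \sum_(S <- ofringe t) g S = \sum_(S <- ofringe u) g S.
Proof.
move=> gE tu; elim: tu => {t u} ts us vs pvu stv iso IH /=.
rewrite !big_cons; congr (_ + _); first by apply: gE; exact: (OIso pvu stv iso).
rewrite !big_flatten/= !big_map.
rewrite -(perm_big _ pvu)/= (big_nth (ONode [::])) [RHS](big_nth (ONode [::])) stv.
by apply: eq_big_nat => i /andP[_ iv]; apply: IH; rewrite stv.
Qed.

Lemma osize_sum t : osize t = (\sum_(S <- ofringe t) 1)%N.
Proof.
elim/otree_seq_ind: t => ts IH /=; rewrite big_cons big_flatten/= big_map add1n; congr _.+1.
elim: ts IH => [|t ts IHts] /=; first by rewrite big_nil.
by move=> [-> /IHts ->]; rewrite big_cons.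
Qed.

Lemma oiso_osize t u : oiso t u -> osize t = osize u.
Proof. by move=> tu; rewrite !osize_sum; apply: (oiso_ind_sum (g := fun=> 1%N)). Qed.

Lemma pi_utree_eq t u : oiso t u -> \pi_utree%qT t = \pi_utree%qT u.
Proof. by move=> tu; apply/eqmodP/asboolP. Qed.

Lemma oiso_repr t : oiso (repr (\pi_utree%qT t)) t.
Proof.
have : \pi_utree%qT (repr (\pi_utree%qT t)) = \pi_utree%qT t by rewrite reprK.
by move=> /eqmodP/asboolP.
Qed.

Lemma usize_pi t : usize (\pi_utree%qT t) = osize t.
Proof. by apply: oiso_osize; exact: oiso_repr. Qed.

Lemma ufringe_pi (V : nmodType) (f : utree -> V) t :
  \sum_(S <- ufringe (\pi_utree%qT t)) f S = \sum_(S <- ofringe t) f (\pi_utree%qT S).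
Proof.
rewrite /ufringe big_map; apply: oiso_ind_sum (oiso_repr t) => x y xy.
by rewrite (pi_utree_eq xy).
Qed.

Lemma ufringe_cons T :
  exists2 r, ufringe T = T :: r & {in r, forall S, (0 < usize S < usize T)%N}.
Proof.
rewrite /ufringe /usize; have [r -> rT] := ofringe_cons (repr T).
exists (map \pi_utree%qT r); first by rewrite /= reprK.
by move=> _ /mapP[S Sr ->]; rewrite -/(usize _) usize_pi; exact: rT.
Qed.

(** The root of [rotation t] comes from no node of [t], hence the separate term. *)
Lemma tsum_left_rotation (R : realType) (g : otree -> R) t :
  \sum_(S <- ofringe (rotation t)) g S =
  g (rotation t) + tsum (left_toll (fun t => g (rotation t))) t.
Proof.
elim: t => [|l IHl r IHr]; first by rewrite /tsum /= !big_cons !big_nil.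
rewrite tsum_node /= big_cons big_cat/= IHl.
move: IHr; case: (rotation r) => ts /=; rewrite big_cons => /addrI ->.
by rewrite -!addrA.
Qed.

End trees.

(** * Conclusion *)

Section assembly.
Context {R : realType}.
(** [h] is the part of the functional outside the centred toll sum and [d] the shift in size. For
    search trees [d] is 0 and [h] is the constant mu, as [csum] subtracts mu (n + 1) rather than mu
    n; for recursive trees [d] is 1 and [h] is the toll of the root. *)
Variables (phi h : bintree -> R) (c al mu : R) (d : nat).
Hypotheses (phi0 : phi BEmpty = 0) (al0 : 0 <= al) (al2 : al < 1 / 2) (c0 : 0 < c).
Hypotheses (phi_le : toll_le phi c al) (h_le : toll_le h c al) (d1 : (d <= 1)%N).
Hypothesis muE : mu = toll_mu phi.

Let Y t := csum phi mu t + h t.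
Let rho n : R := Num.sqrt n.+1%:R / Num.sqrt (n + d)%:R.

Let cvg_ratio : (fun n => n.+1%:R / (n + d)%:R) @ \oo --> (1 : R).
Proof.
case: d d1 => [|[|//]] _.
  have lim : (fun n => 1 + n.+1%:R^-1) @ \oo --> (1 : R).
    by rewrite -[X in _ --> X]addr0; apply: cvgD; [exact: cvg_cst|exact: cvg_harmonic].
  rewrite -(cvg_shiftS (fun n => n.+1%:R / (n + 0)%:R : R)).
  rewrite (_ : (fun n => n.+2%:R / _) = (fun n => 1 + n.+1%:R^-1))//.
  by apply/funext => n; rewrite addn0 -[n.+2%:R]natr1 mulrDl divff ?pnatr_eq0// mul1r.
rewrite (_ : (fun n => _) = cst 1); first exact: cvg_cst.
by apply/funext => n; rewrite addn1 divff// pnatr_eq0.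
Qed.

Let cvg_rho : rho @ \oo --> (1 : R).
Proof.
rewrite (_ : rho = fun n => Num.sqrt (n.+1%:R / (n + d)%:R)).
  rewrite -[X in _ --> X]sqrtr1; apply: continuous_cvg => //; exact: sqrt_continuous.
by apply/funext => n; rewrite sqrtrM// sqrtrV.
Qed.

Lemma assembly_mean_le n : `|bexp n Y| <= 10 * c * n.+1%:R `^ al.
Proof.
rewrite bexpD; apply: le_trans (ler_normD _ _) _.
have := bexp_csum_le phi0 al0 al2 c0 phi_le n; have := bexp_phi_le h_le n; rewrite muE.
by move: (n.+1%:R `^ al) => p; lra.
Qed.

Let small_ratio : (fun n => n.+1%:R `^ al / n.+1%:R) @ \oo --> (0 : R).
Proof.
rewrite (_ : (fun n => _) = (fun n => n.+1%:R `^ (- (1 - al)))).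
  by apply: cvg_powRN; move: (al2); lra.
apply/funext => n; rewrite opprB powRB ?powRr1//.
by rewrite pnatr_eq0 implybT.
Qed.

Let small_sqrt : (fun n => n.+1%:R `^ al / Num.sqrt n.+1%:R) @ \oo --> (0 : R).
Proof.
rewrite (_ : (fun n => _) = (fun n => n.+1%:R `^ (- (2^-1 - al)))).
  by apply: cvg_powRN; move: (al2); lra.
apply/funext => n; rewrite opprB powRB ?powR12_sqrt//.
by rewrite pnatr_eq0 implybT.
Qed.

Let mean_cvg : (fun n => bexp n Y / (n + d)%:R) @ \oo --> (0 : R).
Proof.
have lim : (fun n => 10 * c * (n.+1%:R `^ al / n.+1%:R) * (n.+1%:R / (n + d)%:R)) @ \oo --> (0 : R).
  rewrite -[X in _ --> X](_ : 10 * c * 0 * 1 = 0); last by rewrite mulr0 mul0r.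
  by apply: cvgM => //; apply: cvgM => //; exact: cvg_cst.
apply/cvgr0Pnorm_le => e e0; move/cvgr0Pnorm_le : lim => /(_ _ e0); apply: filterS => n.
apply: le_trans; apply: le_trans (ler_norm _).
rewrite -!mulrA mulKf ?pnatr_eq0// !mulrA normrM normfV (ger0_norm (ler0n R _)).
by rewrite ler_wpM2r ?invr_ge0// assembly_mean_le.
Qed.

Lemma assembly_mean :
  (fun n => bexp n (fun t => Y t + mu * (n + d)%:R) / (n + d)%:R) @ \oo --> mu.
Proof.
have lim : (fun n => bexp n.+1 Y / (n.+1 + d)%:R + mu) @ \oo --> (mu : R).
  rewrite -[X in _ --> X]add0r; apply: cvgD; last exact: cvg_cst.
  by rewrite (cvg_shiftS (fun n => bexp n Y / (n + d)%:R)).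
rewrite -(cvg_shiftS (fun n => bexp n (fun t => Y t + mu * (n + d)%:R) / (n + d)%:R)).
rewrite (_ : (fun n => bexp _ _ / _) = (fun n => bexp n.+1 Y / (n.+1 + d)%:R + mu))//.
by apply/funext => n /=; rewrite bexpD bexp_cst mulrDl mulfK//.
Qed.

Let second_le : exists C : R, forall n, bexp n (fun t => csum phi mu t ^+ 2) <= C * n.+1%:R.
Proof.
have [C HC] := bexp_csum2_uniform al0 al2; exists (C * c ^+ 2) => n.
by rewrite muE; exact: HC.
Qed.

Let h2_le n : bexp n (fun t => h t ^+ 2) <= c ^+ 2 * (n.+1%:R `^ al) ^+ 2.
Proof.
rewrite -[leRHS](bexp_cst n); apply: ler_bexp => t tn.
rewrite -exprMn -(real_normK (num_real (h t))) lerXn2r ?nnegrE//.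
  by rewrite mulr_ge0 ?powR_ge0// ltW.
by rewrite -tn; exact: h_le.
Qed.

Let pp n : (n.+1%:R `^ al) ^+ 2 = n.+1%:R `^ (al + al) :> R.
Proof. by rewrite expr2 powRD// pnatr_eq0 implybT. Qed.

Let variance_diff : (fun n => (bexp n (fun t => (Y t - bexp n Y) ^+ 2) -
  bexp n (fun t => csum phi mu t ^+ 2)) / n.+1%:R) @ \oo --> (0 : R).
Proof.
have [C HC] := second_le.
pose th : R := 2^-1 - al; have th0 : 0 < th by rewrite /th; move: (al2); lra.
pose D := C + 2 * c ^+ 2 + 100 * c ^+ 2.
have lim : (fun n => D * n.+1%:R `^ (- th)) @ \oo --> (0 : R).
  by rewrite -[X in _ --> X](mulr0 D); apply: cvgM; [exact: cvg_cst|exact: cvg_powRN].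
apply/cvgr0Pnorm_le => e e0; move/cvgr0Pnorm_le : lim => /(_ _ e0); apply: filterS => n.
apply: le_trans; apply: le_trans (ler_norm _).
have n1 : 0 < n.+1%:R :> R by rewrite ltr0n.
(* [eta] is the ratio of n^al to n^(1/2). With this weight both halves of the bound on the cross
   term 2 Y h are O(eta n), which is o(n). *)
pose eta : R := n.+1%:R `^ (- th); have eta0 : 0 < eta by rewrite powR_gt0.
pose p : R := n.+1%:R `^ al.
have pE : p ^+ 2 = eta ^+ 2 * n.+1%:R.
  rewrite pp /eta expr2 -[X in _ * X]powRr1// -!powRD ?pnatr_eq0 ?implybT//.
  by congr powR; rewrite /th; field.
have eta1 : eta <= 1 by rewrite /eta powRN invf_le1 ?powR_gt0// -[leLHS](powRr0 (n.+1%:R : R))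
  ler_powR ?ler1n// ltW.
have -> : bexp n (fun t => (Y t - bexp n Y) ^+ 2) - bexp n (fun t => csum phi mu t ^+ 2) =
    bexp n (fun t => 2 * (csum phi mu t * h t)) + bexp n (fun t => h t ^+ 2) - bexp n Y ^+ 2.
  have -> : bexp n (fun t => (Y t - bexp n Y) ^+ 2) = bexp n (fun t => Y t ^+ 2) - bexp n Y ^+ 2.
    rewrite (@eq_bexp _ n _ (fun t => Y t ^+ 2 + (- 2 * bexp n Y) * Y t + bexp n Y ^+ 2));
      last first.
      by move=> t _; ring.
    by rewrite bexpD bexp_cst bexpD (bexpZ n _ Y); ring.
  rewrite addrAC -bexpB -bexpD; congr (_ - _).
  by apply: eq_bexp => t _; rewrite /Y; ring.
have b1 : `|bexp n (fun t => 2 * (csum phi mu t * h t))| <=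
  eta * (C * n.+1%:R) + c ^+ 2 * p ^+ 2 / eta.
  apply: le_trans (ler_norm_bexp _ _) _.
  apply: (@le_trans _ _ (bexp n (fun t => eta * csum phi mu t ^+ 2 + h t ^+ 2 / eta))).
    apply: ler_bexp => t _; move: (csum _ _ t) (h t) => x y.
    rewrite [leRHS](_ : _ = ((eta * x) ^+ 2 + y ^+ 2) / eta); last by field; rewrite lt0r_neq0.
    rewrite ler_pdivlMr// -[X in _ * X](gtr0_norm eta0) -normrM ler_norml.
    by have := sqr_ge0 (eta * x - y); have := sqr_ge0 (eta * x + y); rewrite !expr2; lra.
  rewrite bexpD bexpZ bexpZr; apply: lerD; first by rewrite ler_wpM2l ?HC// ltW.
  by rewrite ler_wpM2r ?h2_le// invr_ge0 ltW.
have b2 : `|bexp n Y ^+ 2| <= 100 * c ^+ 2 * p ^+ 2.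
  rewrite normrX (_ : 100 * c ^+ 2 * p ^+ 2 = (10 * c * p) ^+ 2); last by ring.
  by rewrite lerXn2r ?nnegrE ?assembly_mean_le// !mulr_ge0 ?powR_ge0// ltW.
have b3 : `|bexp n (fun t => h t ^+ 2)| <= c ^+ 2 * p ^+ 2.
  by rewrite ger0_norm ?h2_le//; apply: bexp_ge0 => t _; exact: sqr_ge0.
rewrite normrM normfV (ger0_norm (ltW n1)) ler_pdivrMr//.
apply: le_trans (ler_normB _ _) _; apply: le_trans (lerD (ler_normD _ _) (lexx _)) _.
apply: le_trans (lerD (lerD b1 b3) b2) _.
rewrite pE -/eta (_ : c ^+ 2 * (eta ^+ 2 * n.+1%:R) / eta = c ^+ 2 * eta * n.+1%:R); last first.
  by field; rewrite lt0r_neq0.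
have k1 : eta ^+ 2 * n.+1%:R <= eta * n.+1%:R by rewrite ler_wpM2r// expr2 ler_piMr// ltW.
have c2 : 0 <= c ^+ 2 by exact: sqr_ge0.
have k2 : c ^+ 2 * (eta ^+ 2 * n.+1%:R) <= c ^+ 2 * (eta * n.+1%:R) by rewrite ler_wpM2l.
by rewrite /D; lra.
Qed.

Lemma assembly_variance :
  (fun n => bexp n (fun t => (Y t - bexp n Y) ^+ 2) / (n + d)%:R) @ \oo --> toll_sigma2 phi.
Proof.
have [_ lim] := toll_sigma2_cvg phi0 al0 al2 c0 phi_le; rewrite -muE in lim.
rewrite -[toll_sigma2 phi](_ : (0 + toll_sigma2 phi) * 1 = _); last by rewrite add0r mulr1.
rewrite (_ : (fun n => _) = (fun n => ((bexp n (fun t => (Y t - bexp n Y) ^+ 2) -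
    bexp n (fun t => csum phi mu t ^+ 2)) / n.+1%:R +
      bexp n (fun t => csum phi mu t ^+ 2) / n.+1%:R) *
    (n.+1%:R / (n + d)%:R))).
  by apply: cvgM => //; apply: cvgD.
by apply/funext => n; rewrite -mulrDl subrK mulrA divfK// pnatr_eq0.
Qed.

(** A shift [kap] of order n^al is negligible against sqrt(n), and leaving it free yields at once
    the centring by the exact mean and the one by n mu. *)
Lemma assembly_clt (kap : nat -> R) (tau x : R) : 0 < tau ->
  (forall n, `|kap n| <= 10 * c * n.+1%:R `^ al) ->
  (fun n => bexp n (fun t => heat tau (x - (Y t - kap n) / Num.sqrt (n + d)%:R))) @ \oo -->
  heat (tau + toll_sigma2 phi) x.
Proof.
move=> tau0 kap_le; have clt := @smooth_clt _ phi c al tau x phi0 al0 al2 c0 phi_le tau0.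
rewrite -muE in clt; have [C HC] := second_le.
set u := fun n => _; set w := fun n => _ in clt.
have -> : u = fun n => w n + (u n - w n) by apply/funext => n; ring.
rewrite -[X in _ --> X]addr0; apply: cvgD => //.
have lim : (fun n => 17 / Num.sqrt tau * ((1 + C) / 2 * `|1 - rho n| +
    11 * c * (n.+1%:R `^ al / Num.sqrt n.+1%:R) * rho n)) @ \oo --> (0 : R).
  rewrite -[X in _ --> X](_ : 17 / Num.sqrt tau * ((1 + C) / 2 * `|1 - 1| + 11 * c * 0 * 1) = 0);
    last first.
    by rewrite subrr normr0 !mulr0 mul0r addr0 mulr0.
  apply: cvgM; first exact: cvg_cst.
  apply: cvgD; last by apply: cvgM => //; apply: cvgM => //; exact: cvg_cst.
  apply: cvgM; first exact: cvg_cst.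
  by apply: cvg_norm; apply: cvgB => //; exact: cvg_cst.
apply/cvgr0Pnorm_le => e e0; move/cvgr0Pnorm_le : lim => /(_ _ e0); apply: filterS => n.
apply: le_trans; apply: le_trans (ler_norm _).
apply: le_trans (bexp_heat_lipschitz (fun t => (Y t - kap n) / Num.sqrt (n + d)%:R)
  (fun t => csum phi mu t / Num.sqrt n.+1%:R) n tau x) _.
rewrite ler_wpM2l ?divr_ge0 ?sqrtr_ge0//.
have r0 : 0 < Num.sqrt n.+1%:R :> R by rewrite sqrtr_gt0.
have rho0 : 0 <= rho n by rewrite divr_ge0 ?sqrtr_ge0.
pose Z t := csum phi mu t / Num.sqrt n.+1%:R.
apply: (@le_trans _ _ (bexp n (fun t => `|Z t| * `|1 - rho n| +
    11 * c * (n.+1%:R `^ al / Num.sqrt n.+1%:R) * rho n))).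
  apply: ler_bexp => t tn.
  have -> : (Y t - kap n) / Num.sqrt (n + d)%:R - csum phi mu t / Num.sqrt n.+1%:R =
      - (Z t * (1 - rho n)) + (h t - kap n) / Num.sqrt n.+1%:R * rho n.
    rewrite /Y /Z /rho; move: (Num.sqrt _)^-1 => s; by field; rewrite lt0r_neq0.
  apply: le_trans (ler_normD _ _) _; rewrite normrN normrM lerD2l normrM (ger0_norm rho0).
  rewrite ler_wpM2r// normrM normfV (gtr0_norm r0) mulrA ler_wpM2r ?invr_ge0 ?sqrtr_ge0//.
  apply: le_trans (ler_normB _ _) _; have := h_le t; rewrite tn; have := kap_le n.
  by move: (_ `^ al) => p; lra.
rewrite bexpD bexp_cst lerD2r bexpZr ler_wpM2r//.
apply: le_trans (bexp_norm_le _ _ ltr01) _.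
rewrite ler_pM2r ?invr_gt0// lerD2l divr1.
rewrite (@eq_bexp _ n _ (fun t => csum phi mu t ^+ 2 / n.+1%:R)); last first.
  by move=> t _; rewrite exprMn exprVn sqr_sqrtr.
by rewrite bexpZr ler_pdivrMr ?ltr0n.
Qed.

End assembly.

(** * Passage from the search tree to the three statements *)

Section conclusion.
Context {R : realType}.

Definition additive_limits (M : random_trees) (F : M -> R) (mu sigma2 : R) :=
  [/\ (fun n => uexp (at_random F n) / n%:R) @ \oo --> mu,
      (fun n => uvar (at_random F n) / n%:R) @ \oo --> sigma2,
      cvg_in_distribution
        (fun n w => (at_random F n w - uexp (at_random F n)) / Num.sqrt n%:R)
        (centered_normal sigma2) &
      cvg_in_distribution
        (fun n w => (at_random F n w - n%:R * mu) / Num.sqrt n%:R)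
        (centered_normal sigma2)].

Lemma additive_limits_of_law (M : random_trees) (F : M -> R) (phi h : bintree -> R) (c al mu : R)
  (d : nat) :
  phi BEmpty = 0 -> 0 <= al -> al < 1 / 2 -> 0 < c -> toll_le phi c al -> toll_le h c al ->
  (d <= 1)%N -> mu = toll_mu phi ->
  (forall n (g : R -> R), uexp (fun w : rspace M (n + d) => g (F (rtree w))) =
     bexp n (fun t => g (csum phi mu t + h t + mu * (n + d)%:R))) ->
  additive_limits F mu (toll_sigma2 phi).
Proof.
move=> phi0 al0 al2 c0 phi_le h_le d1 muE law.
pose Y t := csum phi mu t + h t.
have mean n : uexp (at_random F (n + d)%N) = bexp n Y + mu * (n + d)%:R.
  by rewrite /at_random (law n id) bexpD bexp_cst.
have shift (u : nat -> R) l : (fun n => u (n + d)%N) @ \oo --> (l : R) -> u @ \oo --> l.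
  by move=> H; rewrite -(cvg_shiftn d).
have smooth (kap : nat -> R) : (forall n, `|kap (n + d)%N - mu * (n + d)%:R| <=
  10 * c * n.+1%:R `^ al) ->
    smooth_cvg (fun n (w : rspace M n) => (at_random F n w - kap n) / Num.sqrt n%:R)
      (toll_sigma2 phi).
  move=> kap_le tau x tau0; apply: shift.
  have := @assembly_clt R phi h c al mu d phi0 al0 al2 c0 phi_le h_le d1 muE
    (fun n => kap (n + d)%N - mu * (n + d)%:R) tau x tau0 kap_le.
  rewrite (_ : (fun n => bexp n _) = (fun n => uexp (fun w : rspace M (n + d) =>
    heat tau (x - (at_random F (n + d)%N w - kap (n + d)%N) / Num.sqrt (n + d)%:R))))//.
  apply/funext => n; rewrite /at_random
    (law n (fun z => heat tau (x - (z - kap (n + d)%N) / Num.sqrt (n + d)%:R))).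
  apply: eq_bexp => t _.
  have -> : csum phi mu t + h t - (kap (n + d)%N - mu * (n + d)%:R) =
      csum phi mu t + h t + mu * (n + d)%:R - kap (n + d)%N.
    by move: (csum phi mu t + h t) (kap _) (mu * _) => a b b'; ring.
  by [].
have s20 := toll_sigma2_ge0 phi0 al0 al2 c0 phi_le.
split.
- apply: shift; have := assembly_mean phi0 al0 al2 c0 phi_le h_le d1 muE.
  rewrite (_ : (fun n => bexp n _ / _) = (fun n => uexp (at_random F (n + d)%N) / (n + d)%:R))//.
  by apply/funext => n; rewrite mean bexpD bexp_cst.
- apply: shift; have := assembly_variance phi0 al0 al2 c0 phi_le h_le d1 muE.
  rewrite (_ : (fun n => bexp n _ / _) = (fun n => uvar (at_random F (n + d)%N) / (n + d)%:R))//.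
  apply/funext => n; rewrite /uvar mean /at_random (law n (fun z => (z - _) ^+ 2)); congr (_ / _).
  by apply: eq_bexp => t _; congr (_ ^+ 2); rewrite /Y; ring.
- apply: (@smooth_cvg_distribution _ (rspace M)) => //;
  apply: (smooth (fun n => uexp (at_random F n))) => n.
  by rewrite mean addrK; exact: assembly_mean_le phi0 al0 al2 c0 phi_le h_le muE n.
- apply: (@smooth_cvg_distribution _ (rspace M)) => //; apply: (smooth (fun n => n%:R * mu)) => n.
  by rewrite mulrC subrr normr0 !mulr_ge0 ?powR_ge0// ltW.
Qed.

(** The given [alpha] may be negative and [C] need not be positive; as sizes are at least 1, both
    can be enlarged. *)
Lemma size_bigO_le (M : random_trees) (f : M -> R) (alpha : R) : alpha < 1 / 2 ->
  size_bigO f alpha ->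
  exists al c : R, [/\ 0 <= al, al < 1 / 2, 0 < c &
    forall T, (0 < Defs.tsize T)%N -> `|f T| <= c * (Defs.tsize T)%:R `^ al].
Proof.
move=> a2 [C HC]; exists (Num.max alpha 0), (`|C| + 1); split.
- by rewrite le_max lexx orbT.
- by rewrite gt_max a2; lra.
- by rewrite ltr_wpDl.
move=> T T0; apply: le_trans (HC T T0) _.
apply: (@le_trans _ _ ((`|C| + 1) * (Defs.tsize T)%:R `^ alpha)).
  by rewrite ler_wpM2r ?powR_ge0//; have := ler_norm C; lra.
by rewrite ler_wpM2l ?addr_ge0// ler_powR ?ler1n// le_max lexx.
Qed.

Lemma sum_index1 (u : nat -> R) N : \sum_(1 <= k < N.+1) u k = \sum_(k < N) u k.+1.
Proof. by rewrite big_add1/= big_mkord. Qed.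

Lemma tsum_trunc_toll (phi : bintree -> R) N t : (bsize t <= N)%N ->
  tsum (trunc_toll phi N) t = tsum phi t.
Proof.
move=> tN; rewrite /tsum; apply: eq_big_seq => S /bfringe_size/andP[_ St].
by rewrite /trunc_toll (leq_trans St tN).
Qed.

Lemma bst_case (f : binary_search_trees -> R) (alpha : R) : alpha < 1 / 2 -> size_bigO f alpha ->
  exists mu sigma2 : R,
  [/\ (fun N => \sum_(1 <= k < N.+1) (2 / ((k + 1) * (k + 2))%:R) * uexp (at_random f k)) @ \oo
    --> mu,
      (fun N => quadratic_sum bst_cov f N) @ \oo --> sigma2 &
      additive_limits (additive_functional f) mu sigma2].
Proof.
move=> a2 /(size_bigO_le a2) [al [c [al0 al2 c0 fle]]].
(* [f] is unconstrained at [BEmpty], which is not a tree and never occurs in a fringe. *)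
pose phi (t : bintree) : R := if t is BNode _ _ then f t else 0.
have phi0 : phi BEmpty = 0 by [].
have phiE t : (0 < bsize t)%N -> phi t = f t by case: t.
have phi_le : toll_le phi c al.
  case=> [|l r]; first by rewrite normr0 mulr_ge0 ?powR_ge0// ltW.
  apply: le_trans (fle (BNode l r) _) _ => //; rewrite ler_wpM2l ?(ltW c0)//.
  by rewrite ge0_ler_powR ?nnegrE// ler_nat.
have FE t : additive_functional f t = tsum phi t.
  apply: eq_big_seq => S /bfringe_size/andP[S0 _]; by rewrite phiE.
have lawE n (g : bintree -> R) : uexp (fun w : rspace binary_search_trees n => g (rtree w)) =
  bexp n g.
  by rewrite bexp.unlock.
exists (toll_mu phi), (toll_sigma2 phi); split.
- have [lim _] := toll_mu_cvg al0 al2 c0 phi_le.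
  rewrite -cvg_shiftS in lim; move: lim.
  rewrite (_ : (fun n => _) = (fun N =>
    \sum_(1 <= k < N.+1) 2 / ((k + 1) * (k + 2))%:R * uexp (at_random f k)))//.
  apply/funext => N /=; rewrite sum_index1 big_ord_recl bexp0 phi0 mulr0 add0r.
  apply: eq_bigr => k _; rewrite lift0 /at_random (lawE _ f); congr (_ * _).
  by apply: eq_bexp => t tk; rewrite phiE ?tk.
(* The covariance sum up to size [N] is the variance constant of the toll truncated at [N], so it
   converges by continuity in the toll. *)
- pose bt := (al + 1 / 2) / 2.
  have [albt bt0 bt2] : [/\ al < bt, 0 <= bt & bt < 1 / 2] by rewrite /bt; split; lra.
  have e0 K : 0 < c * K.+1%:R `^ (al - bt) by rewrite mulr_gt0// powR_gt0.
  have e_lim : (fun K => c * K.+1%:R `^ (al - bt)) @ \oo --> (0 : R).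
    rewrite -[0](mulr0 c); apply: cvgM; first exact: cvg_cst.
    by rewrite -[al - bt]opprB; apply: cvg_powRN; lra.
  have lebt : toll_le phi c bt by apply: toll_le_weaken phi_le => //; exact: ltW.
  have psi0 K : trunc_toll phi K BEmpty = 0 by [].
  have lediff K : toll_le (fun t => phi t - trunc_toll phi K t) (c * K.+1%:R `^ (al - bt)) bt.
    by apply: trunc_toll_diff => //; exact: ltW.
  have := toll_sigma2_cvg_seq bt0 bt2 phi0 psi0 c0 lebt e0 e_lim lediff.
  rewrite (_ : (fun N => _) = (fun N => quadratic_sum bst_cov f N))//; apply/funext => N.
  rewrite /bst_cov quadratic_sumE.
  + have tE k t : (k < N)%N -> bsize t = k.+1 -> trunc_toll phi N t = f t.
      by move=> kN tk; rewrite /trunc_toll tk kN phiE// tk.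
    have psiN t : (N < bsize t)%N -> trunc_toll phi N t = 0.
      by move=> Nt; rewrite /trunc_toll leqNgt Nt.
    have aE k : (k < N)%N -> bexp k.+1 (trunc_toll phi N) = uexp (at_random f k.+1).
      by move=> kN; rewrite /at_random (lawE _ f); apply: eq_bexp => t tk; rewrite (tE k).
    rewrite (bst_sigma2_formula (psi0 N) psiN) !sum_index1; congr (_ - _).
      rewrite big_ord_recl bexp0 psi0 mul0r mulr0 add0r; apply: eq_bigr => k _.
      rewrite lift0 /at_random (lawE _ (fun T => f T * (2 * additive_functional f T - f T))).
      congr (_ * _); apply: eq_bexp => t tk.
      by rewrite (tE k)// tsum_trunc_toll ?tk// FE.
    rewrite big_ord_recl bexp0 psi0 big1 ?add0r; last by move=> m _; rewrite mulr0 mul0r.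
    apply: eq_bigr => k _; rewrite sum_index1 big_ord_recl bexp0 psi0 mulr0 add0r.
    by apply: eq_bigr => m _; rewrite !lift0 !aE.
  + by move=> n w _; exact: bsize_bst.
  + exact: bfringe_cons.
  + by move=> K; apply: sub_finite_set (finite_bintrees K) => t /= /andP[].
  + move=> k m; rewrite /bst_beta !(natrM, natrD, natrX).
    by have := ler0n R k; have := ler0n R m => ? ?; field; nonzero.
have c1 : 0 < c + `|toll_mu phi| by rewrite ltr_pwDl.
apply: (@additive_limits_of_law binary_search_trees _ phi (fun=> toll_mu phi) _ al _ 0 phi0 al0
  al2 c1) => //.
- by apply: toll_le_weaken phi_le => //; [rewrite lerDl|exact: ltW].
- move=> t; apply: (@le_trans _ _ ((c + `|toll_mu phi|) * 1)); first by rewrite mulr1 lerDr ltW.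
  by rewrite ler_wpM2l ?(ltW c1)// -[leLHS](powRr0 ((bsize t).+1%:R : R)) ler_powR ?ler1n.
move=> n g; rewrite addn0 (lawE n (fun t => g (additive_functional f t))).
apply: eq_bexp => t tn; rewrite FE /csum tn -[n.+1%:R]natr1; congr g.
by ring.
Qed.

(** Ordered and unordered trees differ only in the map [emb], the rotation or the rotation followed
    by the quotient. *)
Lemma rrt_case (M : random_trees) (emb : bintree -> M) (f : M -> R) (alpha : R) :
  (forall n (g : M -> R), uexp (fun w : rspace M n.+1 => g (rtree w)) =
    bexp n (fun t => g (emb t))) ->
  (forall t, Defs.tsize (emb t) = (bsize t).+1) ->
  (forall T, exists t, emb t = T) ->
  (forall T : M, exists2 r, fringe T = T ::
    r & {in r, forall S, (0 < Defs.tsize S < Defs.tsize T)%N}) ->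
  (forall (g : M -> R) t, additive_functional g (emb t) =
     g (emb t) + tsum (left_toll (fun t => g (emb t))) t) ->
  alpha < 1 / 2 -> size_bigO f alpha ->
  exists mu sigma2 : R,
  [/\ (fun N => \sum_(1 <= k < N.+1) (1 / (k * (k + 1))%:R) * uexp (at_random f k)) @ \oo --> mu,
      (fun N => quadratic_sum (tcov_of rrt_coef rrt_beta) f N) @ \oo --> sigma2 &
      additive_limits (additive_functional f) mu sigma2].
Proof.
move=> lawE embS surj fringeT FE a2 /(size_bigO_le a2) [al [c [al0 al2 c0 fle]]].
pose psi t := f (emb t); pose phi := left_toll psi.
have phi0 : phi BEmpty = 0 by [].
have psi_le : toll_le psi c al by move=> t; rewrite -embS; apply: fle; rewrite embS.
have left_le (u : bintree -> R) e bt : 0 <= e -> 0 <= bt -> toll_le u e bt ->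
  toll_le (left_toll u) e bt.
  move=> e0 bt0 ule [|l r] /=; first by rewrite normr0 mulr_ge0 ?powR_ge0.
  apply: le_trans (ule l) _; rewrite ler_wpM2l//.
  by rewrite ge0_ler_powR ?nnegrE// ler_nat; lia.
have phi_le : toll_le phi c al by apply: left_le => //; exact: ltW.
(* Read off from the law: the event of a wrong size has probability 0, and under the uniform law
   every outcome has positive mass. *)
have tsize_rtree n (w : rspace M n) : (0 < n)%N -> Defs.tsize (rtree w) = n.
  case: n w => // n w _; apply/eqP; rewrite -[_ == _]negbK; apply/negP => wn.
  have := lawE n (fun T => (Defs.tsize T != n.+1)%:R).
  rewrite (@eq_bexp _ n _ (fun=> 0)); last by move=> t tn; rewrite embS tn eqxx.
  rewrite bexp_cst /uexp => /eqP; rewrite mulf_eq0 invr_eq0 pnatr_eq0 => /orP[|/eqP].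
    rewrite psumr_eq0; last by move=> i _; exact: ler0n.
    by move=> /allP/(_ w (mem_index_enum w)) /=; rewrite wn pnatr_eq0.
  by move=> /card0_eq/(_ w).
exists (toll_mu phi), (toll_sigma2 phi); split.
- have [lim _] := toll_mu_cvg al0 al2 c0 phi_le.
  (* Here [psi] is not truncated, so the boundary term of [sum_coef_average] has to be shown to
     vanish: n terms of order n^al over n^2. *)
  have lim0 : (fun n => (\sum_(i < n) bexp i psi) / (n%:R * n.+1%:R)) @ \oo --> (0 : R).
    have h : (fun n => c * n.+1%:R `^ (- (1 - al))) @ \oo --> (0 : R).
      by rewrite -[X in _ --> X](mulr0 c); apply: cvgM; [exact: cvg_cst|apply: cvg_powRN; lra].
    apply/cvgr0Pnorm_le => e e0; move/cvgr0Pnorm_le : h => /(_ _ e0); apply: filterS => -[|n].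
      by move=> _; rewrite big_ord0 mul0r normr0 ltW.
    apply: le_trans; apply: le_trans (ler_norm _).
    have n0 : 0 < n.+1%:R :> R by rewrite ltr0n.
    have n1 : 0 < n.+2%:R :> R by rewrite ltr0n.
    rewrite normrM normfV (@ger0_norm _ (n.+1%:R * n.+2%:R)) ?mulr_ge0// ler_pdivrMr ?mulr_gt0//.
    apply: le_trans (ler_norm_sum _ _ _) _.
    apply: (@le_trans _ _ (\sum_(i < n.+1) c * n.+2%:R `^ al)).
      apply: ler_sum => i _; apply: le_trans (bexp_phi_le psi_le i) _.
      rewrite ler_wpM2l ?(ltW c0)// ge0_ler_powR ?nnegrE// ler_nat.
      by have := ltn_ord i; lia.
    have pE : n.+2%:R `^ al = n.+2%:R `^ (- (1 - al)) * n.+2%:R :> R.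
      rewrite -[X in _ = _ * X]powRr1// -powRD ?pnatr_eq0 ?implybT//.
      by rewrite opprB subrK.
    rewrite sumr_const card_ord pE -mulr_natr; move: (_ `^ _) => p.
    by rewrite le_eqVlt; apply/orP; left; apply/eqP; ring.
  have -> : (fun N => \sum_(1 <= k < N.+1) (1 / (k * (k + 1))%:R) * uexp (at_random f k)) =
      (fun n => \sum_(j < n) bst_coef j * bexp j phi +
        (\sum_(i < n) bexp i psi) / (n%:R * n.+1%:R)).
    apply/funext => n; under [in RHS]eq_bigr do rewrite bexp_left_toll.
    rewrite sum_coef_average subrK sum_index1; apply: eq_bigr => k _.
    rewrite /at_random lawE mulrC; congr (_ * _); rewrite /bst_coef addn1 addn2 addn1.
    by rewrite mulrAC divff// pnatr_eq0.
  by rewrite -[X in _ --> X]addr0; apply: cvgD.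
- pose bt := (al + 1 / 2) / 2.
  have [albt bt0 bt2] : [/\ al < bt, 0 <= bt & bt < 1 / 2] by rewrite /bt; split; lra.
  have e0 K : 0 < c * K.+1%:R `^ (al - bt) by rewrite mulr_gt0// powR_gt0.
  have e_lim : (fun K => c * K.+1%:R `^ (al - bt)) @ \oo --> (0 : R).
    rewrite -[0](mulr0 c); apply: cvgM; first exact: cvg_cst.
    by rewrite -[al - bt]opprB; apply: cvg_powRN; lra.
  have lebt : toll_le phi c bt by apply: toll_le_weaken phi_le => //; exact: ltW.
  have psi0 K : left_toll (trunc_toll psi K) BEmpty = 0 by [].
  have lediff K : toll_le (fun t => phi t - left_toll (trunc_toll psi K) t)
    (c * K.+1%:R `^ (al - bt)) bt.
    have h := left_le _ _ _ (ltW (e0 K)) bt0 (trunc_toll_diff K (ltW c0) (ltW albt) psi_le).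
    by move=> [|l r]; [rewrite subrr; exact: (h BEmpty)|exact: (h (BNode l r))].
  have := toll_sigma2_cvg_seq bt0 bt2 phi0 psi0 c0 lebt e0 e_lim lediff.
  (* A search tree with at most [N] nodes corresponds to a recursive tree with at most [N.+1], hence
     the shifted index. *)
  rewrite -(cvg_shiftS (fun N => quadratic_sum _ f N)).
  rewrite (_ : (fun N => toll_sigma2 _) =
    (fun N => quadratic_sum (tcov_of rrt_coef rrt_beta) f N.+1))//.
  apply/funext => N; rewrite quadratic_sumE//.
  + have tE t : (bsize t <= N)%N -> trunc_toll psi N t = f (emb t) by rewrite /trunc_toll => ->.
    have psiN t : (N.+1 <= bsize t)%N -> trunc_toll psi N t = 0.
      by move=> Nt; rewrite /trunc_toll leqNgt Nt.
    have aE k : (k < N.+1)%N -> bexp k (trunc_toll psi N) = uexp (at_random f k.+1).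
      by move=> kN; rewrite /at_random lawE; apply: eq_bexp => t tk; rewrite tE// tk -ltnS.
    rewrite (left_sigma2_formula psiN) !sum_index1; congr (_ - _); last first.
      apply: eq_bigr => k _; rewrite sum_index1.
      by apply: eq_bigr => m _; rewrite !aE.
    apply: eq_bigr => k _.
    rewrite /at_random (lawE _ (fun T => f T * (2 * additive_functional f T - f T))); congr (_ * _).
      rewrite /bst_coef /rrt_coef addn1 addn2 addn1.
      by rewrite mulrAC divff// pnatr_eq0.
    apply: eq_bexp => t tk; have tN : (bsize t <= N)%N by rewrite tk -ltnS.
    rewrite tE// FE -/(psi t) (_ : tsum (left_toll (trunc_toll psi N)) t = tsum (left_toll psi) t).
      by rewrite /psi; ring.
    apply: eq_big_seq => -[//|l r] /bfringe_size/andP[_ St] /=.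
    by rewrite tE//; move: St => /=; lia.
  + move=> K; apply: sub_finite_set (finite_image emb (finite_bintrees K)) => T /= /andP[_ TK].
    by have [t tT] := surj T; exists t => //=; move: TK; rewrite -tT embS => /ltnW.
  + by move=> k m; rewrite /rrt_beta; congr (_%:R / _%:R); ring.
apply: (@additive_limits_of_law M _ phi psi _ al _ 1 phi0 al0 al2 c0) => //.
move=> n g; rewrite addn1 (lawE n (fun T => g (additive_functional f T))).
apply: eq_bexp => t tn; rewrite FE /csum tn; congr g.
by rewrite -/(psi t) -/phi; ring.
Qed.

End conclusion.

Theorem corollary1p21 (R : realType) :
  (forall (f : binary_search_trees -> R) (alpha : R),
    alpha < 1 / 2 -> size_bigO f alpha ->
    let F := additive_functional f in
    exists mu sigma2 : R,
    [/\ (fun N => \sum_(1 <= k < N.+1) (2 / ((k + 1) * (k + 2))%:R) * uexp (at_random f k))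
          @ \oo --> mu,
        (fun n => uexp (at_random F n) / n%:R) @ \oo --> mu,
        (fun N => quadratic_sum bst_cov f N) @ \oo --> sigma2,
        (fun n => uvar (at_random F n) / n%:R) @ \oo --> sigma2 &
        cvg_in_distribution
          (fun n w => (at_random F n w - uexp (at_random F n)) / Num.sqrt n%:R)
          (centered_normal sigma2) /\
        cvg_in_distribution
          (fun n w => (at_random F n w - n%:R * mu) / Num.sqrt n%:R)
          (centered_normal sigma2)]) /\
  (forall (f : ordered_recursive_trees -> R) (alpha : R),
    alpha < 1 / 2 -> size_bigO f alpha ->
    let F := additive_functional f in
    exists mu sigma2 : R,
    [/\ (fun N => \sum_(1 <= k < N.+1) (1 / (k * (k + 1))%:R) * uexp (at_random f k))
          @ \oo --> mu,
        (fun n => uexp (at_random F n) / n%:R) @ \oo --> mu,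
        (fun N => quadratic_sum ordered_rrt_cov f N) @ \oo --> sigma2,
        (fun n => uvar (at_random F n) / n%:R) @ \oo --> sigma2 &
        cvg_in_distribution
          (fun n w => (at_random F n w - uexp (at_random F n)) / Num.sqrt n%:R)
          (centered_normal sigma2) /\
        cvg_in_distribution
          (fun n w => (at_random F n w - n%:R * mu) / Num.sqrt n%:R)
          (centered_normal sigma2)]) /\
  (forall (f : unordered_recursive_trees -> R) (alpha : R),
    alpha < 1 / 2 -> size_bigO f alpha ->
    let F := additive_functional f in
    exists mu sigma2 : R,
    [/\ (fun N => \sum_(1 <= k < N.+1) (1 / (k * (k + 1))%:R) * uexp (at_random f k))
          @ \oo --> mu,
        (fun n => uexp (at_random F n) / n%:R) @ \oo --> mu,
        (fun N => quadratic_sum unordered_rrt_cov f N) @ \oo --> sigma2,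
        (fun n => uvar (at_random F n) / n%:R) @ \oo --> sigma2 &
        cvg_in_distribution
          (fun n w => (at_random F n w - uexp (at_random F n)) / Num.sqrt n%:R)
          (centered_normal sigma2) /\
        cvg_in_distribution
          (fun n w => (at_random F n w - n%:R * mu) / Num.sqrt n%:R)
          (centered_normal sigma2)]).
Proof.
split=> [f alpha a2 fO /=|].
  have [mu [sigma2 [h1 h2 [h3 h4 h5 h6]]]] := bst_case a2 fO.
  by exists mu, sigma2.
split=> [f alpha a2 fO /=|f alpha a2 fO /=].
  have [|||||mu [sigma2 [h1 h2 [h3 h4 h5 h6]]]] :=
      @rrt_case R ordered_recursive_trees rotation f alpha _ _ _ _ _ a2 fO.
  - by move=> n g; exact: (uexp_rrt n g).
  - exact: osize_rotation.
  - exact: rotation_surj.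
  - exact: ofringe_cons.
  - by move=> g t; exact: tsum_left_rotation.
  by exists mu, sigma2.
have [|||||mu [sigma2 [h1 h2 [h3 h4 h5 h6]]]] :=
    @rrt_case R unordered_recursive_trees (fun t => \pi_utree%qT (rotation t)) f alpha _ _ _ _ _
      a2 fO.
- by move=> n g; exact: (uexp_rrt n (fun t => g (\pi_utree%qT t))).
- by move=> t; rewrite /= usize_pi osize_rotation.
- by move=> T; have [t tT] := rotation_surj (repr T); exists t; rewrite tT reprK.
- exact: ufringe_cons.
- move=> g t; have := @tsum_left_rotation R (fun t => g (\pi_utree%qT t)) t.
  by rewrite -(ufringe_pi g).
by exists mu, sigma2.
Qed.
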